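(* Let $\mathcal C=\mathcal C_\pi$ be the continuous cluster category over a field $\mathbb k$, let $\mathcal T$ be a cluster in $\mathcal C$ and $T\in\mathcal T$. Let $A,B,C,D\in\mathcal T$ be the (nonisomorphic) objects such that the irreducible maps of $\mathcal T$ starting or ending at $T$ are exactly $a:T\to A$, $f:T\to C$ (with source $T$) and $b:B\to T$, $g:D\to T$ (with target $T$), and such that there are distinguished triangles $B\xrightarrow{b}T\xrightarrow{a}A\xrightarrow{c}\Sigma B$ and $D\xrightarrow{g}T\xrightarrow{f}C\xrightarrow{h}\Sigma D$ with $c: A\to\Sigma B\cong B$ and $h: C\to\Sigma D\cong D$ irreducible. Then: (a) Up to isomorphism, there is a unique object $T^*$ of $\mathcal C$ not isomorphic to $T$ such that $\mathcal T^*=(\mathcal T\setminus\{T\})\cup\{T^*\}$ is a cluster. (b) The object $T^*$ is given by the octahedral axiom applied to $B\xrightarrow{b}T\xrightarrow{f}C$ and the two triangles above: there are distinguished triangles $B\xrightarrow{fb}C\to T^*\to\Sigma B$ and $D\xrightarrow{ag}A\to T^*\to\Sigma D$. (c) In particular (as part of the octahedral axiom, and using $\Sigma X\cong X$), there are distinguished triangles $T\to A\oplus C\to T^*\to\Sigma T$ and $T^*\to B\oplus D\to T\to\Sigma T^*$, and these triangles are $\mathrm{add}(\mathcal T\setminus\{T\})$-approximations of $T$ and $T^*$ on the left and right (that is, $T\to A\oplus C$ and $T^*\to B\oplus D$ are left approximations and $A\oplus C\to T^*$ and $B\oplus D\to T$ are right approximations). (d) The morphisms $fb:B\to C$, $C\to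 T^*$, $T^*\to \Sigma B\cong B$, $ag:D\to A$, $A\to T^*$, $T^*\to\Sigma D\cong D$ in the triangles of (b) are irreducible morphisms in $\mathcal T^*$.
   Context: Category $\mathcal C$. Let $R=\mathbb k[[t]]$, $S^1=\mathbb R/2\pi\mathbb Z$. $\mathcal P_{S^1}$ is the additive $R$-category with indecomposable objects $P_{[x]}$, $[x]\in S^1$, and a morphism $e^\alpha:P_{[x]}\to P_{[x+\alpha]}$ for every real $\alpha\ge 0$, with $e^\alpha e^\beta=e^{\alpha+\beta}$ and $e^{2\pi}=$ multiplication by $t$; $\mathrm{Hom}(P_{[x]},P_{[y]})$ is the free $R$-module of rank 1 generated by $e^\alpha$ with $\alpha\ge0$ smallest such that $[x+\alpha]=[y]$. $\mathcal F$ is the category of pairs $(V,d)$, $V\in\mathcal P_{S^1}$, $d\in\mathrm{End}(V)$, $d^2=t$, with morphisms those of $\mathcal P_{S^1}$ commuting with $d$; a sequence in $\mathcal F$ is exact if the underlying sequence in $\mathcal P_{S^1}$ is split exact. For $x\le y\le x+2\pi$ put $E(x,y)=\left(P_{[x]}\oplus P_{[y]},\begin{bmatrix}0&e^{x+2\pi-y}\\ e^{y-x}&0\end{bmatrix}\right)$; then $E(x,y)=E(x+2\pi,y+2\pi)$ and $E(x,y)\cong E(y,x+2\pi)$. It is known that $\mathcal F$ is a Krull–Schmidt Frobenius category whose indecomposables are the objects isomorphic to some $E(x,y)$ and whose indecomposable projective-injectives are those isomorphic to some $E(x,x)$. $\mathcal C=\mathcal C_\pi$ is the stable category of $\mathcal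 F$, with its standard (Happel) triangulated structure and shift $\Sigma$, where $\Sigma E(x,y)=E(y,x+2\pi)\cong E(x,y)$. Isomorphism classes of indecomposables of $\mathcal C$ are the classes of $E(x,y)$, $x<y<x+2\pi$, i.e. unordered pairs of distinct points of $S^1$. Clusters. $\mathcal M$ is the set of isomorphism classes of indecomposables of $\mathcal C$ with the quotient topology from $\{(x,y)\in S^1\times S^1: x\ne y\}$ (an open Moebius band). Two indecomposables $X,Y$ are compatible if $\mathcal C(X,Y)=0$ or $\mathcal C(Y,X)=0$ or $X\cong Y$ (equivalently, the corresponding geodesics of the hyperbolic disc do not cross). A cluster is a subset of $\mathcal M$ that is maximal among sets of pairwise compatible elements and is discrete (every element has an open neighbourhood containing no other element of the set); it is regarded as a full subcategory of $\mathcal C$ by choosing representatives. A nonzero nonisomorphism between objects $T_i,T_j$ of a cluster $\mathcal T$ is irreducible (in $\mathcal T$) if it is not in the span of the compositions $T_i\to Z\to T_j$ of two nonisomorphisms with $Z\in\mathcal T$; irreducible maps are counted up to nonzero scalar. The existence of $A,B,C,D$ and of the maps $a,b,c,f,g,h$ with the stated properties for every $T\in\mathcal T$ is known. *)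

(* Defs.v *)
From HB Require Import structures.
From mathcomp Require Import all_boot all_order all_algebra.
From mathcomp Require Import generic_quotient.
From mathcomp Require Import all_classical all_reals all_analysis.
From mathcomp Require Import ring lra.
Set Implicit Arguments.
Unset Strict Implicit.
Unset Printing Implicit Defensive.
Import Order.TTheory GRing.Theory Num.Theory.
Import numFieldNormedType.Exports.
Local Open Scope quotient_scope.
Local Open Scope classical_set_scope.
Local Open Scope ring_scope.

Record fps (k : fieldType) : Type := Fps { fcoef : nat -> k }.

Notation "'{fps' k }" := (fps k) (at level 0, format "'{fps'  k }") : type_scope.

Section FpsRing.
Variable k : fieldType.
Implicit Types f g h : {fps k}.

Lemma fpsP f g : fcoef f =1 fcoef g <-> f = g.
Proof.
by split=> [|-> //]; case: f g => [f] [g] /= e; congr Fps; apply/funext.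
Qed.

HB.instance Definition _ := gen_eqMixin {fps k}.
HB.instance Definition _ := gen_choiceMixin {fps k}.

Definition fps_zero : {fps k} := Fps (fun=> 0).
Definition fps_opp f : {fps k} := Fps (fun n => - fcoef f n).
Definition fps_add f g : {fps k} := Fps (fun n => fcoef f n + fcoef g n).
Definition fps_one : {fps k} := Fps (fun n => (n == 0)%:R).
Definition fps_mul f g : {fps k} :=
  Fps (fun n => \sum_(i < n.+1) fcoef f i * fcoef g (n - i)%N).

Fact fps_addA : associative fps_add.
Proof. by move=> f g h; apply/fpsP => n /=; rewrite addrA. Qed.
Fact fps_addC : commutative fps_add.
Proof. by move=> f g; apply/fpsP => n /=; rewrite addrC. Qed.
Fact fps_add0 : left_id fps_zero fps_add.
Proof. by move=> f; apply/fpsP => n /=; rewrite add0r. Qed.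
Fact fps_addN : left_inverse fps_zero fps_opp fps_add.
Proof. by move=> f; apply/fpsP => n /=; rewrite addNr. Qed.

HB.instance Definition _ := GRing.isZmodule.Build {fps k}
  fps_addA fps_addC fps_add0 fps_addN.

Local Definition fps_tr N f : {poly k} := \poly_(i < N) fcoef f i.

Local Lemma fps_mulE N f g n : (n < N)%N ->
  fcoef (fps_mul f g) n = (fps_tr N f * fps_tr N g)`_n.
Proof.
move=> nN; rewrite coefM /=; apply: eq_bigr => i _.
rewrite !coef_poly (leq_ltn_trans _ nN) ?leq_ord //.
by rewrite (leq_ltn_trans (leq_subr _ _) nN).
Qed.

Fact fps_mulA : associative fps_mul.
Proof.
move=> f g h; apply/fpsP => n.
transitivity ((fps_tr n.+1 f * (fps_tr n.+1 g * fps_tr n.+1 h))`_n).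
  rewrite coefM; apply: eq_bigr => i _.
  by rewrite coef_poly ltn_ord -(@fps_mulE n.+1) // ltnS leq_subr.
rewrite mulrA coefM; apply: eq_bigr => i _.
by rewrite coef_poly ltnS leq_subr -(@fps_mulE n.+1).
Qed.
Fact fps_mulC : commutative fps_mul.
Proof. by move=> f g; apply/fpsP => n; rewrite !(@fps_mulE n.+1) // mulrC. Qed.
Fact fps_mul1 : left_id fps_one fps_mul.
Proof.
move=> f; apply/fpsP => n /=; rewrite big_ord_recl /= mul1r subn0 big1 ?addr0 //.
by move=> i _; rewrite mul0r.
Qed.
Fact fps_mulDl : left_distributive fps_mul fps_add.
Proof.
move=> f g h; apply/fpsP => n /=; rewrite -big_split /=.
by apply: eq_bigr => i _; rewrite mulrDl.
Qed.
Fact fps_oneN0 : fps_one != 0.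
Proof. by apply/eqP => /fpsP /(_ 0%N) /eqP; rewrite /= oner_eq0. Qed.

HB.instance Definition _ := GRing.Zmodule_isComNzRing.Build {fps k}
  fps_mulA fps_mulC fps_mul1 fps_mulDl fps_oneN0.

Definition fpsC (c : k) : {fps k} := Fps (fun n => if n == 0%N then c else 0).
Definition fpsT : {fps k} := Fps (fun n => (n == 1%N)%:R).
End FpsRing.

Notation "'T" := (@fpsT _) (at level 0) : ring_scope.

Section Circle.
Variable R : realType.
Implicit Types x y : R.

Definition twopi : R := 2 * pi.

Lemma twopi_gt0 : 0 < twopi.
Proof. by rewrite mulr_gt0 ?pi_gt0. Qed.

Lemma twopi_neq0 : twopi != 0.
Proof. by rewrite gt_eqF ?twopi_gt0. Qed.

Definition circle_rel : rel R := fun x y => (x - y) / twopi \is a Num.int.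

Fact circle_refl : reflexive circle_rel.
Proof. by move=> x; rewrite /circle_rel subrr mul0r rpred0. Qed.
Fact circle_sym : symmetric circle_rel.
Proof. by move=> x y; rewrite /circle_rel -opprB mulNr rpredN. Qed.
Fact circle_trans : transitive circle_rel.
Proof.
move=> y x z xy yz; rewrite /circle_rel.
by rewrite -(subrKA y) mulrDl rpredD.
Qed.

Definition circle_equiv := EquivRel circle_rel circle_refl circle_sym circle_trans.

Definition S1 : topologicalType := quotient_topology {eq_quot circle_equiv}.

Definition cls (x : R) : S1 := \pi_({eq_quot circle_equiv})%qT x.
Definition lift1 (p : S1) : R := repr (p : {eq_quot circle_equiv}).

(** [arc p q] is the smallest [a >= 0] such that [p + a = q] on the circle,
    see [arcP] and [arc_min]. *)
Definition arc (p q : S1) : R :=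
  let a := lift1 q - lift1 p in a - twopi * (Num.floor (a / twopi))%:~R.

Lemma lift1K p : cls (lift1 p) = p.
Proof. exact: reprK. Qed.

Lemma clsP x y : cls x = cls y <-> circle_rel x y.
Proof. by split=> [/eqmodP//|xy]; apply/eqmodP. Qed.

Lemma clsD2pi x (m : int) : cls (x + twopi * m%:~R) = cls x.
Proof.
by apply/clsP; rewrite /circle_rel addrAC subrr add0r mulrAC divff ?twopi_neq0 // mul1r intr_int.
Qed.

Lemma arc_ge0 p q : 0 <= arc p q.
Proof.
rewrite /arc subr_ge0 mulrC -ler_pdivlMr ?twopi_gt0 //; exact: floor_le.
Qed.

Lemma arc_lt p q : arc p q < twopi.
Proof.
rewrite /arc ltrBlDr -[X in _ < X + _]mulr1 -mulrDr mulrC -ltr_pdivrMr ?twopi_gt0 //.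
by have := floorD1_gt ((lift1 q - lift1 p) / twopi); rewrite intrD mulr1z [_%:~R + 1]addrC.
Qed.

Lemma arcP p q x : cls x = p -> cls (x + arc p q) = q.
Proof.
move=> <-; rewrite /arc -[RHS]lift1K.
have /clsP xp : cls x = cls (lift1 (cls x)) by rewrite lift1K.
move: xp; rewrite /circle_rel => /intrP [m /(canRL (divfK twopi_neq0)) e].
set n := Num.floor _.
rewrite -[RHS](clsD2pi _ (m - n)); congr cls.
by rewrite intrB mulrBr [_ * m%:~R]mulrC -e; ring.
Qed.

Lemma arc_min x a : 0 <= a ->
  a = arc (cls x) (cls (x + a)) + twopi * (`|Num.floor (a / twopi)|%N)%:R.
Proof.
move=> a0; set b := arc _ _.
have /clsP : cls (x + b) = cls (x + a) by apply: arcP.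
rewrite /circle_rel => /intrP [m /(canRL (divfK twopi_neq0)) e].
have {e} e : a = b - m%:~R * twopi by rewrite -e; ring.
have -> : Num.floor (a / twopi) = - m.
  apply/eqP; rewrite floor_eq ler_pdivlMr ?twopi_gt0 // ltr_pdivrMr ?twopi_gt0 //.
  have := arc_ge0 (cls x) (cls (x + a)); have := arc_lt (cls x) (cls (x + a)).
  rewrite -/b intrD mulr1z intrN e => b2 b0; apply/andP; split; first by rewrite mulNr; lra.
  by rewrite mulrDl mulNr mul1r; lra.
have m0 : 0 <= - m.
  have := arc_lt (cls x) (cls (x + a)); rewrite -/b => b2.
  have : - 1 < (- m)%:~R :> R.
    rewrite -(ltr_pM2r twopi_gt0) intrN !mulNr mul1r; lra.
  by rewrite (_ : -1 = (-1)%:~R) // ltr_int; case: (- m) => // -[].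
rewrite -[RHS]/(b + twopi * (`|- m|%N)%:~R) gez0_abs // intrN e; ring.
Qed.

(** Correction exponent: [e^(arc q r) e^(arc p q) = t^(wrap p q r) e^(arc p r)],
    since [e^(2 pi)] is multiplication by [t]; see [wrapP]. *)
Definition wrap (p q r : S1) : bool := twopi <= arc p q + arc q r.

Lemma wrapP p q r : arc p q + arc q r = arc p r + twopi * (wrap p q r)%:R.
Proof.
set a := _ + _.
have a0 : 0 <= a by rewrite addr_ge0 ?arc_ge0.
have ep : cls (lift1 p + a) = r.
  rewrite /a addrA; apply: arcP; apply: arcP; exact: lift1K.
rewrite [LHS](arc_min (lift1 p) a0) ep lift1K; congr (_ + _ * _%:R).
have a2 : a < 2 * twopi.
  by have := arc_lt p q; have := arc_lt q r; rewrite /a; lra.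
rewrite /wrap -/a; case: leP => h.
  suff -> : Num.floor (a / twopi) = 1 by [].
  apply/eqP; rewrite floor_eq ler_pdivlMr ?twopi_gt0 // ltr_pdivrMr ?twopi_gt0 //.
  by rewrite mul1r h.
suff -> : Num.floor (a / twopi) = 0 by [].
apply/eqP; rewrite floor_eq ler_pdivlMr ?twopi_gt0 // ltr_pdivrMr ?twopi_gt0 //.
by rewrite mul0r a0 mul1r.
Qed.

End Circle.

Section CircleMore.
Variable R : realType.

Lemma arc_refl (p : S1 R) : arc p p = 0.
Proof. by rewrite /arc subrr mul0r floor0 mulr0 subrr. Qed.

Lemma wrap_l (p q : S1 R) : wrap p p q = false.
Proof. by rewrite /wrap arc_refl add0r leNgt arc_lt. Qed.

Lemma wrap_r (p q : S1 R) : wrap p q q = false.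
Proof. by rewrite /wrap arc_refl addr0 leNgt arc_lt. Qed.

Lemma wrap_cocycle (p q r s : S1 R) :
  (wrap p q r + wrap p r s = wrap q r s + wrap p q s)%N.
Proof.
apply/eqP; rewrite -(eqr_nat R) -(inj_eq (mulfI (twopi_neq0 R))) !natrD !mulrDr.
apply/eqP; have := wrapP p q r; have := wrapP p r s; have := wrapP q r s.
by have := wrapP p q s; lra.
Qed.
End CircleMore.

(** Category [P_{S^1}]: an object is a finite direct sum of objects [P_[x]].  The entry [F i j] of
    a morphism is the coefficient, in [k[[t]]], of the generator
    [e^(arc _ _)] of [Hom(P_(ppt j), P_(ppt i))]. *)

Section CategoryP.
Variables (k : fieldType) (R : realType).

Record pobj := PObj { prk : nat; ppt : 'I_prk -> S1 R }.

Definition pmor (U V : pobj) : Type := 'M[{fps k}]_(prk V, prk U).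

HB.instance Definition _ U V :=
  GRing.Lmodule.copy (pmor U V) 'M[{fps k}]_(prk V, prk U).

Definition pid (U : pobj) : pmor U U := 1%:M.

Definition pcomp (U V W : pobj) (G : pmor V W) (F : pmor U V) : pmor U W :=
  \matrix_(i, j) \sum_l 'T ^+ wrap (ppt j) (ppt l) (ppt i) * (G i l * F l j).

Implicit Types U V W X : pobj.

Lemma pcomp1l U V (F : pmor U V) : pcomp (pid V) F = F.
Proof.
apply/matrixP => i j; rewrite mxE (bigD1 i) //= big1 => [|l li].
  by rewrite mxE eqxx wrap_r expr0 !mul1r addr0.
by rewrite mxE eq_sym (negbTE li) mul0r mulr0.
Qed.

Lemma pcomp1r U V (F : pmor U V) : pcomp F (pid U) = F.
Proof.
apply/matrixP => i j; rewrite mxE (bigD1 j) //= big1 => [|l lj].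
  by rewrite mxE eqxx wrap_l expr0 mul1r mulr1 addr0.
by rewrite mxE (negbTE lj) !mulr0.
Qed.

Lemma pcompA U V W X (H : pmor W X) (G : pmor V W) (F : pmor U V) :
  pcomp H (pcomp G F) = pcomp (pcomp H G) F.
Proof.
apply/matrixP => i j; rewrite !mxE.
under eq_bigr => l _ do rewrite mxE !mulr_sumr.
rewrite exchange_big; apply: eq_bigr => m _; rewrite mxE mulr_suml mulr_sumr.
apply: eq_bigr => l _.
have := wrap_cocycle (ppt j) (ppt m) (ppt l) (ppt i).
move=> /(congr1 (fun n => 'T ^+ n : {fps k})); rewrite !exprD.
move: ('T ^+ _) ('T ^+ _) ('T ^+ _) ('T ^+ _) => u v w z e.
move: (H i l) (G l m) (F m j) => p q r.
transitivity (z * w * (p * q * r)); first by ring.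
by rewrite e; ring.
Qed.

Lemma pcompDl U V W (G G' : pmor V W) (F : pmor U V) :
  pcomp (G + G') F = pcomp G F + pcomp G' F.
Proof.
apply/matrixP => i j; rewrite !mxE -big_split; apply: eq_bigr => l _ /=.
by rewrite mxE mulrDl mulrDr.
Qed.

Lemma pcompDr U V W (G : pmor V W) (F F' : pmor U V) :
  pcomp G (F + F') = pcomp G F + pcomp G F'.
Proof.
apply/matrixP => i j; rewrite !mxE -big_split; apply: eq_bigr => l _ /=.
by rewrite mxE !mulrDr.
Qed.

Lemma pcompZl U V W c (G : pmor V W) (F : pmor U V) :
  pcomp (c *: G) F = c *: pcomp G F.
Proof.
apply/matrixP => i j; rewrite !mxE mulr_sumr; apply: eq_bigr => l _ /=.
by rewrite mxE; move: ('T ^+ _) => u; ring.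
Qed.

Lemma pcompZr U V W c (G : pmor V W) (F : pmor U V) :
  pcomp G (c *: F) = c *: pcomp G F.
Proof.
apply/matrixP => i j; rewrite !mxE mulr_sumr; apply: eq_bigr => l _ /=.
by rewrite mxE; move: ('T ^+ _) => u; ring.
Qed.

Lemma pcomp0l U V W (F : pmor U V) : pcomp (0 : pmor V W) F = 0.
Proof. by rewrite -[0 in LHS](scale0r 0) pcompZl scale0r. Qed.

Lemma pcomp0r U V W (G : pmor V W) : pcomp G (0 : pmor U V) = 0.
Proof. by rewrite -[0 in LHS](scale0r 0) pcompZr scale0r. Qed.

Lemma pcompNl U V W (G : pmor V W) (F : pmor U V) : pcomp (- G) F = - pcomp G F.
Proof. by rewrite -scaleN1r pcompZl scaleN1r. Qed.

Lemma pcompNr U V W (G : pmor V W) (F : pmor U V) : pcomp G (- F) = - pcomp G F.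
Proof. by rewrite -scaleN1r pcompZr scaleN1r. Qed.

Definition psum U V : pobj :=
  PObj (fun i : 'I_(prk U + prk V) =>
          match fintype.split i with inl u => ppt u | inr v => ppt v end).

Definition pcol U V W (F : pmor U V) (G : pmor U W) : pmor U (psum V W) :=
  col_mx F G.
Definition prow U V W (F : pmor U W) (G : pmor V W) : pmor (psum U V) W :=
  row_mx F G.

Let psumL U V i : @ppt (psum U V) (unsplit (inl i)) = ppt i.
Proof. by rewrite [LHS]/= (unsplitK (inl i)). Qed.
Let psumR U V i : @ppt (psum U V) (unsplit (inr i)) = ppt i.
Proof. by rewrite [LHS]/= (unsplitK (inr i)). Qed.
Let pcolL U V W (F : pmor U V) (G : pmor U W) i j :
  pcol F G (unsplit (inl i)) j = F i j.
Proof. exact: col_mxEu. Qed.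
Let pcolR U V W (F : pmor U V) (G : pmor U W) i j :
  pcol F G (unsplit (inr i)) j = G i j.
Proof. exact: col_mxEd. Qed.
Let prowL U V W (F : pmor U W) (G : pmor V W) i j :
  prow F G i (unsplit (inl j)) = F i j.
Proof. exact: row_mxEl. Qed.
Let prowR U V W (F : pmor U W) (G : pmor V W) i j :
  prow F G i (unsplit (inr j)) = G i j.
Proof. exact: row_mxEr. Qed.

Lemma pcomp_col U V W X (F : pmor V W) (G : pmor V X) (H : pmor U V) :
  pcomp (pcol F G) H = pcol (pcomp F H) (pcomp G H).
Proof.
apply/matrixP => i j; rewrite mxE -(splitK i); case: (fintype.split i) => i'.
  by rewrite pcolL mxE; apply: eq_bigr => l _; rewrite psumL pcolL.
by rewrite pcolR mxE; apply: eq_bigr => l _; rewrite psumR pcolR.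
Qed.

Lemma pcomp_row U V W X (F : pmor U W) (G : pmor V W) (H : pmor W X) :
  pcomp H (prow F G) = prow (pcomp H F) (pcomp H G).
Proof.
apply/matrixP => i j; rewrite mxE -(splitK j); case: (fintype.split j) => j'.
  by rewrite prowL mxE; apply: eq_bigr => l _; rewrite psumL prowL.
by rewrite prowR mxE; apply: eq_bigr => l _; rewrite psumR prowR.
Qed.

Lemma pcomp_row_col U V W X (F : pmor V X) (G : pmor W X)
    (F' : pmor U V) (G' : pmor U W) :
  pcomp (prow F G) (pcol F' G') = pcomp F F' + pcomp G G'.
Proof.
apply/matrixP => i j; rewrite !mxE big_split_ord; congr (_ + _).
  by apply: eq_bigr => l _; rewrite -/(unsplit (inl l)) psumL pcolL prowL.
by apply: eq_bigr => l _; rewrite -/(unsplit (inr l)) psumR pcolR prowR.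
Qed.

Lemma pid_sum U V : pid (psum U V) = pcol (prow (pid U) 0) (prow 0 (pid V)).
Proof. exact: scalar_mx_block. Qed.

Lemma pcol_row U V W X (F : pmor U W) (G : pmor V W) (F' : pmor U X)
    (G' : pmor V X) :
  pcol (prow F G) (prow F' G') = prow (pcol F F') (pcol G G').
Proof. exact: block_mxEh. Qed.

Lemma pcolZ U V W c (F : pmor U V) (G : pmor U W) :
  c *: pcol F G = pcol (c *: F) (c *: G).
Proof. exact: scale_col_mx. Qed.

Lemma prowZ U V W c (F : pmor U W) (G : pmor V W) :
  c *: prow F G = prow (c *: F) (c *: G).
Proof. exact: scale_row_mx. Qed.

Lemma pcolD U V W (F F' : pmor U V) (G G' : pmor U W) :
  pcol F G + pcol F' G' = pcol (F + F') (G + G').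
Proof. exact: add_col_mx. Qed.

Lemma prowD U V W (F F' : pmor U W) (G G' : pmor V W) :
  prow F G + prow F' G' = prow (F + F') (G + G').
Proof. exact: add_row_mx. Qed.

Lemma pcolP U V W (F : pmor U (psum V W)) :
  exists F1 F2, F = pcol F1 F2.
Proof. by exists (usubmx F), (dsubmx F); rewrite [RHS]vsubmxK. Qed.

Lemma prowP U V W (F : pmor (psum U V) W) :
  exists F1 F2, F = prow F1 F2.
Proof. by exists (lsubmx F), (rsubmx F); rewrite [RHS]hsubmxK. Qed.

Lemma pcol_inj U V W (F F' : pmor U V) (G G' : pmor U W) :
  pcol F G = pcol F' G' -> F = F' /\ G = G'.
Proof. exact: eq_col_mx. Qed.

Lemma prow_inj U V W (F F' : pmor U W) (G G' : pmor V W) :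
  prow F G = prow F' G' -> F = F' /\ G = G'.
Proof. exact: eq_row_mx. Qed.

(** Coordinate of [e^a : P_[x] -> P_[x + a]], [a >= 0], on the generator
    [e^(arc [x] [x + a])]; see [arc_min]. *)
Definition epow (a : R) : {fps k} := 'T ^+ `|Num.floor (a / twopi R)|%N.

Lemma epowD x a b : 0 <= a -> 0 <= b ->
  'T ^+ wrap (cls x) (cls (x + a)) (cls (x + a + b)) * (epow b * epow a)
  = epow (a + b).
Proof.
move=> a0 b0; rewrite /epow -!exprD; congr (_ ^+ _).
apply/eqP; rewrite -(eqr_nat R) -(inj_eq (mulfI (twopi_neq0 R))) !natrD !mulrDr.
apply/eqP; have := wrapP (cls x) (cls (x + a)) (cls (x + a + b)).
have := arc_min x a0; have := arc_min (x + a) b0.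
have := arc_min x (addr_ge0 a0 b0); rewrite addrA; lra.
Qed.

Lemma epow2pi : epow (twopi R) = 'T.
Proof. by rewrite /epow divff ?twopi_neq0 // floor1 expr1. Qed.

End CategoryP.

Section CategoryF.
Variables (k : fieldType) (R : realType).

Record fobj := FObj {
  fund :> pobj R;
  fdif : pmor k fund fund;
  fdif2 : pcomp fdif fdif = 'T *: pid k fund }.

Definition fcomm (X Y : fobj) : {pred pmor k X Y} :=
  fun F => pcomp F (fdif X) == pcomp (fdif Y) F.

Fact fcomm_submod X Y : submod_closed (@fcomm X Y).
Proof.
split=> [|c F G /eqP hF /eqP hG]; apply/eqP; first by rewrite pcomp0l pcomp0r.
by rewrite pcompDl pcompDr pcompZl pcompZr hF hG.
Qed.
HB.instance Definition _ (X Y : fobj) :=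
  GRing.isSubmodClosed.Build {fps k} (pmor k X Y) (@fcomm X Y)
    (fcomm_submod X Y).

Record fhom (X Y : fobj) := FHom { fmx :> pmor k X Y; fmxP : fmx \in @fcomm X Y }.

HB.instance Definition _ (X Y : fobj) := [isSub for @fmx X Y].
HB.instance Definition _ (X Y : fobj) := [Choice of fhom X Y by <:].
HB.instance Definition _ (X Y : fobj) := [SubChoice_isSubLmodule of fhom X Y by <:].

Implicit Types X Y Z : fobj.

Fact fid_subproof X : pid k X \in @fcomm X X.
Proof. by apply/eqP; rewrite pcomp1l pcomp1r. Qed.
Definition fid X : fhom X X := FHom (fid_subproof X).

Fact fcomp_subproof X Y Z (g : fhom Y Z) (f : fhom X Y) :
  pcomp (g : pmor k Y Z) (f : pmor k X Y) \in @fcomm X Z.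
Proof.
case: g f => [g /eqP hg] [f /eqP hf] /=.
by apply/eqP; rewrite -pcompA hf pcompA hg -pcompA.
Qed.
Definition fcomp X Y Z (g : fhom Y Z) (f : fhom X Y) : fhom X Z :=
  FHom (fcomp_subproof g f).

Fact fsum_subproof X Y :
  let d : pmor k (psum X Y) (psum X Y) :=
    pcol (prow (fdif X) 0) (prow 0 (fdif Y)) in
  pcomp d d = 'T *: pid k (psum X Y).
Proof.
rewrite /= pcomp_col !pcomp_row_col !pcomp0l addr0 add0r !pcomp_row !pcomp0r.
by rewrite !fdif2 pid_sum pcolZ !prowZ !scaler0.
Qed.
Definition fsum X Y : fobj := FObj (fsum_subproof X Y).

Fact fcol_subproof X Y Z (f : fhom X Y) (g : fhom X Z) :
  pcol (f : pmor k X Y) (g : pmor k X Z) \in @fcomm X (fsum Y Z).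
Proof.
case: f g => [f /eqP hf] [g /eqP hg] /=; apply/eqP.
by rewrite pcomp_col hf hg /= pcomp_col !pcomp_row_col !pcomp0l addr0 add0r.
Qed.
Definition fcol X Y Z (f : fhom X Y) (g : fhom X Z) : fhom X (fsum Y Z) :=
  FHom (fcol_subproof f g).

Fact frow_subproof X Y Z (f : fhom X Z) (g : fhom Y Z) :
  prow (f : pmor k X Z) (g : pmor k Y Z) \in @fcomm (fsum X Y) Z.
Proof.
case: f g => [f /eqP hf] [g /eqP hg] /=; apply/eqP.
rewrite pcomp_row -hf -hg /= pcol_row pcomp_row !pcomp_row_col.
by rewrite !pcomp0r addr0 add0r.
Qed.
Definition frow X Y Z (f : fhom X Z) (g : fhom Y Z) : fhom (fsum X Y) Z :=
  FHom (frow_subproof f g).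

Fact fzero_subproof :
  let U := PObj (fun i : 'I_0 => cls (0 : R)) in
  pcomp (0 : pmor k U U) 0 = 'T *: pid k U.
Proof. by apply/matrixP => -[]. Qed.
Definition fzero : fobj := FObj fzero_subproof.

(** [r] and [s] split the sequence in [P_{S^1}]; they need not commute with the
    differentials. *)
Definition exact_seq X Y Z (f : fhom X Y) (g : fhom Y Z) : Prop :=
  fcomp g f = 0 /\
  exists (r : pmor k Y X) (s : pmor k Z Y),
    [/\ pcomp r (f : pmor k X Y) = pid k X, pcomp (g : pmor k Y Z) s = pid k Z
      & pcomp (f : pmor k X Y) r + pcomp s (g : pmor k Y Z) = pid k Y].

Definition projective_obj P : Prop :=
  forall X Y Z (f : fhom X Y) (g : fhom Y Z), exact_seq f g ->
  forall h : fhom P Z, exists h' : fhom P Y, fcomp g h' = h.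

Definition injective_obj I : Prop :=
  forall X Y Z (f : fhom X Y) (g : fhom Y Z), exact_seq f g ->
  forall h : fhom X I, exists h' : fhom Y I, fcomp h' f = h.

Definition E_pt (x y : R) : pobj R :=
  PObj (fun i : 'I_2 => if i == 0 then cls x else cls y).

Definition E_dif (x y : R) : pmor k (E_pt x y) (E_pt x y) :=
  \matrix_(i, j) (if (i == 0) && (j == 1) then epow k (x + twopi R - y)
                  else if (i == 1) && (j == 0) then epow k (y - x) else 0).

Fact E_subproof (x y : R) : x <= y <= x + twopi R ->
  pcomp (E_dif x y) (E_dif x y) = 'T *: pid k (E_pt x y).
Proof.
move=> /andP[xy yx]; have h1 : 0 <= y - x by rewrite subr_ge0.
have h2 : 0 <= x + twopi R - y by rewrite subr_ge0.
have e1 : y - x + (x + twopi R - y) = twopi R by ring.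
have e1' : x + twopi R - y + (y - x) = twopi R by ring.
have e2 : x + (y - x) = y by ring.
have e3 : y + (x + twopi R - y) = x + twopi R * 1%:~R by rewrite mulr1; ring.
have e4 : x + twopi R * 1%:~R + (y - x) = y + twopi R * 1%:~R by ring.
have ex : 'T ^+ wrap (cls x) (cls y) (cls x)
   * (epow k (x + twopi R - y) * epow k (y - x)) = 'T.
  have := epowD k x h1 h2; rewrite e1 e2 e3 clsD2pi => ->; exact: epow2pi.
have ey : 'T ^+ wrap (cls y) (cls x) (cls y)
   * (epow k (y - x) * epow k (x + twopi R - y)) = 'T.
  have := epowD k y h2 h1; rewrite e1' e3 e4 !clsD2pi => ->.
  exact: epow2pi.
apply/matrixP => i j; rewrite mxE big_ord_recl big_ord1 !mxE.
case: i j => [[|[|//]] ?] [[|[|//]] ?] /=;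
  rewrite ?(mul0r, mulr0, mulr1, addr0, add0r); rewrite ?ex ?ey //.
Qed.

Definition E_obj (x y : R) (h : x <= y <= x + twopi R) : fobj :=
  FObj (E_subproof h).

End CategoryF.

Section Stable.
Variables (k : fieldType) (R : realType).
Local Notation obj := (fobj k R).
Implicit Types X Y Z T : obj.

(** [C] has the objects of [F]; its morphisms are those of [F] up to [==s]. *)
Definition stab_eq X Y (f g : fhom X Y) : Prop :=
  exists (P : obj) (u : fhom X P) (v : fhom P Y),
    [/\ projective_obj P, injective_obj P & f - g = fcomp v u].

Local Notation "f ==s g" := (stab_eq f g) (at level 70, no associativity).

Definition stab_iso X Y (f : fhom X Y) : Prop :=
  exists g : fhom Y X, fcomp g f ==s fid X /\ fcomp f g ==s fid Y.

Definition isomorphic X Y : Prop := exists f : fhom X Y, stab_iso f.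

Definition is_zero X : Prop := fid X ==s 0.

Definition indecomposable X : Prop :=
  ~ is_zero X /\
  forall Y Z, isomorphic X (fsum Y Z) -> is_zero Y \/ is_zero Z.

(** Happel's structure on [C] is taken with respect to the conflations
    [(V, d) -> (V + V, [0 t; 1 0]) -> (V, -d)], with maps [(d, 1)] and
    [(1, -d)]; the middle term [hull X] is projective-injective
    ([hull_projective], [hull_injective]).  Thus [susp (V, d) = (V, -d)], which
    is functorial with [susp_map f] having the matrix of [f], and
    [susp E(x, y)] is isomorphic to [E(y, x + 2 pi)], see [susp_E]. *)
Fact susp_subproof X :
  pcomp (- fdif X) (- fdif X) = 'T *: pid k X.
Proof. by rewrite pcompNl pcompNr opprK fdif2. Qed.
Definition susp X : obj := FObj (susp_subproof X).

Fact susp_map_subproof X Y (f : fhom X Y) :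
  (f : pmor k X Y) \in @fcomm _ _ (susp X) (susp Y).
Proof. by have /eqP hf := fmxP f; apply/eqP; rewrite /= pcompNl pcompNr hf. Qed.
Definition susp_map X Y (f : fhom X Y) : fhom (susp X) (susp Y) :=
  FHom (susp_map_subproof f).

Fact hull_subproof X :
  let d : pmor k (psum X X) (psum X X) :=
    pcol (prow 0 ('T *: pid k X)) (prow (pid k X) 0) in
  pcomp d d = 'T *: pid k (psum X X).
Proof.
rewrite /= pcomp_col !pcomp_row_col !pcomp0l addr0 add0r pcompZl !pcomp_row.
by rewrite !pcomp1l pid_sum pcolZ !prowZ !scaler0.
Qed.
Definition hull X : obj := FObj (hull_subproof X).

Fact hull_in_subproof X :
  pcol (fdif X) (pid k X) \in @fcomm _ _ X (hull X).
Proof.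
apply/eqP; rewrite pcomp_col /= pcomp_col !pcomp_row_col !pcomp0l addr0 add0r.
by rewrite fdif2 pcompZl !pcomp1l.
Qed.
Definition hull_in X : fhom X (hull X) := FHom (hull_in_subproof X).

Fact hull_out_subproof X :
  prow (pid k X) (- fdif X) \in @fcomm _ _ (hull X) (susp X).
Proof.
apply/eqP; rewrite pcomp_row /= pcol_row pcomp_row !pcomp_row_col.
by rewrite !pcomp0r addr0 add0r pcompZr !pcomp1r susp_subproof.
Qed.
Definition hull_out X : fhom (hull X) (susp X) := FHom (hull_out_subproof X).

Lemma hull_exact X : exact_seq (hull_in X) (hull_out X).
Proof.
split; first by apply/val_inj; rewrite /= pcomp_row_col pcomp1l pcomp1r subrr.
exists (prow 0 (pid k X)), (pcol (pid k X) 0); split.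
- by rewrite pcomp_row_col pcomp0l add0r pcomp1l.
- by rewrite pcomp_row_col pcomp1l pcomp0r addr0.
- rewrite !pcomp_col !pcomp_row !pcomp0l !pcomp0r !pcomp1l !pcomp1r pid_sum.
  by rewrite pcolD !prowD add0r !addr0 subrr.
Qed.

Lemma hull_projective X : projective_obj (hull X).
Proof.
move=> A B Z f g [_ [r [s [_ gs _]]]] h; have /eqP := fmxP h; case: h => h hP /=.
have [h1 [h2 eh]] := prowP h; rewrite eh in hP *.
rewrite pcol_row pcomp_row !pcomp_row_col !pcomp0r addr0 add0r pcompZr !pcomp1r.
rewrite pcomp_row => /prow_inj [h2E _].
have /eqP gP := fmxP g.
set m := pcomp s h1.
have h'P : prow m (pcomp (fdif B) m) \in @fcomm _ _ (hull X) B.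
  apply/eqP; rewrite /= pcol_row pcomp_row !pcomp_row_col !pcomp0r addr0 add0r.
  by rewrite pcompZr !pcomp1r pcomp_row pcompA fdif2 pcompZl pcomp1l.
exists (FHom h'P); apply/val_inj => /=.
by rewrite pcomp_row pcompA gP -pcompA /m [pcomp g _]pcompA gs pcomp1l h2E.
Qed.

Lemma hull_injective X : injective_obj (hull X).
Proof.
move=> A B Z f g [_ [r [s [rf _ _]]]] h; have /eqP := fmxP h; case: h => h hP /=.
have [h1 [h2 eh]] := pcolP h; rewrite eh in hP *.
rewrite pcomp_col pcomp_col !pcomp_row_col !pcomp0l addr0 add0r pcompZl !pcomp1l.
move=> /pcol_inj [_ h2E].
have /eqP fP := fmxP f.
have h'P : pcol (pcomp (pcomp h2 r) (fdif B)) (pcomp h2 r) \in @fcomm _ _ B (hull X).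
  apply/eqP; rewrite /= !pcomp_col !pcomp_row_col !pcomp0l addr0 add0r.
  by rewrite pcompZl !pcomp1l -pcompA fdif2 pcompZr pcomp1r.
exists (FHom h'P); apply/val_inj => /=.
rewrite pcomp_col -!pcompA -fP rf pcomp1r; congr pcol.
by rewrite [pcomp r _]pcompA rf pcomp1l.
Qed.

Definition is_pushout X Y I Z (i : fhom X I) (f : fhom X Y)
    (m : fhom I Z) (v : fhom Y Z) : Prop :=
  fcomp m i = fcomp v f /\
  forall (Q : obj) (p : fhom I Q) (q : fhom Y Q), fcomp p i = fcomp q f ->
    exists! z : fhom Z Q, fcomp z m = p /\ fcomp z v = q.

(** [v : Y -> Z] is the pushout of [hull_in X] along [f], and [w] is induced
    by [hull_out X] on [hull X] and by [0] on [Y]. *)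
Definition std_triangle X Y Z (f : fhom X Y) (v : fhom Y Z)
    (w : fhom Z (susp X)) : Prop :=
  exists m : fhom (hull X) Z,
    [/\ is_pushout (hull_in X) f m v, fcomp w m = hull_out X & fcomp w v = 0].

Definition distinguished X Y Z (f : fhom X Y) (v : fhom Y Z)
    (w : fhom Z (susp X)) : Prop :=
  exists (X' Y' Z' : obj) (f' : fhom X' Y') (v' : fhom Y' Z')
    (w' : fhom Z' (susp X')) (x : fhom X X') (y : fhom Y Y') (z : fhom Z Z'),
    [/\ std_triangle f' v' w', [/\ stab_iso x, stab_iso y & stab_iso z],
        fcomp y f ==s fcomp f' x, fcomp z v ==s fcomp v' y
      & fcomp (susp_map x) w ==s fcomp w' z].

(** A set of objects of [C] up to isomorphism is a set [S] of isomorphism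
    classes; an object [X] belongs to the corresponding (replete) full
    subcategory when [S (iso_class X)]. *)
Definition iso_class X : set obj := [set Y | isomorphic X Y].

Definition moebius : set (set obj) :=
  [set c | exists X, indecomposable X /\ c = iso_class X].

Fact E_pair_subproof (p q : S1 R) :
  lift1 p <= lift1 p + arc p q <= lift1 p + twopi R.
Proof. by rewrite lerDl arc_ge0 lerD2l ltW ?arc_lt. Qed.

(** [E(x,y)] for the representatives [x] of [p] and [y] of [q], with
    [x <= y < x + 2 pi]; up to equality, it does not depend on the choice of
    [x] as [E(x + 2 pi, y + 2 pi) = E(x, y)]. *)
Definition E_pair (p q : S1 R) : obj := E_obj k (E_pair_subproof p q).

(** Quotient topology along [(p, q) |-> E_pair p q] from the subspace [p != q]
    of the torus. *)
Definition moebius_open (U : set (set obj)) : Prop :=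
  U `<=` moebius /\
  exists2 O : set (S1 R * S1 R), open O &
    forall p q : S1 R, p <> q -> (O (p, q) <-> U (iso_class (E_pair p q))).

Definition hom_zero X Y : Prop := forall f : fhom X Y, f ==s 0.

Definition compatible X Y : Prop :=
  [\/ hom_zero X Y, hom_zero Y X | isomorphic X Y].

Definition pairwise_compatible (S : set (set obj)) : Prop :=
  forall X Y, S (iso_class X) -> S (iso_class Y) -> compatible X Y.

Definition is_cluster (S : set (set obj)) : Prop :=
  [/\ S `<=` moebius,
      pairwise_compatible S,
      forall S' : set (set obj), S' `<=` moebius -> pairwise_compatible S' ->
        S `<=` S' -> S' = S
    & forall c, S c -> exists U, [/\ moebius_open U, U c & U `&` S = [set c]]].

Definition in_span (S : set (set obj)) X Y (f : fhom X Y) : Prop :=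
  exists (n : nat) (l : 'I_n -> k) (Z : 'I_n -> obj)
    (p : forall i, fhom X (Z i)) (q : forall i, fhom (Z i) Y),
    (forall i, [/\ S (iso_class (Z i)), ~ stab_iso (p i) & ~ stab_iso (q i)]) /\
    f ==s \sum_(i < n) fpsC (l i) *: fcomp (q i) (p i).

Definition irreducible (S : set (set obj)) X Y (f : fhom X Y) : Prop :=
  [/\ S (iso_class X), S (iso_class Y), ~ f ==s 0, ~ stab_iso f
    & ~ in_span S f].

(** [f : X -> susp Y] is irreducible in [S] once [susp Y] is identified
    with [Y] by [s]. *)
Definition irreducible_susp S X Y (s : fhom (susp Y) Y) (f : fhom X (susp Y))
    : Prop :=
  stab_iso s /\ irreducible S (fcomp s f).

(** Equality up to a nonzero scalar and the choice of the representative of the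
    isomorphism class of the target (resp. of the source). *)
Definition eq_target X Y Y' (f : fhom X Y) (f' : fhom X Y') : Prop :=
  exists (s : fhom Y Y') (c : k),
    [/\ stab_iso s, c != 0 & f' ==s fpsC c *: fcomp s f].

Definition eq_source X X' Y (f : fhom X Y) (f' : fhom X' Y) : Prop :=
  exists (s : fhom X' X) (c : k),
    [/\ stab_iso s, c != 0 & f' ==s fpsC c *: fcomp f s].

Definition in_add (S : set (set obj)) X : Prop :=
  exists (X' : obj) (s : seq obj),
    (forall i, (i < size s)%N -> S (iso_class (nth (fzero k R) s i))) /\
    isomorphic (fsum X X') (foldr (@fsum k R) (fzero k R) s).

Definition left_approx (S : set (set obj)) X Y (f : fhom X Y) : Prop :=
  in_add S Y /\
  forall Z, in_add S Z -> forall g : fhom X Z,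
    exists h : fhom Y Z, g ==s fcomp h f.

Definition right_approx (S : set (set obj)) X Y (f : fhom X Y) : Prop :=
  in_add S X /\
  forall Z, in_add S Z -> forall g : fhom Z Y,
    exists h : fhom Z X, g ==s fcomp f h.

Definition exchange (S : set (set obj)) T T' : set (set obj) :=
  (S `\ iso_class T) `|` [set iso_class T'].

(** Octahedron on [X -f-> Y -g-> Z], the third vertex of the triangle over [g]
    being written [susp W]: given the triangles [X -> Y -> A -> susp X] and
    [W -> Y -> Z -> susp W], the vertex [V] completes
    [X -> Z -> V -> susp X] and [W -> A -> V -> susp W]. *)
Definition octahedron X Y Z A W V
    (f : fhom X Y) (i : fhom Y A) (i' : fhom A (susp X))
    (j : fhom W Y) (g : fhom Y Z) (j' : fhom Z (susp W))
    (u : fhom Z V) (u' : fhom V (susp X))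
    (v : fhom A V) (v' : fhom V (susp W)) : Prop :=
  [/\ distinguished f i i' /\ distinguished j g j',
      distinguished (fcomp g f) u u',
      distinguished (fcomp i j) v v',
      fcomp v i ==s fcomp u g /\ fcomp (susp_map f) u' ==s - fcomp (susp_map j) v'
    & fcomp u' v ==s i' /\ fcomp v' u ==s j'].

End Stable.

Section ShiftE.
Variables (k : fieldType) (R : realType).

Lemma susp_E (x y : R) (h : x <= y <= x + twopi R)
    (h' : y <= x + twopi R <= y + twopi R) :
  exists (f : fhom (susp (E_obj k h)) (E_obj k h')) (g : fhom (E_obj k h') (susp (E_obj k h))),
    fcomp g f = fid _ /\ fcomp f g = fid _.
Proof.
have cx : cls (x + twopi R) = cls x by rewrite -[RHS](clsD2pi x 1) mulr1.
pose F : pmor k (E_pt x y) (E_pt y (x + twopi R)) :=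
  \matrix_(i, j) (if (i == 0) && (j == 1) then 1
                  else if (i == 1) && (j == 0) then -1 else 0).
pose G : pmor k (E_pt y (x + twopi R)) (E_pt x y) :=
  \matrix_(i, j) (if (i == 0) && (j == 1) then -1
                  else if (i == 1) && (j == 0) then 1 else 0).
have e : y + twopi R - (x + twopi R) = y - x by ring.
have FP : F \in @fcomm _ _ (susp (E_obj k h)) (E_obj k h').
  apply/eqP/matrixP => i j; rewrite [LHS]mxE [RHS]mxE !big_ord_recl !big_ord0 !mxE.
  case: i j => [[|[|//]] ?] [[|[|//]] ?] /=; rewrite cx ?e
    ?(wrap_l, wrap_r, expr0) ?(mulr1, mul1r, mulr0, mul0r, mulrN, mulNr, oppr0,
      opprK, addr0, add0r) //.
have GP : G \in @fcomm _ _ (E_obj k h') (susp (E_obj k h)).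
  apply/eqP/matrixP => i j; rewrite [LHS]mxE [RHS]mxE !big_ord_recl !big_ord0 !mxE.
  case: i j => [[|[|//]] ?] [[|[|//]] ?] /=; rewrite cx ?e
    ?(wrap_l, wrap_r, expr0) ?(mulr1, mul1r, mulr0, mul0r, mulrN, mulNr, oppr0,
      opprK, addr0, add0r) //.
exists (FHom FP), (FHom GP); split; apply/val_inj/matrixP => i j /=;
  rewrite [LHS]mxE [RHS]mxE !big_ord_recl !big_ord0 !mxE;
  case: i j => [[|[|//]] ?] [[|[|//]] ?] /=; rewrite ?cx
    ?(wrap_l, wrap_r, expr0) ?(mulr1, mul1r, mulr0, mul0r, mulrN, mulNr, oppr0,
      opprK, addr0, add0r) //.
Qed.
End ShiftE.

Notation "f ==s g" := (stab_eq f g) (at level 70, no associativity).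

(* Main.v *)
From HB Require Import structures.
From mathcomp Require Import all_boot all_order all_algebra.
From mathcomp Require Import generic_quotient.
From mathcomp Require Import all_classical all_reals all_analysis.
From mathcomp Require Import ring lra.
Require Import Defs.
From Stdlib Require Setoid.
From Stdlib Require Morphisms.
Set Implicit Arguments.
Unset Strict Implicit.
Unset Printing Implicit Defensive.
Import Order.TTheory GRing.Theory Num.Theory.
Import numFieldNormedType.Exports.
Local Open Scope ring_scope.

(** The stable category is made explicit: a morphism of [F] is stably zero iff
    it has the form [d m + m d] with [m] in [P_{S^1}], and the standard triangles
    are those of mapping cones. The stable morphisms [E(p, q) -> E(r, s)] form a
    space of dimension at most one, nonzero exactly when one of [r], [s] lies in
    the arc [[p, q)] and the other in [[q, p)]; the constant coefficient of one
    matrix entry detects them and is multiplicative for composition. An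
    indecomposable object of the stable category is some [E(p, q)]: a pivot of
    minimal exponent in [d] splits off a direct summand [E(p, q)].

    Hence compatible means noncrossing, and the two given triangles force
    [T, A, B, C, D] to be a diagonal and the sides of an ideal quadrilateral
    whose other diagonal is [T']. The cone [T + (B + D)] of [(b, g) : B + D -> T]
    is isomorphic to [T'] and contains the cones [A] of [b] and [C] of [g], which
    yields the octahedron and all the triangles. The approximations and the
    irreducible maps are read off from the rotations of geodesics about a common
    endpoint. *)

(** * Stable equality as homotopy *)

(** Since d^2 = t, a morphism out of [hull X] is given by one arbitrary matrix of P_{S^1}, its
    restriction to the first summand; this is why factoring through projective-injectives becomes an
    equation f = d m + m d that can be solved entry by entry. The arcs [p, q) and [q, p) appear
    because they decide which exponents [wrap] are 1, that is, which entries of d m + m d are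
    divisible by t. A nonzero map between distinct noncrossing geodesics turns one into the other,
    in the positive direction, about a common endpoint, so whether composites of such maps vanish
    depends only on the order of arcs. Triangles are given only up to stable isomorphism, and
    comparing them with explicit cones takes a substitute for the five lemma. A further obstacle is
    that the triangle T' -> B + D -> T comes as one on [susp B], [susp D] and [susp T]: the
    isomorphisms of these with B, D and T are not canonical and have to be matched with b and g. *)

Section Homotopy.
Variables (k : fieldType) (R : realType).
Local Notation obj := (fobj k R).
Implicit Types X Y Z W : obj.

Definition htpy X Y (m : pmor k X Y) : pmor k X Y :=
  pcomp (fdif Y) m + pcomp m (fdif X).

Lemma fcommE X Y (f : fhom X Y) :
  pcomp (f : pmor k X Y) (fdif X) = pcomp (fdif Y) (f : pmor k X Y).
Proof. exact/eqP/fmxP. Qed.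

Lemma fhomP X Y (f g : fhom X Y) : (f : pmor k X Y) = (g : pmor k X Y) -> f = g.
Proof. exact: val_inj. Qed.

Lemma fmxB X Y (f g : fhom X Y) : fmx (f - g) = fmx f - fmx g.
Proof. exact: (raddfB (val : fhom X Y -> pmor k X Y)). Qed.
Lemma fmxD X Y (f g : fhom X Y) : fmx (f + g) = fmx f + fmx g.
Proof. exact: (raddfD (val : fhom X Y -> pmor k X Y)). Qed.
Lemma fmxN X Y (f : fhom X Y) : fmx (- f) = - fmx f.
Proof. exact: (raddfN (val : fhom X Y -> pmor k X Y)). Qed.
Lemma fmx0 X Y : fmx (0 : fhom X Y) = 0.
Proof. exact: (raddf0 (val : fhom X Y -> pmor k X Y)). Qed.
Lemma fmxZ X Y a (f : fhom X Y) : fmx (a *: f) = a *: fmx f.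
Proof. by []. Qed.

Lemma htpy_comm X Y (m : pmor k X Y) : htpy m \in @fcomm _ _ X Y.
Proof.
apply/eqP; rewrite /htpy pcompDl pcompDr -!pcompA fdif2 [in RHS]pcompA fdif2.
by rewrite pcompZl pcompZr pcomp1l pcomp1r addrC.
Qed.

(** Injectivity of the middle object extends the first factor along [hull_in X], so f - g factors
    through [hull X]. A morphism out of [hull X] has the form (m, d m), and its composite with
    [hull_in X] = (d, 1) is m d + d m. The converse uses the same formula. *)
Lemma stab_eqP X Y (f g : fhom X Y) :
  stab_eq f g <-> exists m : pmor k X Y, fmx f - fmx g = htpy m.
Proof.
split=> [[P [u [v [Pp Pi e]]]]|[m e]].
  have [u' eu] := Pi _ _ _ _ _ (hull_exact X) u.
  have [w ew] : exists w, fcomp w (hull_in X) = f - g.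
    by exists (fcomp v u'); rewrite e -eu; apply: fhomP; rewrite /= pcompA.
  have [w1 [w2 ew2]] := prowP (w : pmor k (hull X) Y).
  have := fcommE w; rewrite ew2 /= pcol_row !pcomp_row !pcomp_row_col.
  rewrite !pcomp0r add0r addr0 pcompZr !pcomp1r => /prow_inj [e2 _].
  exists w1; rewrite -fmxB -ew /= ew2 pcomp_row_col pcomp1r e2 addrC //.
have hP : prow m (pcomp (fdif Y) m) \in @fcomm _ _ (hull X) Y.
  apply/eqP; rewrite /= pcol_row pcomp_row !pcomp_row_col !pcomp0r addr0 add0r.
  by rewrite pcompZr !pcomp1r pcomp_row pcompA fdif2 pcompZl pcomp1l.
exists (hull X), (hull_in X), (FHom hP); split.
- exact: hull_projective.
- exact: hull_injective.
by apply: fhomP; rewrite fmxB e /= pcomp_row_col pcomp1r addrC.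
Qed.

Lemma htpy0 X Y : htpy (0 : pmor k X Y) = 0.
Proof. by rewrite /htpy pcomp0l pcomp0r addr0. Qed.
Lemma htpyN X Y (m : pmor k X Y) : htpy (- m) = - htpy m.
Proof. by rewrite /htpy pcompNl pcompNr opprD. Qed.
Lemma htpyD X Y (m n : pmor k X Y) : htpy (m + n) = htpy m + htpy n.
Proof. by rewrite /htpy pcompDl pcompDr addrACA. Qed.
Lemma htpyZ X Y a (m : pmor k X Y) : htpy (a *: m) = a *: htpy m.
Proof. by rewrite /htpy pcompZl pcompZr scalerDr. Qed.

Lemma stab_refl X Y (f : fhom X Y) : f ==s f.
Proof. by apply/stab_eqP; exists 0; rewrite htpy0 subrr. Qed.
Lemma stab_sym X Y (f g : fhom X Y) : f ==s g -> g ==s f.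
Proof.
by move=> /stab_eqP [m e]; apply/stab_eqP; exists (- m); rewrite htpyN -e opprB.
Qed.
Lemma stab_trans X Y (g f h : fhom X Y) : f ==s g -> g ==s h -> f ==s h.
Proof.
move=> /stab_eqP [m e] /stab_eqP [n e']; apply/stab_eqP; exists (m + n).
by rewrite htpyD -e -e' subrKA.
Qed.

Lemma stab_eqE X Y (f g : fhom X Y) : f = g -> f ==s g.
Proof. by move=> ->; apply: stab_refl. Qed.

Lemma stabD X Y (f f' g g' : fhom X Y) :
  f ==s f' -> g ==s g' -> f + g ==s f' + g'.
Proof.
move=> /stab_eqP [m e] /stab_eqP [n e']; apply/stab_eqP; exists (m + n).
by rewrite htpyD -e -e' !fmxD opprD addrACA.
Qed.
Lemma stabN X Y (f f' : fhom X Y) : f ==s f' -> - f ==s - f'.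
Proof.
move=> /stab_eqP [m e]; apply/stab_eqP; exists (- m).
by rewrite htpyN -e !fmxN opprD.
Qed.
Lemma stab_sub0 X Y (f g : fhom X Y) : f - g ==s 0 <-> f ==s g.
Proof. by rewrite !stab_eqP fmxB fmx0 subr0. Qed.
Lemma stabZ X Y a (f f' : fhom X Y) : f ==s f' -> a *: f ==s a *: f'.
Proof.
move=> /stab_eqP [m e]; apply/stab_eqP; exists (a *: m).
by rewrite htpyZ -e !fmxZ scalerBr.
Qed.

Lemma stab_comp X Y Z (g g' : fhom Y Z) (f f' : fhom X Y) :
  g ==s g' -> f ==s f' -> fcomp g f ==s fcomp g' f'.
Proof.
move=> /stab_eqP [m e] /stab_eqP [n e']; apply/stab_eqP.
exists (pcomp m (fmx f) + pcomp (fmx g') n); rewrite /=.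
transitivity (pcomp (fmx g - fmx g') (fmx f) + pcomp (fmx g') (fmx f - fmx f')).
  by rewrite pcompDl pcompDr pcompNl pcompNr subrKA.
rewrite e e' /htpy !pcompDl !pcompDr -!pcompA fcommE.
by rewrite [pcomp (fmx g') (pcomp (fdif Y) n)]pcompA fcommE -!pcompA addrACA.
Qed.

Lemma stab_susp X Y (f f' : fhom X Y) :
  f ==s f' <-> susp_map f ==s susp_map f'.
Proof.
by split=> /stab_eqP [m /= e]; apply/stab_eqP; exists (- m : pmor k X Y);
  rewrite /= e /htpy /= !(pcompNl, pcompNr, opprK).
Qed.

Lemma fcompA X Y Z W (h : fhom Z W) (g : fhom Y Z) (f : fhom X Y) :
  fcomp h (fcomp g f) = fcomp (fcomp h g) f.
Proof. by apply: fhomP; rewrite /= pcompA. Qed.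
Lemma fcomp1l X Y (f : fhom X Y) : fcomp (fid Y) f = f.
Proof. by apply: fhomP; rewrite /= pcomp1l. Qed.
Lemma fcomp1r X Y (f : fhom X Y) : fcomp f (fid X) = f.
Proof. by apply: fhomP; rewrite /= pcomp1r. Qed.
Lemma fcompDl X Y Z (g g' : fhom Y Z) (f : fhom X Y) :
  fcomp (g + g') f = fcomp g f + fcomp g' f.
Proof. apply: fhomP; rewrite [RHS]fmxD.
exact: etrans (congr1 (fun h => pcomp h _) (fmxD _ _)) (pcompDl _ _ _). Qed.
Lemma fcompDr X Y Z (g : fhom Y Z) (f f' : fhom X Y) :
  fcomp g (f + f') = fcomp g f + fcomp g f'.
Proof. apply: fhomP; rewrite [RHS]fmxD.
exact: etrans (congr1 (pcomp _) (fmxD _ _)) (pcompDr _ _ _). Qed.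
Lemma fcompZl X Y Z a (g : fhom Y Z) (f : fhom X Y) :
  fcomp (a *: g) f = a *: fcomp g f.
Proof. by apply: fhomP; rewrite !fmxZ /= pcompZl. Qed.
Lemma fcompZr X Y Z a (g : fhom Y Z) (f : fhom X Y) :
  fcomp g (a *: f) = a *: fcomp g f.
Proof. by apply: fhomP; rewrite !fmxZ /= pcompZr. Qed.
Lemma fcompNl X Y Z (g : fhom Y Z) (f : fhom X Y) : fcomp (- g) f = - fcomp g f.
Proof. by rewrite -scaleN1r fcompZl scaleN1r. Qed.
Lemma fcompNr X Y Z (g : fhom Y Z) (f : fhom X Y) : fcomp g (- f) = - fcomp g f.
Proof. by rewrite -scaleN1r fcompZr scaleN1r. Qed.
Lemma fcomp0l X Y Z (f : fhom X Y) : fcomp (0 : fhom Y Z) f = 0.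
Proof. by rewrite -[0 in LHS](scale0r 0) fcompZl scale0r. Qed.
Lemma fcomp0r X Y Z (g : fhom Y Z) : fcomp g (0 : fhom X Y) = 0.
Proof. by rewrite -[0 in LHS](scale0r 0) fcompZr scale0r. Qed.
Lemma susp_mapM X Y Z (g : fhom Y Z) (f : fhom X Y) :
  susp_map (fcomp g f) = fcomp (susp_map g) (susp_map f).
Proof. exact: fhomP. Qed.
Lemma susp_map1 X : susp_map (fid X) = fid (susp X).
Proof. exact: fhomP. Qed.

End Homotopy.

#[export] Instance stab_equiv k R (X Y : fobj k R) : RelationClasses.Equivalence (@stab_eq k R X Y).
Proof.
by split; [exact: stab_refl|exact: stab_sym|move=> f g h; exact: stab_trans].
Qed.
#[export] Instance fcomp_proper k R (X Y Z : fobj k R) :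
  Morphisms.Proper (Morphisms.respectful (@stab_eq k R Y Z) (Morphisms.respectful (@stab_eq k R X Y) (@stab_eq k R X Z)))
    (@fcomp k R X Y Z).
Proof. by move=> g g' eg f f' ef; apply: stab_comp. Qed.
#[export] Instance susp_map_proper k R (X Y : fobj k R) :
  Morphisms.Proper (Morphisms.respectful (@stab_eq k R X Y) (@stab_eq k R (susp X) (susp Y)))
    (@susp_map k R X Y).
Proof. by move=> f f' /stab_susp. Qed.
#[export] Instance opp_proper k R (X Y : fobj k R) :
  Morphisms.Proper (Morphisms.respectful (@stab_eq k R X Y) (@stab_eq k R X Y))
    (@GRing.opp (fhom X Y)).
Proof. by move=> f f' /stabN. Qed.
#[export] Instance add_proper k R (X Y : fobj k R) :
  Morphisms.Proper (Morphisms.respectful (@stab_eq k R X Y) (Morphisms.respectful (@stab_eq k R X Y) (@stab_eq k R X Y)))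
    (@GRing.add (fhom X Y)).
Proof. by move=> f f' e g g' e'; apply: stabD. Qed.
#[export] Instance scale_proper k R (X Y : fobj k R) a :
  Morphisms.Proper (Morphisms.respectful (@stab_eq k R X Y) (@stab_eq k R X Y))
    (@GRing.scale _ (fhom X Y) a).
Proof. by move=> f f' /stabZ. Qed.

#[export] Hint Extern 0 (stab_eq _ _) => exact: stab_refl : core.

(** * Objects of rank two *)

Section Fps.
Variable k : fieldType.
Implicit Types f g h u : {fps k}.

Definition fshift f : {fps k} := Fps (fun n => fcoef f n.+1).

Lemma fcoefD f g n : fcoef (f + g) n = fcoef f n + fcoef g n.
Proof. by []. Qed.
Lemma fcoefN f n : fcoef (- f) n = - fcoef f n.
Proof. by []. Qed.
Lemma fcoefM0 f g : fcoef (f * g) 0 = fcoef f 0 * fcoef g 0.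
Proof. by rewrite /= big_ord1. Qed.

Lemma fcoefTM f n : fcoef ('T * f) n = if n is n'.+1 then fcoef f n' else 0.
Proof.
case: n => [|n]; first by rewrite fcoefM0 mul0r.
rewrite /= !big_ord_recl /= mul0r add0r mul1r /bump /= subSS subn0.
by rewrite big1 ?addr0 // => i _; rewrite mul0r.
Qed.

Lemma fcoefT_sum (I : Type) (r : seq I) (P : pred I) (F : I -> {fps k}) n :
  fcoef (\sum_(i <- r | P i) F i) n = \sum_(i <- r | P i) fcoef (F i) n.
Proof. by elim/big_rec2: _ => // i x y _ <-. Qed.

Lemma fcoef_Texp (b : bool) f : fcoef ('T ^+ b * f) 0 = if b then 0 else fcoef f 0.
Proof. by case: b; rewrite ?expr1 ?fcoefTM // expr0 mul1r. Qed.

Lemma fshiftP f : fcoef f 0 = 0 -> f = 'T * fshift f.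
Proof. by move=> f0; apply/fpsP => -[|n]; rewrite fcoefTM. Qed.

Lemma fpsT_inj f g : 'T * f = 'T * g -> f = g.
Proof. by move=> /fpsP e; apply/fpsP => n; have := e n.+1; rewrite !fcoefTM. Qed.

Lemma fpsTX_inj m f g : 'T ^+ m * f = 'T ^+ m * g -> f = g.
Proof.
elim: m => [|m IH]; first by rewrite !expr0 !mul1r.
by rewrite !exprS -!mulrA => /fpsT_inj.
Qed.

(* [1 + n] is inverted by the series of the [(- n) ^+ i], whose [i]-th term
   starts in degree [i]. *)
Lemma fps_inv u : fcoef u 0 != 0 -> exists v, v * u = 1.
Proof.
move=> u0.
pose n := 1 - fpsC (fcoef u 0)^-1 * u.
have n0 : fcoef n 0 = 0 by rewrite fcoefD fcoefN fcoefM0 /= mulVf // subrr.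
have low i m : (m < i)%N -> fcoef (n ^+ i) m = 0.
  rewrite (fshiftP n0) exprMn; move: (fshift n ^+ i) => g.
  by elim: i m => // i IH [|m] mi; rewrite exprS -mulrA fcoefTM ?IH.
pose s : {fps k} := Fps (fun m => \sum_(i < m.+1) fcoef (n ^+ i) m).
have sE N m : (m < N)%N -> fcoef s m = fcoef (\sum_(i < N) n ^+ i) m.
  move=> mN; rewrite fcoefT_sum /= (big_ord_widen _ (fun i => fcoef (n ^+ i) m) mN).
  rewrite [RHS](bigID (fun i : 'I_N => (i < m.+1)%N)) /= [X in _ = _ + X]big1 ?addr0 //.
  by move=> i; rewrite -leqNgt => /low.
have e1 : s * (1 - n) = 1.
  apply/fpsP => m; transitivity (fcoef ((\sum_(i < m.+1) n ^+ i) * (1 - n)) m).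
    by apply: eq_bigr => i _; rewrite (sE m.+1).
  by rewrite mulrC -opprB mulNr -subrX1 opprB fcoefD fcoefN low // subr0.
exists (s * fpsC (fcoef u 0)^-1); rewrite -mulrA -[RHS]e1; congr (_ * _).
by rewrite /n opprB addrC subrK.
Qed.
End Fps.

Section Rank1.
Variables (k : fieldType) (R : realType).
Local Notation S1 := (S1 R).
Implicit Types p q r s u v : S1.

(** Going from p to q and on to r completes a turn exactly when r is met before q. So [wrap p q r]
    is the indicator function of the arc [p, q), evaluated at r. *)
Lemma wrapE p q r : wrap p q r = (arc p r < arc p q).
Proof.
have := wrapP p q r; have := arc_lt p q; have := arc_ge0 q r.
have := twopi_gt0 R; have := arc_lt q r.
case: (wrap p q r); rewrite ?mulr1 ?mulr0 => *; apply/esym.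
  by apply/idP; lra.
by apply/negbTE; rewrite -leNgt; lra.
Qed.

Lemma arc_eq0 p q : (arc p q == 0) = (p == q).
Proof.
apply/eqP/eqP => [e|->]; last exact: arc_refl.
by rewrite -[RHS](arcP q (lift1K p)) e addr0 lift1K.
Qed.

Lemma wrap_pqp p q : wrap p q p = (p != q).
Proof. by rewrite wrapE arc_refl lt_def arc_ge0 andbT arc_eq0. Qed.

(** The arcs [p, q) and [q, p) partition the circle. *)
Lemma wrap_qpr p q r : p != q -> wrap q p r = ~~ wrap p q r.
Proof.
move=> pq; have := wrap_cocycle p q p r; rewrite wrap_pqp pq wrap_l.
by case: (wrap p q r); case: (wrap q p r).
Qed.

Lemma arc_inj p : injective (arc p).
Proof. by move=> q r e; rewrite -(arcP q (lift1K p)) e (arcP r (lift1K p)). Qed.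

(** [pt p] is [P_p]; [sm p q c] is the morphism [c e^(arc p q)]. *)
Definition pt p : pobj R := PObj (fun _ : 'I_1 => p).
Definition sm p q (c : {fps k}) : pmor k (pt p) (pt q) := const_mx c.

Lemma smM p q r c c' :
  pcomp (sm q r c) (sm p q c') = sm p r ('T ^+ wrap p q r * (c * c')).
Proof. by apply/matrixP => i j; rewrite !mxE big_ord1 !mxE. Qed.
Lemma sm1 p : pid k (pt p) = sm p p 1.
Proof. by apply/matrixP => i j; rewrite !mxE !ord1. Qed.
Lemma sm0 p q : sm p q 0 = 0.
Proof. by apply/matrixP => i j; rewrite !mxE. Qed.
Lemma smD p q c c' : sm p q c + sm p q c' = sm p q (c + c').
Proof. by apply/matrixP => i j; rewrite !mxE. Qed.
Lemma smZ p q c c' : c *: sm p q c' = sm p q (c * c').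
Proof. by apply/matrixP => i j; rewrite !mxE. Qed.
Lemma sm_inj p q c c' : sm p q c = sm p q c' -> c = c'.
Proof. by move=> /matrixP /(_ 0 0); rewrite !mxE. Qed.
Lemma smP p q (F : pmor k (pt p) (pt q)) : exists c, F = sm p q c.
Proof. by exists (F 0 0); apply/matrixP => i j; rewrite !mxE !ord1. Qed.

Definition pt2 p q : pobj R := psum (pt p) (pt q).

Definition mat4 p q r s (a b c d : {fps k}) : pmor k (pt2 p q) (pt2 r s) :=
  pcol (prow (sm p r a) (sm q r b)) (prow (sm p s c) (sm q s d)).

Lemma mat4P p q r s (F : pmor k (pt2 p q) (pt2 r s)) :
  exists a b c d, F = mat4 p q r s a b c d.
Proof.
have [F1 [F2 ->]] := pcolP F.
have [F11 [F12 ->]] := prowP F1; have [F21 [F22 ->]] := prowP F2.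
have [a ->] := smP F11; have [b ->] := smP F12.
have [c ->] := smP F21; have [d ->] := smP F22.
by exists a, b, c, d.
Qed.

Lemma mat4M p q r s u v a b c d a' b' c' d' :
  pcomp (mat4 r s u v a b c d) (mat4 p q r s a' b' c' d') =
  mat4 p q u v
   ('T ^+ wrap p r u * (a * a') + 'T ^+ wrap p s u * (b * c'))
   ('T ^+ wrap q r u * (a * b') + 'T ^+ wrap q s u * (b * d'))
   ('T ^+ wrap p r v * (c * a') + 'T ^+ wrap p s v * (d * c'))
   ('T ^+ wrap q r v * (c * b') + 'T ^+ wrap q s v * (d * d')).
Proof.
by rewrite /mat4 pcomp_col !pcomp_row_col !pcomp_row !prowD !smM !smD.
Qed.

Lemma mat4D p q r s a b c d a' b' c' d' :
  mat4 p q r s a b c d + mat4 p q r s a' b' c' d' =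
  mat4 p q r s (a + a') (b + b') (c + c') (d + d').
Proof. by rewrite /mat4 pcolD !prowD !smD. Qed.
Lemma mat4Z p q r s e a b c d :
  e *: mat4 p q r s a b c d = mat4 p q r s (e * a) (e * b) (e * c) (e * d).
Proof. by rewrite /mat4 pcolZ !prowZ !smZ. Qed.
Lemma mat4N p q r s a b c d :
  - mat4 p q r s a b c d = mat4 p q r s (- a) (- b) (- c) (- d).
Proof. by rewrite -scaleN1r mat4Z !mulN1r. Qed.
Lemma mat4_1 p q : pid k (pt2 p q) = mat4 p q p q 1 0 0 1.
Proof. by rewrite pid_sum /mat4 !sm0 !sm1. Qed.
Lemma mat4_0 p q r s : mat4 p q r s 0 0 0 0 = 0.
Proof. by rewrite -[RHS](scale0r (mat4 p q r s 0 0 0 0)) mat4Z !mul0r. Qed.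
Lemma mat4_inj p q r s a b c d a' b' c' d' :
  mat4 p q r s a b c d = mat4 p q r s a' b' c' d' ->
  [/\ a = a', b = b', c = c' & d = d'].
Proof.
move=> /pcol_inj [/prow_inj [/sm_inj -> /sm_inj ->]].
by move=> /prow_inj [/sm_inj -> /sm_inj ->].
Qed.

Let j0 : 'I_(1 + 1) := lshift 1 (ord0 : 'I_1).
Let j1 : 'I_(1 + 1) := rshift 1 (ord0 : 'I_1).
Lemma mat4E p q r s a b c d (M := mat4 p q r s a b c d) :
  [/\ M j0 j0 = a, M j0 j1 = b, M j1 j0 = c & M j1 j1 = d].
Proof.
split.
- by rewrite [LHS](@col_mxEu _ 1 1) [LHS](@row_mxEl _ 1 1 1) mxE.
- by rewrite [LHS](@col_mxEu _ 1 1) [LHS](@row_mxEr _ 1 1 1) mxE.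
- by rewrite [LHS](@col_mxEd _ 1 1) [LHS](@row_mxEl _ 1 1 1) mxE.
- by rewrite [LHS](@col_mxEd _ 1 1) [LHS](@row_mxEr _ 1 1 1) mxE.
Qed.

(** For p <> q the two generators already compose to t by [wrap_pqp]; for p = q both are identities
    and t has to be put in. The case p = q is kept because such summands occur, and are discarded,
    when objects are decomposed. *)
Definition Eo_dif p q := mat4 p q p q 0 ('T ^+ (p == q)) 1 0.

Lemma Eo_subproof p q : pcomp (Eo_dif p q) (Eo_dif p q) = 'T *: pid k (pt2 p q).
Proof.
rewrite mat4M mat4_1 mat4Z !(mul0r, mulr0, mul1r, mulr1, add0r, addr0).
rewrite !wrap_pqp [q == p]eq_sym.
by congr mat4; case: (p == q); rewrite ?expr0 ?mul1r ?mulr1.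
Qed.
Definition Eo p q : fobj k R := FObj (Eo_subproof p q).

(** Both exponents arc p q and 2 pi - arc p q lie strictly between 0 and 2 pi, so the entries given
    by [epow] are 1. *)
Lemma E_pairE p q : p != q -> E_pair k p q = Eo p q.
Proof.
move=> pq; rewrite /E_pair.
have FE n (f f' : 'I_n -> S1) (d d' : 'M[{fps k}]_n) h h' :
    f = f' -> d = d' -> @FObj k R (PObj f) d h = @FObj k R (PObj f') d' h'.
  by move=> e; case: _ / e h h' => h h' e; case: _ / e h' => h'; congr FObj.
apply: FE; last first.
  have h0 := arc_ge0 p q; have h1 := arc_lt p q; have t0 := twopi_gt0 R.
  have h2 : arc p q != 0 by rewrite arc_eq0.
  have h3 : 0 < arc p q by rewrite lt_def h2.
  apply/matrixP => i j; rewrite mxE.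
  rewrite /Eo_dif (negbTE pq) expr0.
  have o0 (h : (0 < 2)%N) : Ordinal h = j0 by apply: val_inj.
  have o1 (h : (1 < 2)%N) : Ordinal h = j1 by apply: val_inj.
  have [e00 e01 e10 e11] := mat4E p q p q 0 1 1 0.
  have fl (x : R) : 0 < x < twopi R -> epow k x = 1.
    move=> /andP [x0 x1]; rewrite /epow (_ : Num.floor _ = 0) //.
    by apply/eqP; rewrite floor_eq ler_pdivlMr // ltr_pdivrMr //; lra.
  case: i => [[|[|//]]] hi; case: j => [[|[|//]]] hj; rewrite ?o0 ?o1.
  - by rewrite e00.
  - by rewrite e01 /= fl //; apply/andP; split; lra.
  - by rewrite e10 /= fl //; apply/andP; split; lra.
  - by rewrite e11.
apply/funext => i; rewrite lift1K (arcP q (lift1K p)).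
have o0 (h : (0 < 2)%N) : Ordinal h = j0 by apply: val_inj.
have o1 (h : (1 < 2)%N) : Ordinal h = j1 by apply: val_inj.
case: i => [[|[|//]]] hi; rewrite ?o0 ?o1 /=.
  by rewrite [in RHS](unsplitK (inl _)).
by rewrite [in RHS](unsplitK (inr _)).
Qed.
End Rank1.

(** * Stable morphisms between the E(p, q) *)

Section HomEo.
Variables (k : fieldType) (R : realType).
Local Notation S1 := (S1 R).
Local Notation E := (@Eo k R).
Implicit Types p q r s u v : S1.

(** [r] lies in the arc [[p, q)] and [s] in [[q, p)]. *)
Definition sep p q r s := wrap p q r && ~~ wrap p q s.

Lemma sepC p q r s : p != q -> sep q p s r = sep p q r s.
Proof. by move=> pq; rewrite /sep !(wrap_qpr _ pq) negbK andbC. Qed.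

Lemma Eo_comm p q r s a b c d : p != q -> r != s ->
  mat4 p q r s a b c d \in @fcomm k R (E p q) (E r s) ->
  'T ^+ wrap p q s * d = 'T ^+ wrap p r s * a /\
  'T ^+ wrap p q r * b = 'T ^+ wrap p s r * c.
Proof.
move=> /negbTE pq /negbTE rs /eqP; rewrite /= /Eo_dif pq rs expr0 !mat4M.
by rewrite !(mul0r, mulr0, mul1r, mulr1, add0r, addr0) => /mat4_inj [].
Qed.

(** Separation reads p <= r < q <= s in cyclic order, and then every [wrap] exponent in the
    commutation relation is 0. *)
Lemma diag_comm p q r s : sep p q r s -> r != s -> p != q ->
  mat4 p q r s 1 0 0 1 \in @fcomm k R (E p q) (E r s).
Proof.
move=> /andP [h1 h2] /negbTE rs /negbTE pq; apply/eqP.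
rewrite /= /Eo_dif pq rs expr0 !mat4M !(mul0r, mulr0, mul1r, mulr1, add0r, addr0).
move: h1 h2; rewrite !wrapE => h1 h2.
have -> : (arc q r < arc q p) = false.
  have := @wrap_qpr _ p q r; rewrite !wrapE pq h1 => /(_ isT) -> //.
have -> : (arc q r < arc q s) = false.
  apply/negbTE; have := wrapP p q r; have := wrapP p q s; rewrite !wrapE h1 (negbTE h2) mulr1 mulr0.
  by move: h1 h2; rewrite -!leNgt; have := arc_lt p s; have := arc_ge0 p r; lra.
rewrite (negbTE h2).
have -> // : (arc p s < arc p r) = false.
by apply/negbTE; move: h2; rewrite -!leNgt => h2; apply/ltW/(lt_le_trans h1).
Qed.

(** Existence of the off-diagonal entries [m], [n] of a homotopy for the
    diagonal part [(a, d)] of a morphism. *)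
Lemma diag_htpy p q r s (a d : {fps k}) : p != q ->
  'T ^+ wrap p q s * d = 'T ^+ wrap p r s * a ->
  (sep p q r s -> fcoef a 0 = 0) ->
  exists m n, 'T ^+ wrap p s r * m + 'T ^+ wrap p q r * n = a /\
    'T ^+ wrap q r s * n + 'T ^+ wrap q p s * m = d.
Proof.
move=> pq e a0; have wc := wrap_cocycle p q r s.
(* Since t is cancellable, the relation [e] determines d from a: a homotopy with m = 0 that produces
   a also produces d. *)
have viaN n : 'T ^+ wrap p q r * n = a ->
    exists m n, 'T ^+ wrap p s r * m + 'T ^+ wrap p q r * n = a /\
    'T ^+ wrap q r s * n + 'T ^+ wrap q p s * m = d.
  move=> en; exists 0, n; rewrite !mulr0 add0r addr0; split=> //.
  apply: (@fpsTX_inj _ (wrap p q s)); rewrite e -en !mulrA -!exprD addnC -wc.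
  by rewrite addnC.
have [pqr|pqr] : wrap p q r = false \/ wrap p q r by case: wrap; [right|left].
  by apply: (viaN a); rewrite pqr mul1r.
have [a0'|a0'] := eqVneq (fcoef a 0) 0.
  by apply: (viaN (fshift a)); rewrite pqr -fshiftP.
(* Now a is invertible and r lies in [p, q). Without separation s lies there too, and [e] then
   forces s to come before r as seen from p; both exponents of m are 0, so m = a will do. *)
have pqs : wrap p q s.
  by apply/negPn/negP => h; move: a0'; rewrite a0 ?eqxx // /sep pqr h.
have prs : wrap p r s.
  apply/negPn/negP => h; move: e; rewrite pqs (negbTE h) mul1r expr1 => /fpsP /(_ 0%N).
  by rewrite fcoefTM => /esym /eqP; rewrite (negbTE a0').
exists a, 0; rewrite !mulr0 add0r addr0.
have -> : wrap p s r = false.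
  by move: prs; rewrite !wrapE => h; apply/negbTE; rewrite -leNgt ltW.
rewrite (wrap_qpr _ pq) pqs !mul1r; split=> //.
by move: e; rewrite pqs prs => /fpsTX_inj.
Qed.

(** The diagonal and off-diagonal parts do not interact. Under separation a homotopy enters the
    entry a (or c) only with factors t, so the constant coefficient is an invariant; otherwise
    [diag_htpy] supplies a homotopy. The two separation conditions exclude each other, whence
    dimension at most one. *)
Lemma Eo_null p q r s a b c d (f : fhom (E p q) (E r s)) :
  p != q -> r != s -> fmx f = mat4 p q r s a b c d ->
  (f ==s 0 <-> (sep p q r s -> fcoef a 0 = 0) /\ (sep p q s r -> fcoef c 0 = 0)).
Proof.
move=> pq rs ef; have := fmxP f; rewrite ef => /(Eo_comm pq rs) [e1 e2].
have pqF := negbTE pq; have rsF := negbTE rs.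
rewrite stab_eqP fmx0 subr0; split=> [[m]|[h1 h2]].
  have [m11 [m12 [m21 [m22 ->]]]] := mat4P m.
  rewrite ef /htpy /= /Eo_dif pqF rsF expr0 !mat4M mat4D.
  rewrite !(mul0r, mulr0, mul1r, mulr1, add0r, addr0) => /mat4_inj [ea _ ec _].
  split=> /andP [h h']; [rewrite ea|rewrite ec];
    rewrite fcoefD !fcoef_Texp h ?addr0; case: ifP => // /negP [];
    move: h h'; rewrite !wrapE => h; rewrite -leNgt => h'; exact: lt_le_trans h'.
have [m21 [m12 [ea ed]]] := diag_htpy pq e1 h1.
have [m11 [m22 [ec eb]]] := diag_htpy pq e2 h2.
exists (mat4 p q r s m11 m12 m21 m22).
rewrite ef /htpy /= /Eo_dif pqF rsF expr0 !mat4M mat4D.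
rewrite !(mul0r, mulr0, mul1r, mulr1, add0r, addr0) -ea -ec -ed -eb.
by congr mat4; rewrite // addrC.
Qed.

(** Meaningful under [sep p q r s]: the upper left entry is then the one whose constant coefficient
    no homotopy can change. *)
Definition hc p q r s (f : fhom (E p q) (E r s)) : k :=
  fcoef ((fmx f : 'M[{fps k}]_(1 + 1)) (lshift 1 ord0) (lshift 1 ord0)) 0.

Lemma hcE p q r s a b c d (f : fhom (E p q) (E r s)) :
  fmx f = mat4 p q r s a b c d -> hc f = fcoef a 0.
Proof. by rewrite /hc => ->; case: (mat4E p q r s a b c d) => ->. Qed.

Lemma hc0P p q r s (f : fhom (E p q) (E r s)) :
  p != q -> r != s -> sep p q r s -> (f ==s 0 <-> hc f = 0).
Proof.
move=> pq rs h; have [a [b [c [d e]]]] := mat4P (fmx f : pmor k (pt2 p q) (pt2 r s)).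
rewrite (Eo_null pq rs e) (hcE e); split=> [[/(_ h)]//|->].
by split=> // /andP [_]; case/andP: h => ->.
Qed.

Lemma Eo_hom0 p q r s (f : fhom (E p q) (E r s)) :
  p != q -> r != s -> ~~ sep p q r s -> ~~ sep p q s r -> f ==s 0.
Proof.
move=> pq rs /negP h /negP h'.
have [a [b [c [d e]]]] := mat4P (fmx f : pmor k (pt2 p q) (pt2 r s)).
by rewrite (Eo_null pq rs e).
Qed.

Lemma hcB p q r s (f g : fhom (E p q) (E r s)) : hc (f - g) = hc f - hc g.
Proof. by rewrite /hc fmxB !mxE. Qed.

Lemma hcZ p q r s c (f : fhom (E p q) (E r s)) : hc (fpsC c *: f) = c * hc f.
Proof. by rewrite /hc fmxZ !mxE fcoefM0. Qed.

Lemma hc_basis p q r s : p != q -> r != s -> sep p q r s ->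
  exists f : fhom (E p q) (E r s), fmx f = mat4 p q r s 1 0 0 1 /\ hc f = 1.
Proof.
move=> pq rs h; exists (FHom (diag_comm h rs pq)); split=> //.
by rewrite (@hcE _ _ _ _ 1 0 0 1).
Qed.

(** The path from P_p to P_u through P_s always picks up a factor t; the one through P_r does so
    exactly when u comes before r as seen from p. *)
Lemma hcM p q r s u v (f : fhom (E p q) (E r s)) (g : fhom (E r s) (E u v)) :
  sep p q r s -> sep p q u v ->
  hc (fcomp g f) = if arc p r <= arc p u then hc g * hc f else 0.
Proof.
move=> /andP [h1 h2] /andP [h3 h4].
have [a [b [c [d e]]]] := mat4P (fmx f : pmor k (pt2 p q) (pt2 r s)).
have [a' [b' [c' [d' e']]]] := mat4P (fmx g : pmor k (pt2 r s) (pt2 u v)).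
have psu : wrap p s u.
  by move: h2 h3; rewrite !wrapE -leNgt => h2 h3; exact: lt_le_trans h2.
rewrite (@hcE p q u v _ _ _ _ (fcomp g f) (etrans (congr2 (@pcomp _ _ _ _ _) e' e) (mat4M _ _ _ _ _ _ _ _ _ _ _ _ _ _))).
rewrite (hcE e) (hcE e') fcoefD !fcoef_Texp psu addr0 fcoefM0 wrapE ltNge.
by case: (arc p r <= arc p u).
Qed.

Lemma swap_comm p q : p != q -> mat4 p q q p 0 1 1 0 \in @fcomm k R (E p q) (E q p).
Proof.
move=> pq; apply/eqP; rewrite /= /Eo_dif [q == p]eq_sym (negbTE pq) expr0 !mat4M.
by rewrite !(wrap_l, wrap_r) !(mul0r, mulr0, mul1r, mulr1, add0r, addr0).
Qed.
End HomEo.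

(** * Transfer from the models E(p, q) to all objects isomorphic to them *)

Section IsE.
Variables (k : fieldType) (R : realType).
Local Notation S1 := (S1 R).
Local Notation obj := (fobj k R).
Local Notation E := (@Eo k R).
Implicit Types (p q r s u v : S1) (X Y Z : obj).

Lemma iso_refl X : isomorphic X X.
Proof. by exists (fid X), (fid X); rewrite fcomp1l; split; reflexivity. Qed.
Lemma iso_sym X Y : isomorphic X Y -> isomorphic Y X.
Proof. by move=> [f [g [e e']]]; exists g, f. Qed.
Lemma stab_iso_comp X Y Z (g : fhom Y Z) (f : fhom X Y) :
  stab_iso g -> stab_iso f -> stab_iso (fcomp g f).
Proof.
move=> [g' [e e']] [f' [h h']]; exists (fcomp f' g'); split.
  by rewrite -fcompA [fcomp g' _]fcompA e fcomp1l.
by rewrite -fcompA [fcomp f _]fcompA h' fcomp1l.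
Qed.
Lemma iso_trans X Y Z : isomorphic X Y -> isomorphic Y Z -> isomorphic X Z.
Proof. by move=> [f fi] [g gi]; exists (fcomp g f); apply: stab_iso_comp. Qed.
Lemma stab_iso_eq X Y (f f' : fhom X Y) : f ==s f' -> stab_iso f -> stab_iso f'.
Proof. by move=> e [g [e1 e2]]; exists g; rewrite -e. Qed.
Lemma fpsCV c : c != 0 -> fpsC c^-1 * fpsC c = 1 :> {fps k}.
Proof.
move=> c0; apply/fpsP => -[|n] /=; first by rewrite big_ord1 /= mulVf.
by rewrite big1 // => -[[|i] hi] _ /=; rewrite ?mul0r ?mulr0.
Qed.
Lemma fpsC0 : fpsC 0 = 0 :> {fps k}.
Proof. by apply/fpsP => -[]. Qed.
Lemma stabZ0 X Y (f : fhom X Y) c : c != 0 -> fpsC c *: f ==s 0 -> f ==s 0.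
Proof.
by move=> c0 e; rewrite -[f]scale1r -(fpsCV c0) -scalerA e scaler0.
Qed.
Lemma stab_isoZ X Y (f : fhom X Y) c : c != 0 -> stab_iso f -> stab_iso (fpsC c *: f).
Proof.
move=> c0 [g [e1 e2]]; exists (fpsC c^-1 *: g).
by rewrite !fcompZl !fcompZr !scalerA [fpsC c * _]mulrC fpsCV // !scale1r.
Qed.

Definition isE X p q := p != q /\ isomorphic X (E p q).

Lemma isE_sym X p q : isE X p q -> isE X q p.
Proof.
move=> [pq i]; split; first by rewrite eq_sym.
apply: (iso_trans i); have qp : q != p by rewrite eq_sym.
exists (FHom (swap_comm k pq)), (FHom (swap_comm k qp)).
by split; apply: stab_eqE; apply: fhomP;
  rewrite /= mat4M !(mul0r, mulr0, mul1r, mulr1, add0r, addr0) wrap_l wrap_r mat4_1.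
Qed.

Lemma isE_iso X Y p q : isE X p q -> isomorphic X Y -> isE Y p q.
Proof. by move=> [pq i] /iso_sym j; split=> //; apply: iso_trans i. Qed.

Lemma isE_isoE X Y p q : isE X p q -> isE Y p q -> isomorphic X Y.
Proof. by move=> [_ i] [_ /iso_sym j]; apply: iso_trans j. Qed.

Lemma isE_Eo p q : p != q -> isE (E p q) p q.
Proof. by split=> //; apply: iso_refl. Qed.

Lemma transport X X' Y Y' (y : fhom Y Y') (f : fhom X Y) (x : fhom X X') :
  stab_iso x -> exists f', fcomp f' x ==s fcomp y f.
Proof.
move=> [x' [e e']]; exists (fcomp y (fcomp f x')).
by rewrite -!fcompA e fcomp1r.
Qed.
Arguments transport {X X' Y Y'} y f {x}.

Lemma comp_iso_l X Y Z (g : fhom Y Z) (f : fhom X Y) :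
  stab_iso g -> (fcomp g f ==s 0 <-> f ==s 0).
Proof.
move=> [g' [e _]]; split=> h; last by rewrite h fcomp0r.
by rewrite -[f]fcomp1l -e -fcompA h fcomp0r.
Qed.
Lemma comp_iso_r X Y Z (g : fhom Y Z) (f : fhom X Y) :
  stab_iso f -> (fcomp g f ==s 0 <-> g ==s 0).
Proof.
move=> [f' [_ e]]; split=> h; last by rewrite h fcomp0l.
by rewrite -[g]fcomp1r -e fcompA h fcomp0l.
Qed.

Lemma isE_hom X Y p q r s (f : fhom X Y) : isE X p q -> isE Y r s ->
  ~ f ==s 0 -> sep p q r s || sep p q s r.
Proof.
move=> [pq [x xi]] [rs [y yi]] f0; have [f' e] := transport y f xi.
apply/negPn/negP; rewrite negb_or => /andP [h h']; apply: f0.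
by rewrite -(comp_iso_l _ yi) -e (Eo_hom0 f' pq rs h h') fcomp0l.
Qed.

Lemma isE_dim1 X Y p q r s (f g : fhom X Y) : isE X p q -> isE Y r s ->
  ~ f ==s 0 -> exists c, g ==s fpsC c *: f.
Proof.
wlog h : r s / sep p q r s.
  move=> W iX iY f0; have /orP [h|h] := isE_hom iX iY f0; first exact: (W r s).
  by apply: (W s r) => //; apply: isE_sym.
move=> [pq [x xi]] [rs [y yi]] f0; have [f' e] := transport y f xi.
have [g' e'] := transport y g xi.
have f'0 : hc f' != 0.
  apply/eqP => /(hc0P f' pq rs h) f'0; apply: f0.
  by rewrite -(comp_iso_l _ yi) -e f'0 fcomp0l.
have [c e1] : exists c, g' ==s fpsC c *: f'.
  exists (hc g' / hc f').
  by apply/stab_sub0/(hc0P _ pq rs h); rewrite hcB hcZ divfK // subrr.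
exists c; case: yi => [y' [ye _]].
by rewrite -[g]fcomp1l -ye -fcompA -e' e1 fcompZl e fcompZr fcompA ye fcomp1l.
Qed.

Lemma isE_hom_ex X Y p q r s : isE X p q -> isE Y r s -> sep p q r s ->
  exists f : fhom X Y, ~ f ==s 0.
Proof.
move=> [pq [x xi]] [rs /iso_sym [y yi]] h; have [f [_ f1]] := hc_basis k pq rs h.
exists (fcomp y (fcomp f x)); rewrite (comp_iso_l _ yi) (comp_iso_r _ xi).
by rewrite (hc0P f pq rs h) f1 => /eqP; rewrite oner_eq0.
Qed.

Lemma isE_comp_le1 X Y Z p q r s u v (f : fhom X Y) (g : fhom Y Z) :
  isE X p q -> isE Y r s -> isE Z u v -> sep p q r s -> sep p q u v ->
  ~ fcomp g f ==s 0 -> arc p r <= arc p u.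
Proof.
move=> [pq [x xi]] [rs [y yi]] [uv [z zi]] h h' n0.
have [f' ef] := transport y f xi; have [g' eg] := transport z g yi.
apply/negPn/negP => le; apply: n0.
have e0 : fcomp g' f' ==s 0 by apply/(hc0P _ pq uv h'); rewrite hcM // (negbTE le).
by rewrite -(comp_iso_l _ zi) fcompA -eg -fcompA -ef fcompA e0 fcomp0l.
Qed.

(** The second bound is the first one after exchanging the endpoints of each geodesic. *)
Lemma isE_comp_le X Y Z p q r s u v (f : fhom X Y) (g : fhom Y Z) :
  isE X p q -> isE Y r s -> isE Z u v -> sep p q r s -> sep p q u v ->
  ~ fcomp g f ==s 0 -> arc p r <= arc p u /\ arc q s <= arc q v.
Proof.
move=> iX iY iZ h h' n0; split; first exact: (isE_comp_le1 iX iY iZ h h' n0).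
have pq := iX.1.
by apply: (isE_comp_le1 (isE_sym iX) (isE_sym iY) (isE_sym iZ)) n0; rewrite sepC.
Qed.

Lemma isE_comp_neq0 X Y Z p q r s u v (f : fhom X Y) (g : fhom Y Z) :
  isE X p q -> isE Y r s -> isE Z u v -> sep p q r s -> sep p q u v -> sep r s u v ->
  arc p r <= arc p u -> ~ f ==s 0 -> ~ g ==s 0 -> ~ fcomp g f ==s 0.
Proof.
move=> [pq [x xi]] [rs [y yi]] [uv [z zi]] h h' h'' le f0 g0.
have [f' ef] := transport y f xi; have [g' eg] := transport z g yi => n0.
have : fcomp g' f' ==s 0.
  by rewrite -(comp_iso_r _ xi) -fcompA ef fcompA eg -fcompA n0 fcomp0r.
move=> /(hc0P _ pq uv h'); rewrite hcM // le => /eqP; rewrite mulf_eq0.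
case/orP => /eqP.
  move=> /(hc0P _ rs uv h'') e; apply: g0.
  by rewrite -(comp_iso_l _ zi) -eg e fcomp0l.
move=> /(hc0P _ pq rs h) e; apply: f0.
by rewrite -(comp_iso_l _ yi) -ef e fcomp0l.
Qed.

Lemma sep_refl p q : p != q -> sep p q p q.
Proof. by rewrite /sep wrap_pqp wrap_r => ->. Qed.

Lemma isE_nonzero X p q : isE X p q -> ~ is_zero X.
Proof.
move=> [pq [x [x' [e e']]]] z; have h : fid X ==s 0 := z.
have : fid (E p q) ==s 0 by rewrite -e' -[x]fcomp1r h fcomp0r fcomp0l.
move=> /(hc0P _ pq pq (sep_refl pq)); rewrite (@hcE _ _ _ _ _ _ 1 0 0 1) //=.
  by move/eqP; rewrite oner_eq0.
exact: mat4_1.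
Qed.

Lemma iso_neq0 X Y p q (f : fhom X Y) : isE X p q -> stab_iso f -> ~ f ==s 0.
Proof.
move=> iX [g [e _]] f0; apply: (isE_nonzero iX).
by rewrite /is_zero -e f0 fcomp0r.
Qed.

(** An isomorphism followed by its inverse is a nonzero composite that ends where it began, so
    [isE_comp_le] bounds both angles of rotation by 0. *)
Lemma isE_inj X Y p q r s : isE X p q -> isE Y r s -> isomorphic X Y ->
  (p = r /\ q = s) \/ (p = s /\ q = r).
Proof.
wlog h : r s / sep p q r s.
  move=> W iX iY [f fi]; have /orP [h|h] := isE_hom iX iY (iso_neq0 iX fi).
    by apply: (W r s) => //; exists f.
  case: (W s r) => //; [exact: isE_sym|by exists f|by right|by left].
move=> iX iY [f fi]; have pq := iX.1; have n0 := iso_neq0 iX fi.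
left; case: (fi) => g [e _].
have := @isE_comp_le _ _ _ _ _ _ _ _ _ f g iX iY iX h (sep_refl pq).
rewrite !arc_refl e => /(_ (isE_nonzero iX)) [l1 l2].
by split; apply/eqP; rewrite -arc_eq0 eq_le arc_ge0 ?l1 ?l2.
Qed.

(** The stable morphisms from X to Y form a line spanned by an isomorphism. *)
Lemma isE_isoP X Y p q (f : fhom X Y) : isE X p q -> isomorphic X Y ->
  ~ f ==s 0 -> stab_iso f.
Proof.
move=> iX [g gi] f0; have iY := isE_iso iX (ex_intro _ g gi).
have [c e] := isE_dim1 f iX iY (iso_neq0 iX gi).
have c0 : c != 0.
  by apply/eqP => c0; apply: f0; rewrite e c0 fpsC0 scale0r.
by apply: stab_iso_eq (stab_isoZ c0 gi); rewrite e.
Qed.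

End IsE.

(** * Decomposition of objects *)

Section Sub.
Variables (k : fieldType) (R : realType).
Local Notation obj := (fobj k R).
Implicit Types (U V : pobj R) (X Y : obj).

Definition subp U m (sg : 'I_m -> 'I_(prk U)) : pobj R := PObj (fun a => ppt (sg a)).
Definition pinc U m (sg : 'I_m -> 'I_(prk U)) : pmor k (subp sg) U :=
  \matrix_(l, a) (l == sg a)%:R.
Definition pprj U m (sg : 'I_m -> 'I_(prk U)) : pmor k U (subp sg) :=
  \matrix_(a, l) (l == sg a)%:R.

Lemma pcomp_inc U V m (sg : 'I_m -> 'I_(prk U)) (F : pmor k U V) l a :
  pcomp F (pinc sg) l a = F l (sg a).
Proof.
rewrite mxE (bigD1 (sg a)) //= big1 => [|x xa]; last first.
  by rewrite mxE (negbTE xa) !mulr0.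
by rewrite mxE eqxx wrap_l mul1r mulr1 addr0.
Qed.

Lemma pcomp_prj U V m (sg : 'I_m -> 'I_(prk V)) (F : pmor k U V) a l :
  pcomp (pprj sg) F a l = F (sg a) l.
Proof.
rewrite mxE (bigD1 (sg a)) //= big1 => [|x xa]; last first.
  by rewrite mxE (negbTE xa) mul0r mulr0.
by rewrite mxE eqxx wrap_r mul1r mul1r addr0.
Qed.

Lemma pinc_prj U m (sg : 'I_m -> 'I_(prk U)) l l' :
  pcomp (pinc sg) (pprj sg) l l' = \sum_a ((l == sg a) && (l' == sg a))%:R.
Proof.
rewrite mxE; apply: eq_bigr => a _; rewrite !mxE.
case: eqVneq => [->|_]; last by rewrite mul0r mulr0.
by rewrite wrap_r !mul1r.
Qed.

Lemma pmorT_inj U V (F G : pmor k U V) : 'T *: F = 'T *: G -> F = G.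
Proof.
by move=> /matrixP e; apply/matrixP => i j; have := e i j; rewrite !mxE => /fpsT_inj.
Qed.
End Sub.

(** * Direct sums in the stable category *)

Section Sums.
Variables (k : fieldType) (R : realType).
Local Notation obj := (fobj k R).
Implicit Types X Y Z W : obj.

Lemma fcolM X Y Z W (f : fhom Y Z) (g : fhom Y W) (h : fhom X Y) :
  fcomp (fcol f g) h = fcol (fcomp f h) (fcomp g h).
Proof. by apply: fhomP; rewrite /= pcomp_col. Qed.
Lemma frowM X Y Z W (f : fhom X Z) (g : fhom Y Z) (h : fhom Z W) :
  fcomp h (frow f g) = frow (fcomp h f) (fcomp h g).
Proof. by apply: fhomP; rewrite /= pcomp_row. Qed.
Lemma frow_col X Y Z W (f : fhom Y W) (g : fhom Z W) (f' : fhom X Y) (g' : fhom X Z) :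
  fcomp (frow f g) (fcol f' g') = fcomp f f' + fcomp g g'.
Proof. by apply: fhomP; rewrite [RHS]fmxD /= pcomp_row_col. Qed.
Lemma fid_sum X Y :
  fid (fsum X Y) = fcol (frow (fid X) (0 : fhom Y X)) (frow (0 : fhom X Y) (fid Y)).
Proof. by apply: fhomP; rewrite /= pid_sum. Qed.
Lemma fcol_row X Y Z W (a : fhom X Z) (b : fhom Y Z) (c : fhom X W) (d : fhom Y W) :
  fcol (frow a b) (frow c d) = frow (fcol a c) (fcol b d).
Proof. by apply: fhomP; rewrite /= pcol_row. Qed.

Lemma fcolP X Y Z (f : fhom X (fsum Y Z)) : exists f1 f2, f = fcol f1 f2.
Proof.
exists (fcomp (frow (fid Y) (0 : fhom Z Y)) f), (fcomp (frow (0 : fhom Y Z) (fid Z)) f).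
by rewrite -fcolM -fid_sum fcomp1l.
Qed.
Lemma frowP X Y Z (f : fhom (fsum X Y) Z) : exists f1 f2, f = frow f1 f2.
Proof.
exists (fcomp f (fcol (fid X) (0 : fhom X Y))), (fcomp f (fcol (0 : fhom Y X) (fid Y))).
by rewrite -frowM -fcol_row -fid_sum fcomp1r.
Qed.

Lemma fcolE X Y Z (f : fhom X Y) (g : fhom X Z) :
  fcol f g = fcomp (fcol (fid Y) (0 : fhom Y Z)) f + fcomp (fcol (0 : fhom Z Y) (fid Z)) g.
Proof.
apply: fhomP; rewrite [RHS]fmxD /= !pcomp_col !pcomp0l !pcomp1l pcolD.
by rewrite addr0 add0r.
Qed.
Lemma frowE X Y Z (f : fhom X Z) (g : fhom Y Z) :
  frow f g = fcomp f (frow (fid X) (0 : fhom Y X)) + fcomp g (frow (0 : fhom X Y) (fid Y)).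
Proof.
apply: fhomP; rewrite [RHS]fmxD /= !pcomp_row !pcomp0r !pcomp1r prowD.
by rewrite addr0 add0r.
Qed.
Lemma stab_col X Y Z (f f' : fhom X Y) (g g' : fhom X Z) :
  f ==s f' -> g ==s g' -> fcol f g ==s fcol f' g'.
Proof. by move=> e e'; rewrite (fcolE f) (fcolE f') e e'. Qed.
Lemma stab_row X Y Z (f f' : fhom X Z) (g g' : fhom Y Z) :
  f ==s f' -> g ==s g' -> frow f g ==s frow f' g'.
Proof. by move=> e e'; rewrite (frowE f) (frowE f') e e'. Qed.

#[export] Instance fcol_proper X Y Z :
  Morphisms.Proper (Morphisms.respectful (@stab_eq k R X Y)
    (Morphisms.respectful (@stab_eq k R X Z) (@stab_eq k R X (fsum Y Z))))
    (@fcol k R X Y Z).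
Proof. by move=> f f' e g g' e'; apply: stab_col. Qed.
#[export] Instance frow_proper X Y Z :
  Morphisms.Proper (Morphisms.respectful (@stab_eq k R X Z)
    (Morphisms.respectful (@stab_eq k R Y Z) (@stab_eq k R (fsum X Y) Z)))
    (@frow k R X Y Z).
Proof. by move=> f f' e g g' e'; apply: stab_row. Qed.

Definition fpr1 X Y : fhom (fsum X Y) X := frow (fid X) (0 : fhom Y X).
Definition fpr2 X Y : fhom (fsum X Y) Y := frow (0 : fhom X Y) (fid Y).
Definition fin1 X Y : fhom X (fsum X Y) := fcol (fid X) (0 : fhom X Y).
Definition fin2 X Y : fhom Y (fsum X Y) := fcol (0 : fhom Y X) (fid Y).

Lemma frow00 X Y Z : frow (0 : fhom X Z) (0 : fhom Y Z) = 0.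
Proof. by rewrite frowE !fcomp0l addr0. Qed.

Lemma fsum0_l X Y : is_zero X -> isomorphic (fsum X Y) Y.
Proof.
move=> X0; have {}X0 : fid X ==s 0 := X0.
exists (fpr2 X Y), (fin2 X Y); split.
  rewrite fid_sum fcolM; apply: stab_col; last by rewrite fcomp1l.
  by rewrite fcomp0l; apply/stab_sym; rewrite X0 frow00.
by rewrite frow_col fcomp0l add0r fcomp1l.
Qed.
Lemma fsumC X Y : isomorphic (fsum X Y) (fsum Y X).
Proof.
exists (fcol (fpr2 X Y) (fpr1 X Y)), (fcol (fpr2 Y X) (fpr1 Y X)).
by split; apply: stab_eqE; rewrite fid_sum fcolM !frow_col !fcomp0l !fcomp1l add0r addr0.
Qed.
Lemma fsum0_r X Y : is_zero Y -> isomorphic (fsum X Y) X.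
Proof. by move=> Y0; apply: iso_trans (fsumC _ _) (fsum0_l _ Y0). Qed.

Lemma iso_zero X Y : isomorphic X Y -> is_zero X -> is_zero Y.
Proof.
move=> [f [g [_ e]]] X0; have {}X0 : fid X ==s 0 := X0.
by rewrite /is_zero -e -[f]fcomp1r X0 fcomp0r fcomp0l; apply: stab_refl.
Qed.

Lemma zero_prk0 X : prk X = 0 -> is_zero X.
Proof.
move=> X0; apply: stab_eqE; apply: fhomP; apply/matrixP => i.
by have := ltn_ord i; rewrite {2}X0.
Qed.
End Sums.

Section Decomposition.
Variables (k : fieldType) (R : realType).
Local Notation obj := (fobj k R).
Local Notation E := (@Eo k R).
Implicit Types (X Y : obj).

Lemma iso_strict X Y (f : fhom X Y) (g : fhom Y X) :
  fcomp g f = fid X -> fcomp f g = fid Y -> isomorphic X Y.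
Proof. by move=> e e'; exists f, g; rewrite e e'. Qed.

(** Splitting off a direct summand [(U, d')] of [P_{S^1}], where [q] and [p]
    are complementary to [phi] and [psi]. *)
Lemma split_summand X Y (U : pobj R) (phi : fhom Y X) (psi : fhom X Y)
    (q : pmor k U X) (p : pmor k X U) :
  fcomp psi phi = fid Y -> pcomp (fmx psi) q = 0 -> pcomp p (fmx phi) = 0 ->
  pcomp p q = pid k U -> pcomp q p = pid k X - fmx (fcomp phi psi) ->
  exists2 Z : obj, fund Z = U & isomorphic X (fsum Y Z).
Proof.
move=> psiphi psiq pphi pq qp.
have qpd : pcomp (pcomp q p) (fdif X) = pcomp (fdif X) (pcomp q p).
  by rewrite qp pcompDl pcompDr pcompNl pcompNr pcomp1l pcomp1r (fcommE (fcomp phi psi)).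
(* The complement carries the differential p d q: the idempotent q p commutes with d, so (p d q)^2 =
   p d^2 q = t. *)
have h : pcomp (pcomp p (pcomp (fdif X) q)) (pcomp p (pcomp (fdif X) q)) = 'T *: pid k U.
  transitivity (pcomp p (pcomp (pcomp (fdif X) (pcomp q p)) (pcomp (fdif X) q))).
    by rewrite !pcompA.
  rewrite -qpd !pcompA pq pcomp1l -[pcomp (pcomp p _) (fdif X)]pcompA fdif2.
  by rewrite pcompZr pcomp1r pcompZl pq.
pose Z : obj := FObj h; exists Z => //.
have qP : q \in @fcomm _ _ Z X.
  by apply/eqP; rewrite /= !pcompA qpd -pcompA -pcompA pq pcomp1r.
have pP : p \in @fcomm _ _ X Z.
  by apply/eqP; rewrite /= -!pcompA -qpd !pcompA pq pcomp1l.
apply: (@iso_strict _ _ (fcol psi (FHom pP)) (frow phi (FHom qP))).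
  by apply: fhomP; rewrite /= pcomp_row_col qp addrC subrK.
apply: fhomP; rewrite /= pcomp_col !pcomp_row.
by rewrite psiq pphi pq (congr1 (@fmx _ _ _ _) psiphi : pcomp _ _ = _) pid_sum.
Qed.

(** * Splitting off E(pJ, pI): [del] and [eps] are column j and row i of d divided by the generator
    e *)

Section Summand.
Variables (X : obj) (i j : 'I_(prk X)) (u v : {fps k}).
Hypotheses (ij : i != j) (uv : v * u = 1).
Let d : pmor k X X := fdif X.
Let pI := ppt i.
Let pJ := ppt j.
Let ii := @pinc k R X 1 (fun=> i).
Let ij_ := @pinc k R X 1 (fun=> j).
Let ri := @pprj k R X 1 (fun=> i).
Let rj := @pprj k R X 1 (fun=> j).
Let e : pmor k (pt pJ) (pt pI) := sm pJ pI 1.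
Let e' : pmor k (pt pI) (pt pJ) := sm pI pJ ('T ^+ (pJ == pI)).
Variables (del : pmor k (pt pI) X) (eps : pmor k X (pt pJ)).
Hypotheses (delE : pcomp del e = pcomp d ij_) (epsE : pcomp e eps = pcomp ri d).
Hypotheses (deli : pcomp ri del = sm pI pI u) (epsj : pcomp eps ij_ = sm pJ pJ u).

Let ee' : pcomp e e' = 'T *: pid k (pt pI).
Proof.
rewrite smM sm1 smZ mul1r mulr1; congr sm; rewrite wrap_pqp [pJ == _]eq_sym.
by case: eqP; rewrite ?expr0 ?mulr1 ?mul1r.
Qed.
Let e'e : pcomp e' e = 'T *: pid k (pt pJ).
Proof.
rewrite smM sm1 smZ !mulr1; congr sm; rewrite wrap_pqp.
by case: eqP; rewrite ?expr0 ?mulr1 ?mul1r.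
Qed.
Let e_epi W (F G : pmor k (pt pI) W) : pcomp F e = pcomp G e -> F = G.
Proof.
move=> /(congr1 (fun H => pcomp H e')); rewrite -!pcompA ee' !pcompZr !pcomp1r.
exact: pmorT_inj.
Qed.
Let e_mono W (F G : pmor k W (pt pJ)) : pcomp e F = pcomp e G -> F = G.
Proof.
move=> /(congr1 (pcomp e')); rewrite !pcompA e'e !pcompZl !pcomp1l.
exact: pmorT_inj.
Qed.
Let d2 : pcomp d d = 'T *: pid k X. Proof. exact: fdif2. Qed.

Let ri_ij : pcomp ri ij_ = 0.
Proof.
by apply/matrixP => a b; rewrite pcomp_prj !mxE; case: eqP ij => // ->; rewrite eqxx.
Qed.

Let phiP : prow ij_ del \in @fcomm _ _ (E pJ pI) X.
Proof.
have dd : pcomp d del = pcomp ij_ e'.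
  by apply: e_epi; rewrite -!pcompA e'e delE pcompA d2 pcompZl pcompZr pcomp1l pcomp1r.
apply/eqP; rewrite /= pcomp_row -/d -delE dd pcomp_row_col !pcomp_row.
by rewrite !sm0 !pcomp0r prowD add0r addr0.
Qed.
Let psiP : pcol eps ri \in @fcomm _ _ X (E pJ pI).
Proof.
have dd : pcomp eps d = pcomp e' ri.
  by apply: e_mono; rewrite !pcompA ee' epsE -pcompA d2 pcompZl pcompZr pcomp1l pcomp1r.
apply/eqP; rewrite /= pcomp_col -/d -epsE dd /mat4 pcomp_col !pcomp_row_col.
by rewrite !sm0 !pcomp0l add0r addr0.
Qed.

Let eps_del : pcomp eps del = 0.
Proof.
apply: e_epi; rewrite pcomp0l; apply: e_mono; rewrite pcomp0r.
rewrite -pcompA delE pcompA epsE -pcompA [pcomp d (pcomp _ _)]pcompA d2.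
by rewrite pcompZl pcomp1l pcompZr ri_ij scaler0.
Qed.

(** The morphism v (eps, ri) is a retraction of (ij_, del), and f is the complementary idempotent.
    Since f kills the inclusion of index j and has zero row i, its image is in P_{S^1} the sum over
    the remaining indices, by way of f inc and prj f. *)
Lemma summand : exists2 Y : obj, (prk Y < prk X)%N &
  isomorphic X (fsum (E pJ pI) Y).
Proof.
pose A := [pred l : 'I_(prk X) | (l != i) && (l != j)].
pose sg : 'I_#|A| -> 'I_(prk X) := @enum_val _ A.
pose inc := @pinc k R X _ sg; pose prj := @pprj k R X _ sg.
have sgA a : sg a != i /\ sg a != j by apply/andP; exact: (enum_valP a).
pose phi := FHom phiP; pose psi := v *: FHom psiP.
have psiphi : fcomp psi phi = fid (E pJ pI).
  apply: fhomP; rewrite /= pcompZl pcomp_col !pcomp_row epsj eps_del ri_ij deli.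
  rewrite pcolZ !prowZ !smZ uv. by rewrite !mulr0 !sm0 pid_sum !sm1.
pose f := pid k X - fmx (fcomp phi psi).
have sumsg l l' : \sum_a ((l == sg a) && (l' == sg a))%:R = (A l && (l == l'))%:R :> {fps k}.
  rewrite -(@big_enum_val _ _ _ _ A (fun x => ((l == x) && (l' == x))%:R)).
  rewrite (bigID (pred1 l)) /= [X in _ + X]big1 ?addr0; last first.
    by move=> x /andP [_]; rewrite eq_sym => /negbTE ->.
  case Al: ((l != i) && (l != j)); last first.
    by rewrite big1 // => x /andP [Ax /eqP xl]; move: Ax; rewrite xl inE Al.
  rewrite (big_pred1 l) => [|x]; first by rewrite eqxx eq_sym.
  by rewrite /= inE; case: (eqVneq x l) => [->|]; rewrite ?Al ?andbT ?andbF.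
have incprj : pcomp inc prj = pid k X - pcomp ij_ rj - pcomp ii ri.
  apply/matrixP => l l'; rewrite pinc_prj sumsg !mxE !big_ord1 !mxE /= -/pI -/pJ.
  case: (eqVneq l i) => [->|li].
    rewrite (negbTE ij) !(mul0r, mulr0, subr0, mul1r) /=.
    by case: (eqVneq i l') => [<-|il']; rewrite ?mulr0 ?wrap_l ?mulr1 ?subrr.
  case: (eqVneq l j) => [->|lj]; rewrite !(mul0r, mulr0, subr0, mul1r) //=.
  by case: (eqVneq j l') => [<-|jl']; rewrite ?mulr0 ?wrap_l ?mulr1 ?subrr.
have rjinc : pcomp ri inc = 0.
  by apply/matrixP => a b; rewrite pcomp_prj !mxE eq_sym (negbTE (sgA b).1).
have prjij : pcomp prj ij_ = 0.
  by apply/matrixP => a b; rewrite pcomp_prj !mxE (negbTE (sgA a).2).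
have ffE : fmx (fcomp phi psi) = v *: (pcomp ij_ eps + pcomp del ri).
  by rewrite /= pcompZr pcomp_row_col.
have pp : pcomp (fmx psi) (fmx phi) = pid k (E pJ pI) := congr1 (@fmx _ _ _ _) psiphi.
have psif : pcomp (fmx psi) f = 0.
  by rewrite /f pcompDr pcomp1r pcompNr /= pcompA pp pcomp1l subrr.
have fphi : pcomp f (fmx phi) = 0.
  by rewrite /f pcompDl pcomp1l pcompNl /= -pcompA pp pcomp1r subrr.
have f2 : pcomp f f = f.
  by rewrite {1}/f pcompDl pcomp1l pcompNl /= -pcompA psif pcomp0r subr0.
have fij : pcomp f ij_ = 0.
  rewrite /f ffE pcompDl pcomp1l pcompNl pcompZl pcompDl -!pcompA epsj ri_ij pcomp0r addr0.
  by rewrite -pcompZr smZ uv -sm1 pcomp1r subrr.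
have rif : pcomp ri f = 0.
  rewrite /f ffE pcompDr pcomp1r pcompNr pcompZr pcompDr !pcompA deli ri_ij pcomp0l add0r.
  by rewrite -pcompZl smZ uv -sm1 pcomp1l subrr.
have prjinc : pcomp prj inc = pid k (subp sg).
  by apply/matrixP => a b; rewrite pcomp_prj !mxE (inj_eq enum_val_inj).
have prjfinc : pcomp prj (pcomp f inc) = pid k (subp sg).
  rewrite /f ffE pcompDl pcomp1l pcompNl pcompZl pcompDl -!pcompA rjinc pcomp0r addr0.
  by rewrite pcompDr prjinc pcompNr pcompZr pcompA prjij pcomp0l scaler0 subr0.
have [||||Z ZE iso] := @split_summand X (E pJ pI) (subp sg) phi psi
    (pcomp f inc) (pcomp prj f) psiphi.
- by rewrite pcompA psif pcomp0l.
- by rewrite -pcompA fphi pcomp0r.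
- by rewrite -pcompA [pcomp f (pcomp _ _)]pcompA f2.
- rewrite -pcompA [pcomp inc _]pcompA.
  have -> : pcomp (pcomp inc prj) f = f - pcomp ij_ (pcomp rj f).
    by rewrite incprj !pcompDl pcomp1l !pcompNl -!pcompA rif pcomp0r subr0.
  by rewrite (pcompDr f f) f2 pcompNr pcompA fij pcomp0l subr0.
exists Z => //; rewrite ZE /= -[X in (_ < X)%N]card_ord -(cardC A) -addn1 leq_add2l.
by apply/card_gt0P; exists i; rewrite !inE eqxx.
Qed.
End Summand.

(** Without unit entries, t^2 would divide the entries of d^2 = t. If a minimal unit entry sits on
    the diagonal, its exponent is 0; as (d^2)_ii = t has no constant term, row i contains another
    unit entry between equal points, again with exponent 0. *)
Lemma dif_pivot X : (0 < prk X)%N -> exists i j : 'I_(prk X),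
  [/\ i != j, fcoef (fdif X i j) 0 != 0 &
    forall i' j', fcoef (fdif X i' j') 0 != 0 ->
      arc (ppt j) (ppt i) <= arc (ppt j') (ppt i')].
Proof.
move=> X0; pose i0 := Ordinal X0; pose d := fdif X.
have dd i j : \sum_l 'T ^+ wrap (ppt j) (ppt l) (ppt i) * (d i l * d l j) =
    'T * (i == j)%:R by have /matrixP /(_ i j) := fdif2 X; rewrite !mxE.
pose P (x : 'I_(prk X) * 'I_(prk X)) := fcoef (d x.1 x.2) 0 != 0.
have [x0 Px0] : exists x, P x.
  apply: contrapT => nP.
  have d0 i j : fcoef (d i j) 0 = 0 by apply/eqP/negPn/negP => h; apply: nP; exists (i, j).
  have /fpsP /(_ 1%N) := dd i0 i0; rewrite eqxx mulr1 fcoefT_sum big1.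
    by move=> /esym /eqP; rewrite /= oner_eq0.
  move=> l _; rewrite (fshiftP (d0 i0 l)) (fshiftP (d0 l i0)).
  move: ('T ^+ _) (fshift _) (fshift _) => w a b.
  by rewrite (_ : _ * _ = 'T * ('T * (w * a * b))) ?fcoefTM //; ring.
case: (@Order.TotalTheory.arg_minP _ R _ x0 P (fun x => arc (ppt x.2) (ppt x.1)) Px0).
move=> [i j] /= Pij min.
have [eij|nij] := eqVneq i j; last by exists i, j; split=> // i' j' h; apply: (min (i', j')).
subst j; move: Pij min; rewrite /P /= arc_refl => Pi min.
have [l [li dl arcl]] : exists l, [/\ l != i, fcoef (d i l) 0 != 0 & ppt l = ppt i].
  apply: contrapT => nl; have /fpsP /(_ 0%N) := dd i i.
  rewrite eqxx mulr1 fcoefT_sum (bigD1 i) // big1 => [|l li].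
    rewrite [LHS]addr0 wrap_l mul1r fcoefM0 => /eqP; rewrite mulf_eq0 orbb.
    by rewrite (negbTE Pi).
  rewrite fcoef_Texp wrap_pqp fcoefM0; case: eqP => //= e.
  have [->|dl] := eqVneq (fcoef (d i l) 0) 0; first by rewrite mul0r.
  by case: nl; exists l.
exists i, l; split=> //; first by rewrite eq_sym.
by move=> i' j' h; rewrite arcl arc_refl arc_ge0.
Qed.

Lemma split_E X : (0 < prk X)%N -> exists p q Y,
  (prk Y < prk X)%N /\ isomorphic X (fsum (E p q) Y).
Proof.
move=> /dif_pivot [i [j [ij u0 min]]].
have [v uv] := fps_inv u0; pose d := fdif X; exists (ppt j), (ppt i).
(* Where [wrap] is 1, the entry has a smaller exponent than the pivot, so by minimality it is
   divisible by t; dividing it once makes up for the t that composition with the generator e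
   produces. *)
pose del : pmor k (pt (ppt i)) X :=
  \matrix_(l, _) if wrap (ppt j) (ppt i) (ppt l) then fshift (d l j) else d l j.
pose eps : pmor k X (pt (ppt j)) :=
  \matrix_(_, l) if wrap (ppt l) (ppt j) (ppt i) then fshift (d i l) else d i l.
have [||||Y Y1 Y2] := @summand X i j (d i j) v ij uv del eps; last by exists Y.
- apply/matrixP => l a; rewrite pcomp_inc !mxE big_ord1 !mxE /= mulr1.
  case: ifP => w; last by rewrite mul1r.
  rewrite -fshiftP //; apply/eqP/negPn/negP => /min; rewrite leNgt.
  by move: w; rewrite wrapE => ->.
- apply/matrixP => a l; rewrite pcomp_prj !mxE big_ord1 !mxE /= mul1r.
  case: ifP => w; last by rewrite mul1r.
  rewrite -fshiftP //; apply/eqP/negPn/negP => /min.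
  have := wrapP (ppt l) (ppt j) (ppt i); rewrite w mulr1.
  by have := arc_lt (ppt l) (ppt j); lra.
- by apply/matrixP => a b; rewrite pcomp_prj !mxE wrap_r.
- by apply/matrixP => a b; rewrite pcomp_inc !mxE wrap_l.
Qed.

Lemma Eo_diag_zero p : is_zero (E p p).
Proof.
apply/stab_eqP; exists (mat4 p p p p 0 1 0 0).
rewrite fmx0 subr0 /htpy /= /Eo_dif !mat4M mat4D eqxx !wrap_l.
by rewrite !(mul0r, mulr0, mul1r, mulr1, add0r, addr0) mat4_1.
Qed.

Lemma indecomposable_isE X : indecomposable X -> exists p q, isE X p q.
Proof.
have [n] := ubnP (prk X); elim: n X => // n IH X le [nX ind].
case: (posnP (prk X)) => [/zero_prk0 //|X0].
have [p [q [Y [YX iso]]]] := split_E X0.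
have [zE|zY] := ind _ _ iso; last first.
  exists p, q; split; last exact: iso_trans iso (fsum0_r _ zY).
  apply/eqP => pq; apply: nX; apply: iso_zero (iso_sym iso) _.
  have : is_zero (E p q) by rewrite pq; exact: Eo_diag_zero.
  move=> /(fsum0_l Y) h.
  by apply: iso_zero (iso_sym h) zY.
have isoY := iso_trans iso (fsum0_l Y zE).
have [||p' [q' [pq' i']]] := IH Y.
- by apply: leq_trans YX _; rewrite -ltnS.
- split=> [h|Z W h]; first by apply: nX; apply: iso_zero (iso_sym isoY) h.
  by apply: ind; apply: iso_trans isoY h.
by exists p', q'; split=> //; apply: iso_trans isoY i'.
Qed.

(** Endomorphisms of X are scalars. The idempotents e1 and e2 of Y and Z have product 0, so if the
    scalar of e1 is nonzero then e2 vanishes. *)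
Lemma isE_indecomposable X p q : isE X p q -> indecomposable X.
Proof.
move=> iX; split=> [|Y Z [f [g [gf fg]]]]; first exact: isE_nonzero iX.
have X0 := isE_nonzero iX.
pose e1 := fcomp g (fcomp (fin1 Y Z) (fcomp (fpr1 Y Z) f)).
have idE : fid (fsum Y Z) = fcomp (fin1 Y Z) (fpr1 Y Z) + fcomp (fin2 Y Z) (fpr2 Y Z).
  rewrite /fin1 /fin2 !fcolM !fcomp1l !fcomp0l; apply: fhomP.
  by rewrite [RHS]fmxD /= pcolD addr0 add0r pid_sum.
have p11 : fcomp (fpr1 Y Z) (fin1 Y Z) = fid Y.
  by rewrite frow_col fcomp1l fcomp0l addr0.
have p12 : fcomp (fpr1 Y Z) (fin2 Y Z) = 0.
  by rewrite frow_col fcomp1l fcomp0l addr0.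
have p22 : fcomp (fpr2 Y Z) (fin2 Y Z) = fid Z.
  by rewrite frow_col fcomp1l fcomp0l add0r.
pose e2 := fcomp g (fcomp (fin2 Y Z) (fcomp (fpr2 Y Z) f)).
have e1e2 : fcomp e1 e2 ==s 0.
  rewrite /e1 /e2 -!fcompA [fcomp f (fcomp g _)]fcompA fg fcomp1l.
  by rewrite [fcomp (fpr1 Y Z) (fcomp _ _)]fcompA p12 fcomp0l !fcomp0r.
have [c e1c] := isE_dim1 e1 iX iX X0.
have [c0|c0] := eqVneq c 0; [left|right].
  have e10 : e1 ==s 0 by rewrite e1c c0 fpsC0 scale0r.
  have : fcomp (fpr1 Y Z) (fcomp f (fcomp e1 (fcomp g (fin1 Y Z)))) ==s fid Y.
    rewrite /e1 -!fcompA ![fcomp f (fcomp g _)]fcompA fg !fcomp1l.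
    by rewrite p11 fcomp1r p11.
  by move=> h; rewrite /is_zero -h e10 fcomp0l !fcomp0r; apply: stab_refl.
have e20 : e2 ==s 0.
  by apply: (stabZ0 c0); rewrite -[e2]fcomp1l -fcompZl -e1c.
have : fcomp (fpr2 Y Z) (fcomp f (fcomp e2 (fcomp g (fin2 Y Z)))) ==s fid Z.
  rewrite /e2 -!fcompA ![fcomp f (fcomp g _)]fcompA fg !fcomp1l.
  by rewrite p22 fcomp1r p22.
by move=> h; rewrite /is_zero -h e20 fcomp0l !fcomp0r; apply: stab_refl.
Qed.
End Decomposition.

(** * Triangles *)

Section Blocks.
Variables (k : fieldType) (R : realType).

Lemma prow00 (U V W : pobj R) : prow (0 : pmor k U W) (0 : pmor k V W) = 0.
Proof. exact: row_mx0. Qed.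
Lemma pcol00 (U V W : pobj R) : pcol (0 : pmor k U V) (0 : pmor k U W) = 0.
Proof. exact: col_mx0. Qed.

Lemma pcolN (U V W : pobj R) (F : pmor k U V) (G : pmor k U W) :
  - pcol F G = pcol (- F) (- G).
Proof. exact: opp_col_mx. Qed.
Lemma prowN (U V W : pobj R) (F : pmor k U W) (G : pmor k V W) :
  - prow F G = prow (- F) (- G).
Proof. exact: opp_row_mx. Qed.
End Blocks.

Ltac blk := rewrite /= ?pid_sum ?(pcolN, prowN, pcomp_col, pcomp_row_col, pcomp_row, pcomp0l, pcomp0r,
  pcomp1l, pcomp1r, prow00, pcol00, pcolD, prowD, pcompNl, pcompNr, oppr0, opprK, addr0, add0r).

(** * Mapping cones and standard triangles *)

Section Cones.
Variables (k : fieldType) (R : realType).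
Local Notation obj := (fobj k R).
Implicit Types X Y Z W : obj.

(** [Z] is, up to isomorphism in [F], the mapping cone of [f]: as an object of
    [P_{S^1}] it is [Y + X], with inclusions [v], [s] and projections [r], [w]. *)
Definition cone_data X Y Z (f : fhom X Y) (v : fhom Y Z) (w : fhom Z (susp X))
    (r : pmor k Z Y) (s : pmor k X Z) :=
  [/\ pcomp (fmx w : pmor k Z X) s = pid k X, pcomp r (fmx v) = pid k Y,
      pcomp (fmx v) r + pcomp s (fmx w : pmor k Z X) = pid k Z &
      pcomp (fdif Z) s + pcomp s (fdif X) = pcomp (fmx v) (fmx f)].

Definition is_cone X Y Z (f : fhom X Y) (v : fhom Y Z) (w : fhom Z (susp X)) :=
  exists r s, cone_data f v w r s.

Section Data.
Variables (X Y Z : obj) (f : fhom X Y) (v : fhom Y Z) (w : fhom Z (susp X)).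
Variables (r : pmor k Z Y) (s : pmor k X Z).
Hypothesis D : cone_data f v w r s.
Let w' : pmor k Z X := fmx w.

Lemma cone_ws : pcomp w' s = pid k X. Proof. by case: D. Qed.
Lemma cone_rv : pcomp r (fmx v) = pid k Y. Proof. by case: D. Qed.
Lemma cone_id : pcomp (fmx v) r + pcomp s w' = pid k Z. Proof. by case: D. Qed.
Lemma cone_dif : pcomp (fdif Z) s + pcomp s (fdif X) = pcomp (fmx v) (fmx f).
Proof. by case: D. Qed.
Lemma cone_wv0 : pcomp w' (fmx v) = 0.
Proof.
have := congr1 (fun F => pcomp w' (pcomp F (fmx v))) cone_id.
rewrite pcompDl pcompDr -!pcompA cone_rv pcomp1r pcomp1l.
rewrite [pcomp w' (pcomp s _)]pcompA cone_ws pcomp1l => /eqP.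
by rewrite -subr_eq0 addrK => /eqP.
Qed.
Lemma cone_rs0 : pcomp r s = 0.
Proof.
have := congr1 (fun F => pcomp r (pcomp F s)) cone_id.
rewrite pcompDl pcompDr -!pcompA cone_ws pcomp1r pcomp1l.
rewrite [pcomp r (pcomp (fmx v) _)]pcompA cone_rv pcomp1l => /eqP.
by rewrite -subr_eq0 addrK => /eqP.
Qed.
Lemma cone_wd : pcomp w' (fdif Z) = - pcomp (fdif X) w'.
Proof. by rewrite -pcompNl; exact: (fcommE w). Qed.
Lemma cone_rd : pcomp r (fdif Z) = pcomp (fdif Y) r + pcomp (fmx f) w'.
Proof.
rewrite -[LHS]pcomp1r -cone_id pcompDr -!pcompA [pcomp (fdif Z) (pcomp (fmx v) _)]pcompA.
rewrite -fcommE !pcompA cone_rv pcomp1l; congr (_ + _).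
have -> : pcomp (pcomp r (fdif Z)) s = pcomp r (pcomp (fmx v) (fmx f) - pcomp s (fdif X)).
  by rewrite -cone_dif addrK pcompA.
by rewrite pcompDr pcompA cone_rv pcomp1l pcompNr pcompA cone_rs0 pcomp0l subr0.
Qed.
Lemma cone_ds : pcomp (fdif Z) s = pcomp (fmx v) (fmx f) - pcomp s (fdif X).
Proof. by rewrite -cone_dif addrK. Qed.

(** The map from [hull X] is (s, d s). As v and s together are invertible in P_{S^1}, a compatible
    pair (p, q) determines the induced map as q r + p1 w, where p1 is the first component of p. *)
Lemma cone_std : std_triangle f v w.
Proof.
have mP : prow s (pcomp (fdif Z) s) \in @fcomm _ _ (hull X) Z.
  apply/eqP; rewrite /= pcol_row pcomp_row !pcomp_row_col !pcomp0r addr0 add0r.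
  by rewrite pcompZr !pcomp1r pcomp_row pcompA fdif2 pcompZl pcomp1l.
exists (FHom mP); split.
- split; first by apply: fhomP; rewrite /= pcomp_row_col pcomp1r addrC cone_dif.
  move=> Q p q; have [p1 [p2 ep]] := prowP (p : pmor k (hull X) Q).
  have := fcommE p; rewrite ep /= pcol_row pcomp_row !pcomp_row_col.
  rewrite pcomp_row !pcomp0r add0r addr0 pcompZr !pcomp1r => /prow_inj [ep2 _].
  move=> /(congr1 (@fmx _ _ _ _)); rewrite /= ep pcomp_row_col pcomp1r ep2 => pq.
  pose z := pcomp (fmx q) r + pcomp p1 w'.
  have zs : pcomp z s = p1.
    by rewrite pcompDl -!pcompA cone_rs0 cone_ws pcomp0r add0r pcomp1r.
  have zP : z \in @fcomm _ _ Z Q.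
    apply/eqP; rewrite /= pcompDl -!pcompA cone_rd cone_wd !pcompDr pcompNr.
    rewrite !pcompA -fcommE -pq -!addrA; congr (_ + _).
    by rewrite pcompDl [X in X - _]addrC addrK.
  exists (FHom zP); split.
    split; apply: fhomP => /=; last first.
      by rewrite pcompDl -!pcompA cone_rv cone_wv0 pcomp0r addr0 pcomp1r.
    rewrite ep pcomp_row zs ep2 pcompA (eqP zP) -pcompA zs //.
  move=> z' [/(congr1 (@fmx _ _ _ _)) /= e1 /(congr1 (@fmx _ _ _ _)) /= e2].
  apply: fhomP => /=; rewrite -[RHS]pcomp1r -cone_id pcompDr !pcompA e2.
  by move: e1; rewrite ep pcomp_row => /prow_inj [-> _].
- apply: fhomP; rewrite /= pcomp_row pcompA [pcomp (fmx w) s]cone_ws.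
  by rewrite [pcomp (fmx w) _]cone_wd pcompNl -pcompA [pcomp (fmx w) s]cone_ws pcomp1r.
by apply: fhomP; exact: cone_wv0.
Qed.

Lemma cone_susp0 : fcomp (susp_map f) w ==s 0.
Proof.
apply/stab_eqP; exists (r : pmor k Z (susp Y)).
rewrite fmx0 subr0 /htpy /= [pcomp r _]cone_rd pcompNl addrA addNr add0r //.
Qed.

(** Subtracting the homotopy given by m r makes g vanish strictly on v; what remains is its
    restriction along s, followed after w. *)
Lemma cone_factor Q (g : fhom Z Q) : fcomp g v ==s 0 ->
  exists h : fhom (susp X) Q, g ==s fcomp h w.
Proof.
move=> /stab_eqP [m]; rewrite fmx0 subr0 /= => em.
pose g' := fmx g - htpy (pcomp m r : pmor k Z Q).
have g'P : g' \in @fcomm _ _ Z Q by rewrite rpredB ?fmxP ?htpy_comm.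
have g'v : pcomp g' (fmx v) = 0.
  rewrite pcompDl pcompNl em /htpy pcompDl -!pcompA cone_rv -fcommE.
  by rewrite [pcomp r (pcomp _ _)]pcompA cone_rv pcomp1l pcomp1r subrr.
have hP : pcomp g' s \in @fcomm _ _ (susp X) Q.
  apply/eqP; rewrite /= pcompA -(eqP g'P) pcompNr -!pcompA cone_ds pcompDr.
  by rewrite [pcomp g' (pcomp (fmx v) _)]pcompA g'v pcomp0l add0r pcompNr.
exists (FHom hP); apply/stab_eqP; exists (pcomp m r); rewrite /= -pcompA.
have -> : pcomp s (fmx w) = pid k Z - pcomp (fmx v) r.
  by rewrite -cone_id addrAC subrr add0r.
by rewrite pcompDr pcomp1r pcompNr pcompA g'v pcomp0l subr0 /g' opprB addrCA subrr addr0.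
Qed.
End Data.

Fact cone_subproof X Y (f : fhom X Y) :
  let d : pmor k (psum Y X) (psum Y X) :=
    pcol (prow (fdif Y) (fmx f)) (prow 0 (- fdif X)) in
  pcomp d d = 'T *: pid k (psum Y X).
Proof.
rewrite /= pcomp_col !pcomp_row_col !pcomp0l add0r !pcomp_row !pcomp0r pcompNl !pcompNr.
by rewrite opprK prowD addr0 fcommE subrr !fdif2 pid_sum pcolZ !prowZ !scaler0.
Qed.
Definition cone X Y (f : fhom X Y) : obj := FObj (cone_subproof f).

Fact cin_subproof X Y (f : fhom X Y) : pcol (pid k Y) 0 \in @fcomm _ _ Y (cone f).
Proof.
apply/eqP; rewrite /= !pcomp_col !pcomp_row_col.
by rewrite !(pcomp0l, pcomp0r, pcomp1l, pcomp1r, addr0).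
Qed.
Definition cin X Y (f : fhom X Y) : fhom Y (cone f) := FHom (cin_subproof f).
Fact cout_subproof X Y (f : fhom X Y) : prow 0 (pid k X) \in @fcomm _ _ (cone f) (susp X).
Proof.
apply/eqP; rewrite /= pcomp_row_col !pcomp_row.
by rewrite !(pcomp0l, pcomp0r, pcomp1l, pcomp1r, prow00, add0r).
Qed.
Definition cout X Y (f : fhom X Y) : fhom (cone f) (susp X) := FHom (cout_subproof f).

Lemma coneP X Y (f : fhom X Y) :
  cone_data f (cin f) (cout f) (prow (pid k Y) 0) (pcol 0 (pid k X)).
Proof.
split => /=; rewrite ?pid_sum; do !blk => //.
by rewrite addNr.
Qed.

(** Pushouts are unique up to strict isomorphism, and the splitting of the explicit cone is
    transported along it. *)
Lemma std_is_cone X Y Z (f : fhom X Y) (v : fhom Y Z) (w : fhom Z (susp X)) :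
  std_triangle f v w -> is_cone f v w.
Proof.
move=> [m [[mv univ] wm wv]]; have D := coneP f.
have [m0 [[m0v univ0] wm0 wv0]] := cone_std D.
have [z [[zm zv] _]] := univ _ m0 (cin f) m0v.
have [y [[ym yv] _]] := univ0 _ m v mv.
have yz : fcomp y z = fid Z.
  have [x [_ ux]] := univ _ m v mv.
  rewrite -(ux (fcomp y z)) ?(ux (fid Z)) ?fcomp1l //.
  by rewrite -!fcompA zm zv.
have wy : fcomp w y = cout f.
  have [x [_ ux]] := univ0 _ (hull_out X) 0 (etrans (hull_exact X).1 (esym (fcomp0l _ _))).
  by rewrite -(ux (fcomp w y)) ?(ux (cout f)) // -!fcompA ym yv.
pose r := pcomp (prow (pid k Y) 0) (fmx z) : pmor k Z Y.
pose s := pcomp (fmx y) (pcol 0 (pid k X)) : pmor k X Z.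
have wE : w = fcomp (cout f) z by rewrite -wy -fcompA yz fcomp1r.
have [ws0 rv0 id0 ds0] := D.
exists r, s; split.
- by rewrite /s pcompA [pcomp (fmx w) _](congr1 (@fmx _ _ _ _) wy).
- by rewrite /r -pcompA [pcomp (fmx z) _](congr1 (@fmx _ _ _ _) zv).
- rewrite /r /s wE -yv /= -!pcompA !pcompA -!pcompDl -!(pcompA (fmx y)) -!pcompDr.
  by rewrite id0 pcomp1r; exact: (congr1 (@fmx _ _ _ _) yz).
- rewrite /s pcompA -fcommE -!pcompA -pcompDr ds0 pcompA.
  by rewrite [pcomp (fmx y) _](congr1 (@fmx _ _ _ _) yv).
Qed.

Lemma stab_iso_lr X Y (f : fhom X Y) (g h : fhom Y X) :
  stab_iso (fcomp g f) -> stab_iso (fcomp f h) -> stab_iso f.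
Proof.
move=> [a [e1 _]] [b [_ e2]].
have e : fcomp a g ==s fcomp h b.
  apply: (@stab_trans _ _ _ _ (fcomp (fcomp a g) (fcomp (fcomp f h) b))).
    by rewrite e2 fcomp1r.
  by rewrite -!fcompA [fcomp g (fcomp f _)]fcompA [fcomp a (fcomp _ _)]fcompA e1 fcomp1l.
exists (fcomp a g); split; first by rewrite -fcompA.
by rewrite e fcompA.
Qed.

Let zmod_da (V : zmodType) (A B C D S : V) :
  A - B = C + D -> B - S + C = A - (S + D).
Proof.
move=> e; have -> : A = B + C + D by rewrite -[A](subrK B) e addrC addrA.
by rewrite opprD [- S - D]addrC addrA addrK addrAC.
Qed.

(** The induced map is triangular, with x and y on the diagonal and the homotopy m in the corner.
    The squares with the structure maps of the cones thus commute strictly, although the given one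
    commutes only stably. *)
Lemma cone_map_ex X Y Z X' Y' Z' (f : fhom X Y) (v : fhom Y Z) (w : fhom Z (susp X))
    (f' : fhom X' Y') (v' : fhom Y' Z') (w' : fhom Z' (susp X'))
    (x : fhom X X') (y : fhom Y Y') :
  is_cone f v w -> is_cone f' v' w' -> fcomp y f ==s fcomp f' x ->
  exists z : fhom Z Z', fcomp z v = fcomp v' y /\ fcomp w' z = fcomp (susp_map x) w.
Proof.
move=> [r [s D]] [r' [s' D']] /stab_eqP [m /= em].
pose a := pcomp s' (fmx x) + pcomp (fmx v') m.
pose z := pcomp (pcomp (fmx v') (fmx y)) r + pcomp a (fmx w : pmor k Z X).
have zP : z \in @fcomm _ _ Z Z'.
  have da : pcomp (fdif Z') a = pcomp (pcomp (fmx v') (fmx y)) (fmx f) - pcomp a (fdif X).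
    have := congr1 (pcomp (fmx v')) em; rewrite /a /htpy !pcompDr pcompDl pcompNr.
    rewrite [pcomp (fdif Z') (pcomp s' _)]pcompA (cone_ds D').
    rewrite [pcomp (fdif Z') (pcomp (fmx v') _)]pcompA -(fcommE v') pcompDl pcompNl.
    rewrite -!pcompA -(fcommE x).
    exact: zmod_da.
  have e1 : pcomp z (fdif Z) = pcomp (fmx v') (pcomp (fmx y) (pcomp (fdif Y) r)) +
      (pcomp (fmx v') (pcomp (fmx y) (pcomp (fmx f) (fmx w))) -
       pcomp a (pcomp (fdif X) (fmx w))).
    rewrite /z pcompDl -!pcompA (cone_rd D) [pcomp _ (fdif Z)](cone_wd w).
    by rewrite !(pcompDr (fmx _)) pcompNr addrA.
  apply/eqP; rewrite e1 /z pcompDr [pcomp (fdif Z') (pcomp a _)]pcompA da.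
  rewrite pcompDl pcompNl -!pcompA; congr (_ + _).
  rewrite [RHS]pcompA -fcommE -pcompA; congr pcomp.
  by rewrite [RHS]pcompA -fcommE -pcompA.
exists (FHom zP); split; apply: fhomP => /=; rewrite /z.
  by rewrite pcompDl -!pcompA (cone_rv D) [pcomp (fmx w) _](cone_wv0 D) !pcomp0r addr0 pcomp1r.
rewrite pcompDr !pcompA [pcomp (fmx w') _](cone_wv0 D') !pcomp0l add0r /a pcompDr !pcompA.
by rewrite [pcomp (fmx w') _](cone_ws D') [pcomp (fmx w') _](cone_wv0 D') pcomp0l addr0 pcomp1l.
Qed.
End Cones.

Section Triangles.
Variables (k : fieldType) (R : realType).
Local Notation obj := (fobj k R).
Implicit Types X Y Z W : obj.

Lemma cone_is_cone X Y (f : fhom X Y) : is_cone f (cin f) (cout f).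
Proof. by exists (prow (pid k Y) 0), (pcol 0 (pid k X)); exact: coneP. Qed.

(** Put n = th - 1. As n v is stably zero, n factors through w, and then w n = 0 gives n^2 = 0; the
    inverse is 1 - n. This takes the place of the five lemma. *)
Lemma cone_endo X Y Z (f : fhom X Y) (v : fhom Y Z) (w : fhom Z (susp X))
    (th : fhom Z Z) : is_cone f v w ->
  fcomp th v ==s v -> fcomp w th ==s w -> stab_iso th.
Proof.
move=> [r [s D]] e1 e2; have [n nE] : exists n, n = th - fid Z by exists (th - fid Z).
have nv : fcomp n v ==s 0.
  by rewrite nE fcompDl fcompNl fcomp1l; apply/stab_sub0.
have wn : fcomp w n ==s 0.
  by rewrite nE fcompDr fcompNr fcomp1r; apply/stab_sub0.
have [h e] := cone_factor D nv.
have nn : fcomp n n ==s 0 by rewrite [X in fcomp X n]e -fcompA wn fcomp0r.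
have thE : th = fid Z + n by rewrite nE addrC subrK.
exists (fid Z - n); rewrite thE !(fcompDl, fcompDr, fcompNl, fcompNr, fcomp1l, fcomp1r).
by split; rewrite nn subr0 ?addrA ?subrK ?addrK.
Qed.

Lemma cone_map_iso X Y Z X' Y' Z' (f : fhom X Y) (v : fhom Y Z) (w : fhom Z (susp X))
    (f' : fhom X' Y') (v' : fhom Y' Z') (w' : fhom Z' (susp X'))
    (x : fhom X X') (y : fhom Y Y') :
  is_cone f v w -> is_cone f' v' w' -> stab_iso x -> stab_iso y ->
  fcomp y f ==s fcomp f' x ->
  exists z : fhom Z Z', [/\ stab_iso z, fcomp z v = fcomp v' y &
    fcomp w' z = fcomp (susp_map x) w].
Proof.
move=> C C' [x' [x'x xx']] [y' [y'y yy']] e.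
have [z [zv wz]] := cone_map_ex C C' e.
have e' : fcomp y' f' ==s fcomp f x'.
  rewrite -[X in fcomp y' X ==s _]fcomp1r -xx' [fcomp f' _]fcompA -e !fcompA.
  by rewrite y'y fcomp1l.
have [z' [z'v wz']] := cone_map_ex C' C e'.
exists z; split=> //; apply: (@stab_iso_lr _ _ _ _ z z' z').
  apply: (cone_endo C); first by rewrite -fcompA zv fcompA z'v -fcompA y'y fcomp1r.
  by rewrite fcompA wz' -fcompA wz fcompA -susp_mapM x'x susp_map1 fcomp1l.
apply: (cone_endo C'); first by rewrite -fcompA z'v fcompA zv -fcompA yy' fcomp1r.
by rewrite fcompA wz -fcompA wz' fcompA -susp_mapM xx' susp_map1 fcomp1l.
Qed.

Lemma stab_iso_id X : stab_iso (fid X).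
Proof. by exists (fid X); rewrite fcomp1l. Qed.

Lemma cone_dist X Y Z (f : fhom X Y) (v : fhom Y Z) (w : fhom Z (susp X)) :
  is_cone f v w -> distinguished f v w.
Proof.
move=> [r [s D]]; exists X, Y, Z, f, v, w, (fid X), (fid Y), (fid Z).
split; first exact: cone_std D.
- by split; apply: stab_iso_id.
- by rewrite fcomp1l fcomp1r.
- by rewrite fcomp1l fcomp1r.
by rewrite susp_map1 fcomp1l fcomp1r.
Qed.

Lemma dist_iso X Y Z (f : fhom X Y) (v : fhom Y Z) (w : fhom Z (susp X))
    X' Y' Z' (f' : fhom X' Y') (v' : fhom Y' Z') (w' : fhom Z' (susp X'))
    (x : fhom X X') (y : fhom Y Y') (z : fhom Z Z') :
  distinguished f' v' w' -> stab_iso x -> stab_iso y -> stab_iso z ->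
  fcomp y f ==s fcomp f' x -> fcomp z v ==s fcomp v' y ->
  fcomp (susp_map x) w ==s fcomp w' z -> distinguished f v w.
Proof.
move=> [X1 [Y1 [Z1 [f1 [v1 [w1 [x1 [y1 [z1 [S [xi yi zi] e1 e2 e3]]]]]]]]]].
move=> xi' yi' zi' h1 h2 h3.
exists X1, Y1, Z1, f1, v1, w1, (fcomp x1 x), (fcomp y1 y), (fcomp z1 z).
split=> //; first by split; apply: stab_iso_comp.
- by rewrite -fcompA h1 fcompA e1 fcompA.
- by rewrite -fcompA h2 fcompA e2 fcompA.
- by rewrite susp_mapM -fcompA h3 fcompA e3 fcompA.
Qed.

Lemma dist_cone X Y Z (f : fhom X Y) (v : fhom Y Z) (w : fhom Z (susp X))
    Z' (v' : fhom Y Z') (w' : fhom Z' (susp X)) :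
  distinguished f v w -> is_cone f v' w' ->
  exists z : fhom Z Z', [/\ stab_iso z, fcomp z v ==s v' & fcomp w' z ==s w].
Proof.
move=> [X1 [Y1 [Z1 [f1 [v1 [w1 [x [y [z [S [xi yi zi] e1 e2 e3]]]]]]]]]] C.
case: xi yi => [x' [x'x xx']] [y' [y'y yy']].
have [|||t [ti tv wt]] := @cone_map_iso _ _ _ _ _ _ _ _ _ _ _ _ x' y' (std_is_cone S) C.
- by exists x.
- by exists y.
- rewrite -[X in fcomp y' X ==s _]fcomp1r -xx' [fcomp f1 _]fcompA -e1 !fcompA.
  by rewrite y'y fcomp1l.
exists (fcomp t z); split; first exact: stab_iso_comp.
- by rewrite -fcompA e2 fcompA tv -fcompA y'y fcomp1r.
- by rewrite fcompA wt -fcompA -e3 fcompA -susp_mapM x'x susp_map1 fcomp1l.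
Qed.

(** A conflation [X -> Y -> Z] yields a triangle, as [Z] is then homotopy
    equivalent to the cone of [X -> Y]. *)
Lemma exact_dist X Y Z (f : fhom X Y) (v : fhom Y Z) :
  exact_seq f v -> exists w, distinguished f v w.
Proof.
move=> [/(congr1 (@fmx _ _ _ _)) /= vf [r [s [rf vs e]]]].
have rs : pcomp r s = 0.
  have := congr1 (fun F => pcomp r (pcomp F s)) e.
  rewrite pcompDl pcompDr -!pcompA vs pcomp1r pcomp1l pcompA rf pcomp1l => /eqP.
  by rewrite -subr_eq0 addrK => /eqP.
(* The map [ka] measures how far the section s is from commuting with the differentials; (s, ka) is
   the homotopy inverse of the projection (v, 0) from the cone. *)
pose ka := - pcomp (pcomp r (fdif Y)) s : pmor k Z X.
have fr : pcomp (fmx f) r = pid k Y - pcomp s (fmx v) by rewrite -e addrK.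
have fka : pcomp (fmx f) ka = pcomp s (fdif Z) - pcomp (fdif Y) s.
  rewrite /ka pcompNr !pcompA fr !pcompDl !pcompNl !pcomp1l -(pcompA s) fcommE -!pcompA.
  by rewrite vs pcomp1r opprB.
have zP : pcol s ka \in @fcomm _ _ Z (cone f).
  apply/eqP; rewrite /= !pcomp_col !pcomp_row_col pcomp0l add0r fka addrC subrK.
  congr pcol.
  have f_inj (U : pobj R) (F G : pmor k U X) :
      pcomp (fmx f) F = pcomp (fmx f) G -> F = G.
    by move=> /(congr1 (pcomp r)); rewrite !pcompA rf !pcomp1l.
  apply: f_inj; rewrite pcompNl pcompNr !pcompA fcommE -(pcompA (fdif Y)) fka.
  rewrite !pcompDl !pcompNl pcompDr pcompNr -!pcompA. rewrite fdif2 [pcomp _ (pcomp (fdif Y) s)]pcompA fdif2.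
  by rewrite pcompZl pcompZr pcomp1l pcomp1r opprB.
have pP : prow (fmx v) 0 \in @fcomm _ _ (cone f) Z.
  by apply/eqP; rewrite /= pcomp_row_col !pcomp_row !pcomp0l prow00 addr0 pcomp0r vf -fcommE.
pose z : fhom Z (cone f) := FHom zP; pose p : fhom (cone f) Z := FHom pP.
have pz : fcomp p z = fid Z by apply: fhomP; rewrite /= pcomp_row_col pcomp0l addr0.
have zp : fcomp z p ==s fid (cone f).
  apply/stab_eqP; exists (pcol 0 (prow (- r) 0)); rewrite /htpy /=.
  have sv : pcomp s (fmx v) = pid k Y - pcomp (fmx f) r by rewrite -e addrAC subrr add0r.
  have kv : pcomp ka (fmx v) = pcomp (fdif X) r - pcomp r (fdif Y).
    rewrite /ka pcompNl -!pcompA sv !pcompDr pcompNr !pcompNr.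
    by rewrite pcomp1r [pcomp (fdif Y) _]pcompA -fcommE !pcompA rf pcomp1l opprB.
  rewrite !(pcomp_col, pcomp_row_col, pcomp_row) pid_sum sv kv.
  rewrite !(pcomp0l, pcomp0r, pcompNl, pcompNr, rf, pcomp1l, pcomp1r).
  rewrite !(prow00, pcolN, prowN, pcolD, prowD, oppr0, addr0, add0r, opprK).
  by rewrite addrAC subrr add0r.
exists (fcomp (cout f) z).
apply: (@dist_iso _ _ _ _ _ _ _ _ _ _ _ _ (fid X) (fid Y) z
  (cone_dist (cone_is_cone f))).
- exact: stab_iso_id.
- exact: stab_iso_id.
- by exists p; rewrite pz.
- by rewrite fcomp1l fcomp1r.
- rewrite fcomp1r -[X in _ ==s X]fcomp1l -zp -fcompA.
  by apply: stab_comp => //; apply: stab_eqE; apply: fhomP; rewrite /= pcomp_row_col pcomp1r pcomp0l addr0.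
- by rewrite susp_map1 fcomp1l.
Qed.

(** The usual signs of [susp_map f] and [susp_map v] cancel up to isomorphism
    of triangles. *)
Lemma rotate X Y Z (f : fhom X Y) (v : fhom Y Z) (w : fhom Z (susp X)) :
  is_cone f v w -> distinguished w (susp_map f) (susp_map v).
Proof.
move=> [r [s D]].
have zP : pcol 0 (fmx v) \in @fcomm _ _ (susp Y) (cone w).
  apply/eqP; rewrite /= !pcomp_col !pcomp_row_col !(pcomp0l, pcomp0r, add0r).
  by rewrite [pcomp (fmx w) _](cone_wv0 D) pcompNl pcompNr fcommE.
have pP : prow (fmx f) r \in @fcomm _ _ (cone w) (susp Y).
  apply/eqP; rewrite /= pcomp_row_col !pcomp_row !(pcomp0l, pcomp0r, add0r).
  rewrite prowD addr0 !pcompNr !pcompNl fcommE; congr prow.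
  by rewrite (cone_rd D) opprD addrA addrAC subrr add0r.
pose z : fhom (susp Y) (cone w) := FHom zP; pose p : fhom (cone w) (susp Y) := FHom pP.
have pz : fcomp p z = fid (susp Y).
  by apply: fhomP; rewrite /= pcomp_row_col pcomp0r add0r (cone_rv D).
have zp : fcomp z p ==s fid (cone w).
  apply/stab_eqP; exists (pcol 0 (prow (- s) 0)); rewrite /htpy /=.
  rewrite !(pcomp_col, pcomp_row_col, pcomp_row) pid_sum.
  rewrite !(pcomp0l, pcomp0r, pcompNl, pcompNr, pcomp1l, pcomp1r).
  rewrite !(prow00, pcolN, prowN, pcolD, prowD, oppr0, addr0, add0r, opprK).
  rewrite [pcomp (fmx w) s](cone_ws D) (cone_dif D) -(cone_id D) opprD addrA subrr.
  by rewrite sub0r.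
apply: (@dist_iso _ _ _ _ _ _ _ _ _ _ _ _ (fid Z) (fid (susp X)) z
  (cone_dist (cone_is_cone w))).
- exact: stab_iso_id.
- exact: stab_iso_id.
- by exists p; rewrite pz.
- by rewrite fcomp1l fcomp1r.
- rewrite fcomp1r -[X in _ ==s X]fcomp1l -zp -fcompA.
  by apply: stab_comp => //; apply: stab_eqE; apply: fhomP; rewrite /= pcomp_row_col pcomp1r pcomp0r addr0.
- rewrite susp_map1 fcomp1l; apply: stab_eqE; apply: fhomP.
  by rewrite /= pcomp_row_col pcomp0l add0r pcomp1l.
Qed.

(** The cone [T + (B + D)] of [(b, g) : B + D -> T] contains the cones of [b]
    and of [g], with quotients [susp D] and [susp B], and is the cone of both
    [B -> T -> cone g] and [D -> T -> cone b]. *)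
Section Octahedron.
Variables (T B D : obj) (b : fhom B T) (g : fhom D T).
Let V := cone (frow b g).
Let i := cin (frow b g).

Fact jl_subproof :
  pcol (prow (pid k T) 0) (pcol (prow 0 (pid k B)) 0) \in @fcomm _ _ (cone b) V.
Proof. by apply/eqP; do !blk. Qed.
Definition jl : fhom (cone b) V := FHom jl_subproof.
Fact jr_subproof :
  pcol (prow (pid k T) 0) (pcol 0 (prow 0 (pid k D))) \in @fcomm _ _ (cone g) V.
Proof. by apply/eqP; do !blk. Qed.
Definition jr : fhom (cone g) V := FHom jr_subproof.
Fact ql_subproof : prow 0 (prow (pid k B) 0) \in @fcomm _ _ V (susp B).
Proof. by apply/eqP; do !blk. Qed.
Definition ql : fhom V (susp B) := FHom ql_subproof.
Fact qr_subproof : prow 0 (prow 0 (pid k D)) \in @fcomm _ _ V (susp D).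
Proof. by apply/eqP; do !blk. Qed.
Definition qr : fhom V (susp D) := FHom qr_subproof.

Lemma jl_cin : fcomp jl (cin b) = i.
Proof. by apply: fhomP; do !blk. Qed.
Lemma jr_cin : fcomp jr (cin g) = i.
Proof. by apply: fhomP; do !blk. Qed.
Lemma ql_jl : fcomp ql jl = cout b.
Proof. by apply: fhomP; do !blk. Qed.
Lemma qr_jr : fcomp qr jr = cout g.
Proof. by apply: fhomP; do !blk. Qed.
Lemma cone_jr : is_cone (fcomp (cin g) b) jr ql.
Proof.
exists (pcol (prow (pid k T) 0) (prow 0 (prow 0 (pid k D)))), (pcol 0 (pcol (pid k B) 0)).
by split; do !blk => //; [rewrite pcol_row pcol00|rewrite addNr pcol00].
Qed.
Lemma cone_jl : is_cone (fcomp (cin b) g) jl qr.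
Proof.
exists (pcol (prow (pid k T) 0) (prow 0 (prow (pid k B) 0))), (pcol 0 (pcol 0 (pid k D))).
by split; do !blk => //; [rewrite pcol_row pcol00|rewrite addNr pcol00].
Qed.
(** V is the union of the two cones glued along T, so this is a Mayer-Vietoris sequence; it accounts
    for the sign of u in the exchange triangle. *)
Lemma exact_jlr : exact_seq (fcol (cin b) (cin g)) (frow jl (- jr)).
Proof.
split.
  by rewrite frow_col fcompNl jl_cin jr_cin subrr.
exists (prow 0 (prow (pid k T) 0)).
exists (pcol (pcol (prow (pid k T) 0) (prow 0 (prow (pid k B) 0)))
   (pcol 0 (prow 0 (prow 0 (- pid k D))))).
split; rewrite /= ?fmxN; do !blk => //.
  by rewrite pcol_row pcol00.
by rewrite subrr prow00 !pcol_row !pcol00.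
Qed.
(** The two terms add up to the composite of consecutive maps in the triangle of (b, g). *)
Lemma ql_qr : fcomp (susp_map b) ql ==s - fcomp (susp_map g) qr.
Proof.
have := cone_susp0 (coneP (frow b g)).
have -> : fcomp (susp_map (frow b g)) (cout (frow b g)) =
   fcomp (susp_map b) ql - - fcomp (susp_map g) qr.
  by rewrite opprK; apply: fhomP; rewrite [RHS]fmxD; do !blk.
by move/stab_sub0.
Qed.
End Octahedron.

Definition fdsum X Y X' Y' (f : fhom X X') (g : fhom Y Y') : fhom (fsum X Y) (fsum X' Y') :=
  fcol (fcomp f (fpr1 X Y)) (fcomp g (fpr2 X Y)).

Lemma fdsum_col X Y X' Y' Z (f : fhom X X') (g : fhom Y Y') (a : fhom Z X) (b : fhom Z Y) :
  fcomp (fdsum f g) (fcol a b) = fcol (fcomp f a) (fcomp g b).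
Proof.
rewrite fcolM -!fcompA !frow_col.
by rewrite !(fcomp1l, fcomp0l, addr0, add0r).
Qed.
Lemma row_fdsum X Y X' Y' Z (f : fhom X X') (g : fhom Y Y') (a : fhom X' Z) (b : fhom Y' Z) :
  fcomp (frow a b) (fdsum f g) = frow (fcomp a f) (fcomp b g).
Proof.
rewrite frow_col /fpr1 /fpr2 !frowM !(fcomp1r, fcomp0r).
by apply: fhomP; rewrite [LHS]fmxD /= prowD addr0 add0r.
Qed.
Lemma fdsum1 X Y : fdsum (fid X) (fid Y) = fid (fsum X Y).
Proof. by rewrite /fdsum !fcomp1l fid_sum. Qed.
Lemma fdsumM X Y X' Y' X'' Y'' (f' : fhom X' X'') (g' : fhom Y' Y'') (f : fhom X X') (g : fhom Y Y') :
  fcomp (fdsum f' g') (fdsum f g) = fdsum (fcomp f' f) (fcomp g' g).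
Proof. by rewrite fdsum_col !fcompA. Qed.
Lemma fdsum_iso X Y X' Y' (f : fhom X X') (g : fhom Y Y') :
  stab_iso f -> stab_iso g -> stab_iso (fdsum f g).
Proof.
move=> [f' [f'f ff']] [g' [g'g gg']]; exists (fdsum f' g').
have E Z W (x : fhom Z Z) (y : fhom W W) : x ==s fid Z -> y ==s fid W ->
    fdsum x y ==s fid (fsum Z W).
  by move=> ex ey; rewrite -fdsum1 /fdsum ex ey.
by rewrite !fdsumM; split; apply: E.
Qed.
End Triangles.

Section ConeE.
Variables (k : fieldType) (R : realType).
Local Notation obj := (fobj k R).
Local Notation E := (@Eo k R).
Implicit Types p q r s : S1 R.

Lemma wrap_rot p q r : p != q -> wrap p q r = false -> q != r -> p != r -> wrap q r p = false.
Proof.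
move=> pq w qr pr; have := wrap_cocycle p q r p; rewrite !wrap_pqp w.
by rewrite pq pr; case: (wrap q r p).
Qed.

(** The two copies of P_p in the cone are joined by an identity and cancel, which leaves P_q and
    P_s. *)
Lemma cone_E p q s (f : fhom (E p q) (E p s)) :
  p != q -> p != s -> q != s -> wrap p q s = false ->
  fmx f = mat4 p q p s 1 0 0 1 -> isE (cone f) q s.
Proof.
move=> pq ps qs w ef; split=> //.
have w1 := wrap_rot pq w qs ps.
have sp : s != p by rewrite eq_sym.
have qp : q != p by rewrite eq_sym.
have sq : s != q by rewrite eq_sym.
have w2 := wrap_rot qs w1 sp qp.
have w' : wrap p s q by have := wrap_cocycle p q s q; rewrite w !wrap_r wrap_pqp qs; case: wrap.
have w1' : wrap q p s by rewrite wrap_qpr // w.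
have w2' : wrap s q p by rewrite wrap_qpr // w1.
(* The entry -1 sends P_s into a copy of P_p as well, as commutation with the differential of the
   cone requires. *)
pose F := pcol (mat4 q s p s 0 0 0 1 : pmor k _ _) (mat4 q s p q 0 (-1) 1 0).
pose G := prow (mat4 p s q s 1 0 0 1 : pmor k _ _) (mat4 p q q s 0 1 0 0).
have W := (wrap_l, wrap_r, wrap_pqp, w, w1, w2, w', w1', w2', pq, ps, qs, qp, sp, sq).
have NF := (negbTE pq, negbTE ps, negbTE qs, negbTE qp, negbTE sp, negbTE sq).
have FP : F \in @fcomm _ _ (E q s) (cone f).
  apply/eqP; rewrite /= ef /F /Eo_dif [LHS]pcomp_col [RHS]pcomp_col !pcomp_row_col.
  rewrite pcomp0l add0r pcompNl !mat4M !mat4N !mat4D ?NF ?W /=.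
  rewrite !(mulr0, mul0r, mulr1, mul1r, addr0, add0r, oppr0, opprK, expr0, expr1).
  by rewrite subrr.
have GP : G \in @fcomm _ _ (cone f) (E q s).
  apply/eqP; rewrite /= ef /G /Eo_dif !pcomp_row_col !pcomp_row.
  rewrite pcomp0r prowD pcompNr !mat4M !mat4N !mat4D ?NF ?W /=.
  rewrite !(mulr0, mul0r, mulr1, mul1r, addr0, add0r, oppr0, opprK, expr0, expr1).
  by rewrite subrr.
exists (FHom GP), (FHom FP); split; last first.
  apply: stab_eqE; apply: fhomP; rewrite /= pcomp_row_col !mat4M mat4D mat4_1 ?W /=.
  by rewrite !(mulr0, mul0r, mulr1, mul1r, addr0, add0r, oppr0, opprK, expr0, expr1).
(* The homotopy contracts the two copies of P_p onto each other. *)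
apply/stab_eqP; exists (pcol 0 (prow (mat4 p s p q (-1) 0 0 0) 0)).
rewrite /htpy /= ef /F /G /Eo_dif !pcomp_row pid_sum.
rewrite [in LHS]pcomp_col [pcomp (pcol _ _) (mat4 p q q s _ _ _ _)]pcomp_col.
rewrite [X in _ = X + _]pcomp_col [X in _ = _ + X]pcomp_col !pcomp_row_col !pcomp_row.
rewrite !(pcomp0l, pcomp0r, add0r, addr0, pcompNl, pcompNr, prow00, prowN).
rewrite !mat4_1 !mat4M !mat4N ?NF ?W /=.
rewrite !(mulr0, mul0r, mulr1, mul1r, addr0, add0r, oppr0, opprK, expr0, expr1, mat4_0).
rewrite -pcol_row pcolN !prowN oppr0 !mat4N !pcolD !prowD !mat4D.
by rewrite !(addr0, add0r, oppr0, subrr).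
Qed.
End ConeE.

(** * Geodesics *)

Section Geometry.
Variables (k : fieldType) (R : realType).
Local Notation obj := (fobj k R).
Implicit Types (o p q r s u v : S1 R) (X Y Z : obj).

(** In coordinates f is a nonzero multiple of the map of [cone_E]; the scalar is absorbed into the
    identification of Y. *)
Lemma isE_cone X Y p q s (f : fhom X Y) : isE X p q -> isE Y p s ->
  q != s -> wrap p q s = false -> ~ f ==s 0 -> isE (cone f) q s.
Proof.
move=> [pq [x xi]] [ps [y yi]] qs w f0.
have h : sep p q p s by rewrite /sep wrap_pqp pq w.
have [e [eE e1]] := hc_basis k pq ps h.
have [f' ef] := transport y f xi.
have e0 : ~ e ==s 0 by rewrite (hc0P e pq ps h) e1 => /eqP; rewrite oner_eq0.
have [c ec] := isE_dim1 f' (isE_Eo k pq) (isE_Eo k ps) e0.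
have c0 : c != 0.
  apply/eqP => c0; apply: f0.
  by rewrite -(comp_iso_l _ yi) -ef ec c0 fpsC0 scale0r fcomp0l.
have yi' : stab_iso (fpsC c^-1 *: y) by apply: stab_isoZ => //; rewrite invr_eq0.
have [|z [zi _ _]] := cone_map_iso (cone_is_cone f) (cone_is_cone e) xi yi'.
  by rewrite fcompZl -ef ec fcompZl scalerA fpsCV // scale1r.
apply: isE_iso (cone_E pq ps qs w eE) _.
by apply: iso_sym; exists z.
Qed.

(** Measured from a base point o, points become numbers in [0, 2 pi), and questions of cyclic order
    become linear arithmetic. *)
Lemma arc_coord o p q :
  arc p q = arc o q - arc o p + (if arc o q < arc o p then twopi R else 0).
Proof.
have := wrapP o p q; rewrite wrapE.
by case: ltP => _; rewrite ?mulr1 ?mulr0; lra.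
Qed.

Lemma wrap_coord o p q r (x := arc o p) (y := arc o q) (z := arc o r) :
  wrap p q r = [|| (x <= z) && (z < y), (z < y) && (y < x) | (y < x) && (x <= z)].
Proof.
rewrite wrapE (arc_coord o p r) (arc_coord o p q) -/x -/y -/z.
have := arc_ge0 o p; have := arc_ge0 o q; have := arc_ge0 o r.
have := arc_lt o p; have := arc_lt o q; have := arc_lt o r; rewrite -/x -/y -/z.
move=> z2 y2 x2 z0 y0 x0.
case: (ltP z x) => zx; case: (ltP y x) => yx; case: (ltP z y) => zy /=;
  by [apply/idP; lra|apply/negbTE; rewrite -leNgt; lra].
Qed.

Lemma eq_coord o p q : (p == q) = (arc o p == arc o q).
Proof. by rewrite (inj_eq (@arc_inj R o)). Qed.

(** The geodesics [pq] and [rs] cross. *)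
Definition cross p q r s :=
  [&& p != r, p != s, q != r, q != s & wrap p q r (+) wrap p q s].

Lemma crossC p q r s : p != q -> cross q p r s = cross p q r s.
Proof.
by move=> pq; rewrite /cross !(wrap_qpr _ pq) addbN addNb negbK; do !case: eqP.
Qed.
Lemma crossC' p q r s : cross p q s r = cross p q r s.
Proof. by rewrite /cross addbC; do !case: eqP. Qed.

Lemma cross_coord o p q r s (x := arc o p) (y := arc o q) (a := arc o r) (b := arc o s) :
  x < y -> a < b ->
  cross p q r s = ((x < a) && (a < y) && (y < b)) || ((a < x) && (x < b) && (b < y)).
Proof.
move=> xy ab; rewrite /cross !(eq_coord o) !(wrap_coord o) -/x -/y -/a -/b.
case: (ltgtP x a) => h1; case: (ltgtP x b) => h2; case: (ltgtP y a) => h3;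
  case: (ltgtP y b) => h4; rewrite /= ?andbF ?andbT ?orbF //;
  try (exfalso; lra);  case: (ltgtP x y) => h5 //=; try (exfalso; lra).
Qed.

Lemma sep_addb p q r s : sep p q r s || sep p q s r = wrap p q r (+) wrap p q s.
Proof. by rewrite /sep; case: (wrap p q r); case: (wrap p q s). Qed.

Lemma coord_lt o p q : p != q -> arc o p < arc o q \/ arc o q < arc o p.
Proof. by rewrite (eq_coord o); case: ltgtP; [left|right|]. Qed.

Lemma hom2_coord o p q r s (x := arc o p) (y := arc o q) (a := arc o r) (b := arc o s) :
  x < y -> a < b ->
  wrap p q r (+) wrap p q s = ((x <= a) && (a < y) && (y <= b)) ||
     ((a < x) && (x <= b) && (b < y)).
Proof.
move=> xy ab; rewrite !(wrap_coord o) -/x -/y -/a -/b.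
case: (ltP a x) => h1; case: (ltP b x) => h2; case: (ltP a y) => h3;
  case: (ltP b y) => h4; rewrite /= ?andbF ?andbT ?orbF //;
  try (exfalso; lra);  case: (ltgtP x y) => h5 //=; try (exfalso; lra).
Qed.

Lemma cross_sym p q r s : p != q -> r != s -> cross r s p q = cross p q r s.
Proof.
move=> pq rs.
wlog xy : p q pq / arc p p < arc p q.
  move=> W; case: (coord_lt p pq) => h; first exact: W.
  by rewrite -(crossC' r s p q) -(crossC r s pq) ; move: h; rewrite arc_refl ltNge arc_ge0.
wlog ab : r s rs / arc p r < arc p s.
  move=> W; case: (coord_lt p rs) => h; first exact: W.
  by rewrite -(crossC p q rs) -(crossC' p q r s); apply: W => //; rewrite eq_sym.
rewrite (cross_coord ab xy) (cross_coord xy ab).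
by apply/idP/idP => /orP [] /andP [/andP [-> ->] ->]; rewrite ?orbT.
Qed.

(** Between distinct noncrossing geodesics a nonzero map turns forward about a common endpoint, and
    no nonzero map turns back. *)
Lemma hom2_eq p q r s : p != q -> r != s -> ~~ cross p q r s ->
  wrap p q r (+) wrap p q s -> wrap r s p (+) wrap r s q ->
  (p = r /\ q = s) \/ (p = s /\ q = r).
Proof.
move=> pq rs; wlog ab : r s rs / arc p r < arc p s.
  move=> W; case: (coord_lt p rs) => h; first exact: W.
  rewrite -(crossC' p q r s) addbC => h1 h2 h3.
  case: (W s r _ h h1 h2) => [||[]|[]]; rewrite 1?eq_sym //; [|by right|by left].
  by move: h3; rewrite !(wrap_qpr _ rs) addbN addNb negbK.
have xy : arc p p < arc p q by case: (coord_lt p pq) => //; rewrite arc_refl ltNge arc_ge0.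
rewrite (cross_coord xy ab) (hom2_coord xy ab) (hom2_coord ab xy).
move=> n h h'; left.
have [e1 e2] : arc p p = arc p r /\ arc p q = arc p s.
  move: n h h'; rewrite negb_or !negb_and -!leNgt => /andP [n1 n2].
  by case/orP => /andP [/andP [h1 h2] h3]; case/orP => /andP [/andP [h4 h5] h6];
    move: n1 n2; case/orP => [/orP []|] ?; case/orP => [/orP []|] ?; split; lra.
by split; apply: (@arc_inj _ p).
Qed.

(** If the geodesics cross, each has its endpoints separated by the other, so nonzero maps exist in
    both directions. *)
Lemma compat_ncross X Y p q r s : isE X p q -> isE Y r s ->
  compatible X Y -> ~~ cross p q r s.
Proof.
move=> iX iY c; apply/negP => cr; have /and5P [n1 n2 n3 n4 h] := cr.
have pq := iX.1; have rs := iY.1.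
have ex Z W (p' q' r' s' : S1 R) : isE Z p' q' -> isE W r' s' ->
    wrap p' q' r' (+) wrap p' q' s' -> ~ hom_zero Z W.
  move=> iZ iW; rewrite -sep_addb => /orP [h'|h'] z0.
    by have [f f0] := isE_hom_ex iZ iW h'; apply: f0; apply: z0.
  by have [f f0] := isE_hom_ex iZ (isE_sym iW) h'; apply: f0; apply: z0.
case: c => [| |e].
- exact: ex iX iY h.
- apply: (ex _ _ _ _ _ _ iY iX); move: cr.
  by rewrite -(cross_sym pq rs) => /and5P [].
- by case: (isE_inj iX iY e) => -[e1 e2]; move: n1 n2; rewrite e1 ?eqxx.
Qed.

Lemma ncross_compat X Y p q r s : isE X p q -> isE Y r s ->
  ~~ cross p q r s -> compatible X Y.
Proof.
move=> iX iY n; have pq := iX.1; have rs := iY.1.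
have [h|h] := pselect (hom_zero X Y); first by apply: Or31.
have [h'|h'] := pselect (hom_zero Y X); first by apply: Or32.
move/existsNP: h => [f f0]; move/existsNP: h' => [g g0]; apply: Or33.
have := isE_hom iX iY f0; have := isE_hom iY iX g0; rewrite !sep_addb => h1 h2.
case: (hom2_eq pq rs n h2 h1) => -[e1 e2]; first by apply: isE_isoE iX _; rewrite e1 e2.
by apply: isE_isoE iX _; rewrite e1 e2; apply: isE_sym.
Qed.

(** [v0], [v1], [v2], [v3] follow each other on the circle. *)
Definition quad v0 v1 v2 v3 :=
  [&& v0 != v1, arc v0 v1 < arc v0 v2 & arc v0 v2 < arc v0 v3].

Section Quad.
Variables v0 v1 v2 v3 : S1 R.
Hypothesis Q : quad v0 v1 v2 v3.

Let Q0 : [/\ arc v0 v0 = 0, 0 < arc v0 v1, arc v0 v1 < arc v0 v2 &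
  arc v0 v2 < arc v0 v3].
Proof.
case/and3P: Q => n h1 h2; rewrite arc_refl; split=> //.
by rewrite lt_def arc_ge0 arc_eq0 n.
Qed.

Lemma quad_rot : quad v1 v2 v3 v0.
Proof.
case: Q0 => e h1 h2 h3; have := arc_lt v0 v3.
rewrite /quad (eq_coord v0) !(arc_coord v0 v1) e => h.
rewrite (lt_eqF h2) /=.
have -> : (arc v0 v2 < arc v0 v1) = false by apply/negbTE; rewrite -leNgt ltW.
have -> : (arc v0 v3 < arc v0 v1) = false.
  by apply/negbTE; rewrite -leNgt ltW // (lt_trans h2).
by rewrite h1; apply/andP; split; lra.
Qed.

Lemma quad_neq : [/\ v0 != v1, v0 != v2 & v0 != v3] /\ [/\ v1 != v2, v1 != v3 & v2 != v3].
Proof.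
case: Q0 => e h1 h2 h3; rewrite !(eq_coord v0) e.
by do 2!split; apply/negP => /eqP; lra.
Qed.

Lemma quad_cross : cross v0 v2 v1 v3.
Proof.
case: Q0 => e h1 h2 h3; by rewrite (@cross_coord v0) ?e; lra.
Qed.

(** Crossing the diagonal puts p and q strictly on its two sides; crossing no side of the
    quadrilateral then forces them onto vertices. *)
Lemma quad_unique p q : p != q -> cross v0 v2 p q ->
  ~~ cross v0 v1 p q -> ~~ cross v1 v2 p q -> ~~ cross v2 v3 p q -> ~~ cross v0 v3 p q ->
  (p = v1 /\ q = v3) \/ (p = v3 /\ q = v1).
Proof.
move=> pq; wlog xy : p q pq / arc v0 p < arc v0 q.
  move=> W; case: (coord_lt v0 pq) => h; first exact: W.
  have E a b : cross a b p q = cross a b q p by rewrite crossC'.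
  rewrite !E => h1 h2 h3 h4 h5.
  by rewrite eq_sym in pq; case: (W q p pq h h1 h2 h3 h4 h5) => -[-> ->]; [right|left].
case: Q0 => e h1 h2 h3; have h := arc_lt v0 v3; have p0 := arc_ge0 v0 p.
have l01 : arc v0 v0 < arc v0 v1 by rewrite e.
have l02 : arc v0 v0 < arc v0 v2 by rewrite e; lra.
have l03 : arc v0 v0 < arc v0 v3 by rewrite e; lra.
rewrite (cross_coord l02 xy) (cross_coord l01 xy) (cross_coord h2 xy).
rewrite (cross_coord h3 xy) (cross_coord l03 xy) e ![_ < 0]ltNge p0 /= !orbF.
move=> /andP [/andP [c1 c2] c3].
rewrite c1 /= !negb_or !negb_and -!leNgt => n1 /andP [n2 n2'] /andP [n3 n3'] n4; left.
by split; apply: (@arc_inj _ v0); lra.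
Qed.
End Quad.
End Geometry.

(** * Exchange in a cluster *)

Section CircleTopology.
Variable R : realType.
Local Open Scope classical_set_scope.
Implicit Types p q r : S1 R.

Lemma open_arc p (a : R) : a <= twopi R -> open [set r | 0 < arc p r < a].
Proof.
move=> a2; rewrite /open /= /quotient_open.
rewrite (_ : _ @^-1` _ = \bigcup_(n in [set: int])
    [set` (`](lift1 p + twopi R * n%:~R), (lift1 p + twopi R * n%:~R + a)[)%R ]); last first.
  apply/seteqP; split=> x /=.
    move=> /andP [h1 h2]; set b := arc p _ in h1 h2.
    have /clsP : cls x = cls (lift1 p + b) by rewrite (arcP _ (lift1K p)).
    rewrite /circle_rel => /intrP [n /(canRL (divfK (twopi_neq0 R))) e].
    exists n => //.
    have : x \in (`](lift1 p + twopi R * n%:~R), (lift1 p + twopi R * n%:~R + a)[)%R.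
      by rewrite in_itv /=; apply/andP; split; lra.
    exact.
  move=> [n _ xI].
  have : x \in (`](lift1 p + twopi R * n%:~R), (lift1 p + twopi R * n%:~R + a)[)%R by [].
  rewrite in_itv /= => /andP [h1 h2].
  set b := x - twopi R * n%:~R - lift1 p.
  have b0 : 0 < b by rewrite /b; lra.
  have ba : b < a by rewrite /b; lra.
  change (0 < arc p (cls x) < a); have -> : cls x = cls (lift1 p + b).
    by rewrite -[RHS](clsD2pi _ n); congr cls; rewrite /b; lra.
  have := arc_min (lift1 p) (ltW b0); rewrite lift1K.
  rewrite (_ : Num.floor _ = 0); first by rewrite mulr0 addr0 => <-; rewrite b0.
  apply/eqP; rewrite floor_eq ler_pdivlMr ?twopi_gt0 // ltr_pdivrMr ?twopi_gt0 //.
  by rewrite mul0r add0r mul1r; apply/andP; split; lra.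
by apply: bigcup_open => n _; apply: interval_open.
Qed.

Lemma open_neq p : open [set r | r != p].
Proof.
rewrite (_ : mkset _ = [set r | 0 < arc p r < twopi R]); first exact: open_arc.
apply/seteqP; split=> r /=; rewrite arc_lt andbT lt_def arc_ge0 arc_eq0 andbT eq_sym //.
Qed.

Lemma open_rect (U V : set (S1 R)) : open U -> open V ->
  open [set x : S1 R * S1 R | U x.1 /\ V x.2].
Proof.
move=> oU oV; apply: (@openI _ (fst @^-1` U) (snd @^-1` V)); apply: open_comp => // x _.
  exact: cvg_fst.
exact: cvg_snd.
Qed.

(** One endpoint lies in the open arc from p to q and the other in the one from q to p. This open
    set will isolate the new element of the exchanged cluster. *)
Lemma open_cross p q : p != q ->
  open [set x : S1 R * S1 R | cross p q x.1 x.2].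
Proof.
move=> pq; have o1 := @open_arc p _ (ltW (arc_lt p q)); have o2 := @open_arc q _ (ltW (arc_lt q p)).
have qp : q != p by rewrite eq_sym.
rewrite (_ : mkset _ =
  [set x : S1 R * S1 R | [set r | 0 < arc p r < arc p q] x.1 /\ [set r | 0 < arc q r < arc q p] x.2]
  `|` [set x : S1 R * S1 R | [set r | 0 < arc q r < arc q p] x.1 /\ [set r | 0 < arc p r < arc p q] x.2]).
  by apply: openU; apply: open_rect.
have E s : (p != s) && wrap p q s = (0 < arc p s < arc p q).
  by rewrite wrapE [0 < _]lt_def arc_ge0 arc_eq0 andbT.
have E' s : (q != s) && ~~ wrap p q s = (0 < arc q s < arc q p).
  by rewrite -wrap_qpr // wrapE [0 < _]lt_def arc_ge0 arc_eq0 andbT.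
apply/seteqP; split=> -[r s] /=; rewrite -(E r) -(E s) -(E' r) -(E' s) /cross.

  by case/and5P => -> -> -> -> /=; case: (wrap p q r) => /= ->; [left|right].
have wp := @wrap_pqp _ p q; rewrite pq in wp; have wq := @wrap_r _ p q.
case=> -[/andP [h1 h2] /andP [h3 h4]]; rewrite h1 h3.
  have -> : p != s by apply: contraNneq h4 => <-; rewrite wp.
  have -> : q != r by apply: contraTneq h2 => <-; rewrite wq.
  by rewrite h2 (negbTE h4).
have -> : p != r by apply: contraNneq h2 => <-; rewrite wp.
have -> : q != s by apply: contraTneq h4 => <-; rewrite wq.
by rewrite h4 (negbTE h2).
Qed.
End CircleTopology.

Section Cluster.
Variables (k : fieldType) (R : realType).
Local Notation obj := (fobj k R).
Local Open Scope classical_set_scope.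
Implicit Types (X Y Z T : obj) (p q r s : S1 R) (S : set (set obj)).

Lemma iso_classP X Y : iso_class X = iso_class Y <-> isomorphic X Y.
Proof.
split=> [e|h].
  by have : iso_class Y Y := iso_refl Y; rewrite -e.
apply/seteqP; split=> Z /= h'; first exact: iso_trans (iso_sym h) h'.
exact: iso_trans h h'.
Qed.

Lemma moebiusP (c : set obj) : moebius c <-> exists X p q, isE X p q /\ c = iso_class X.
Proof.
split=> [[X [iX ->]]|[X [p [q [iX ->]]]]].
  by have [p [q iE]] := indecomposable_isE iX; exists X, p, q.
by exists X; split=> //; exact: isE_indecomposable iX.
Qed.

Lemma moebius_isE X : moebius (iso_class X) -> exists p q, isE X p q.
Proof.
move=> /moebiusP [Y [p [q [iY /iso_classP /iso_sym e]]]]; exists p, q; exact: isE_iso e.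
Qed.

Lemma cluster_isE S X : is_cluster S -> S (iso_class X) -> exists p q, isE X p q.
Proof. by move=> [h _ _ _] /h /moebius_isE. Qed.

Lemma compatible_sym X Y : compatible X Y -> compatible Y X.
Proof. by case=> h; [apply: Or32|apply: Or31|apply/Or33/iso_sym]. Qed.

Lemma exchangeP S T T' X : exchange S T T' (iso_class X) <->
  (S (iso_class X) /\ ~ isomorphic X T) \/ isomorphic X T'.
Proof.
rewrite /exchange; split.
  case=> [[h1 h2]|/iso_classP]; last by right.
  by left; split=> // /iso_classP.
case=> [[h1 h2]|/iso_classP]; last by right.
by left; split=> // /iso_classP.
Qed.

Lemma compatible_iso X X' Y : isomorphic X X' -> compatible X Y -> compatible X' Y.
Proof.
move=> e; have [x xi] := e; have [y yi] := iso_sym e.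
case=> h.
- by apply: Or31 => f; rewrite -(comp_iso_r _ xi); apply: h.
- by apply: Or32 => f; rewrite -(comp_iso_l _ yi); apply: h.
- by apply: Or33; apply: iso_trans (iso_sym e) h.
Qed.

Lemma cluster_max S X p q : is_cluster S -> isE X p q ->
  (forall Y, S (iso_class Y) -> compatible X Y) -> S (iso_class X).
Proof.
move=> [SM Sc Smax _] iX c.
suff -> : S = S `|` [set iso_class X] by right.
apply/esym/Smax; last by left.
  by move=> d [/SM//|->]; apply/moebiusP; exists X, p, q.
move=> Y Z [hY|/iso_classP hY] [hZ|/iso_classP hZ].
- exact: Sc.
- by apply: compatible_sym; apply: compatible_iso (iso_sym hZ) _; apply: c.
- by apply: compatible_iso (iso_sym hY) _; apply: c.
- by apply: Or33; apply: iso_trans hY (iso_sym hZ).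
Qed.

Section Exchange.
Variables (S : set (set obj)) (T A B C D : obj) (v0 v1 v2 v3 : S1 R).
Hypotheses (Scl : is_cluster S) (Q : quad v0 v1 v2 v3).
Hypotheses (iT : isE T v0 v2) (iA : isE A v0 v3) (iB : isE B v2 v3)
  (iC : isE C v1 v2) (iD : isE D v0 v1).
Hypotheses (ST : S (iso_class T)) (SA : S (iso_class A)) (SB : S (iso_class B))
  (SC : S (iso_class C)) (SD : S (iso_class D)).

Let SM : S `<=` @moebius k R. Proof. by case: Scl. Qed.
Let Sc : pairwise_compatible S. Proof. by case: Scl. Qed.

Lemma sides_neq : [/\ ~ isomorphic A T, ~ isomorphic B T, ~ isomorphic C T & ~ isomorphic D T].
Proof.
have [[/eqP n01 /eqP n02 /eqP n03] [/eqP n12 /eqP n13 /eqP n23]] := quad_neq Q.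
split=> e; [have := isE_inj iA iT e|have := isE_inj iB iT e|have := isE_inj iC iT e|
  have := isE_inj iD iT e]; case=> -[]; congruence.
Qed.

Lemma diag_unique X p q : isE X p q -> cross v0 v2 p q ->
  (forall Y, S (iso_class Y) -> ~ isomorphic Y T -> compatible X Y) -> isE X v1 v3.
Proof.
move=> iX cr c; have [nA nB nC nD] := sides_neq.
have nc Y r s : isE Y r s -> S (iso_class Y) -> ~ isomorphic Y T -> ~~ cross r s p q.
  by move=> iY SY nY; apply: (compat_ncross iY iX); apply: compatible_sym; apply: c.
have := quad_unique Q iX.1 cr (nc _ _ _ iD SD nD) (nc _ _ _ iC SC nC) (nc _ _ _ iB SB nB)
  (nc _ _ _ iA SA nA).
by case=> -[e1 e2]; move: iX; rewrite e1 e2 // => /isE_sym.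
Qed.

Lemma exchange_diag T' : ~ isomorphic T' T -> is_cluster (exchange S T T') -> isE T' v1 v3.
Proof.
move=> nT' cl; have S'T' : exchange S T T' (iso_class T').
  by apply/exchangeP; right; apply: iso_refl.
have [p [q iT']] := cluster_isE cl S'T'.
have [_ c _ _] := cl.
have cT' Y : S (iso_class Y) -> ~ isomorphic Y T -> compatible T' Y.
  by move=> SY nY; apply: c => //; apply/exchangeP; left.
case cr: (cross v0 v2 p q); first exact: diag_unique cr cT'.
(* If T' did not cross T, maximality of S would put T' into S; the exchanged set, which lacks T,
   would lie properly inside S, against its own maximality. *)
have ST' : S (iso_class T').
  apply: (cluster_max Scl iT') => Y SY.
  have [e|] := pselect (isomorphic Y T); last exact: cT'.
  apply: compatible_sym; apply: compatible_iso (iso_sym e) _.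
  by apply: (ncross_compat iT iT'); rewrite cr.
have [_ _ m _] := cl.
have : S = exchange S T T'.
  by apply: m => // d [[]//|->].
move=> e; have := ST; rewrite e => /exchangeP [[_]|/iso_sym]; last by [].
by move=> []; apply: iso_refl.
Qed.

(** For the quadrilateral starting at v1, the geodesic v1 v3 is the first diagonal, so what crosses
    it but none of the sides is v0 v2, that is T. *)
Lemma diag_cross T' X p q : isE T' v1 v3 -> S (iso_class X) -> ~ isomorphic X T ->
  isE X p q -> ~~ cross v1 v3 p q.
Proof.
move=> iT' SX nX iX; apply/negP => cr; have [nA nB nC nD] := sides_neq.
have nc Y r s : isE Y r s -> S (iso_class Y) -> ~~ cross r s p q.
  by move=> iY SY; apply: (compat_ncross iY iX); apply: Sc.
have v30 : v3 != v0 by have [[_ _]] := quad_neq Q; rewrite eq_sym.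
have v10 : v1 != v0 by have [[]] := quad_neq Q; rewrite eq_sym.
have nc' Y r s : isE Y r s -> S (iso_class Y) -> ~~ cross s r p q.
  by move=> iY SY; apply: nc SY; apply: isE_sym.
have := quad_unique (quad_rot Q) iX.1 cr (nc _ _ _ iC SC) (nc _ _ _ iB SB)
  (nc' _ _ _ iA SA) (nc' _ _ _ iD SD).
case=> -[e1 e2]; apply: nX; move: iX; rewrite e1 e2 => iX; last exact: isE_isoE iX iT.
exact: isE_isoE (isE_sym iX) iT.
Qed.

Lemma diag_notin T' : isE T' v1 v3 -> ~ S (iso_class T').
Proof.
move=> iT' ST'; have := compat_ncross iT iT' (Sc ST ST').
by rewrite (quad_cross Q).
Qed.

Lemma exchange_cluster T' : isE T' v1 v3 -> is_cluster (exchange S T T').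
Proof.
move=> iT'; have nS := diag_notin iT'.
have MS : exchange S T T' `<=` @moebius k R.
  by move=> d [[/SM h _]|->] //; apply/moebiusP; exists T', v1, v3.
have c1 X : S (iso_class X) -> ~ isomorphic X T -> compatible T' X.
  move=> SX nX; have [p [q iX]] := cluster_isE Scl SX.
  by apply: (ncross_compat iT' iX); exact: (diag_cross iT' SX nX iX).
split=> //.
- move=> X Y /exchangeP [[SX nX]|eX] /exchangeP [[SY nY]|eY].
  + exact: Sc.
  + by apply: compatible_sym; apply: compatible_iso (iso_sym eY) _; apply: c1.
  + by apply: compatible_iso (iso_sym eX) _; apply: c1.
  + by apply: Or33; apply: iso_trans eX (iso_sym eY).
- move=> S'' M'' c'' sub; apply/seteqP; split=> // d d''.
  have /moebiusP [X [p [q [iX dX]]]] := M'' _ d''; move: d''; rewrite {}dX => SX.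
  have cX Y : S (iso_class Y) -> ~ isomorphic Y T -> compatible X Y.
    by move=> SY nY; apply: c'' => //; apply: sub; apply/exchangeP; left.
  (* An element that crosses T is the other diagonal. One that does not lies in S by maximality, and
     it is not T because T crosses T'. *)
  case cr: (cross v0 v2 p q).
    by apply/exchangeP; right; apply: isE_isoE iT'; exact: diag_unique cr cX.
  apply/exchangeP; left; split.
    apply: (cluster_max Scl iX) => Y SY.
    have [e|] := pselect (isomorphic Y T); last exact: cX.
    apply: compatible_sym; apply: compatible_iso (iso_sym e) _.
    by apply: (ncross_compat iT iX); rewrite cr.
  move=> e; have ST' : S'' (iso_class T') by apply: sub; apply/exchangeP; right; apply: iso_refl.
  have := compat_ncross iT iT' (compatible_iso e (c'' _ _ SX ST')).
  by rewrite (quad_cross Q).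
move=> d; have [_ _ _ Sd] := Scl.
have pairP X r s p q : p <> q -> isE X r s ->
    (iso_class (E_pair k p q) = iso_class X <-> (p = r /\ q = s) \/ (p = s /\ q = r)).
  move=> /eqP pq iX; rewrite iso_classP E_pairE //; split=> [e|].
    exact: isE_inj (isE_Eo k pq) iX e.
  case=> -[-> ->]; first exact: isE_isoE (isE_Eo k iX.1) iX.
  exact: isE_isoE (isE_Eo k (isE_sym iX).1) (isE_sym iX).
have v02 : v0 != v2 by have [[]] := quad_neq Q.
case=> [[dS dT]|->].
  have [U [[UM [W oO OU]] Ud US]] := Sd _ dS.
  have dT' : d <> iso_class T' by move=> e; apply: nS; rewrite -e.
  (* The class of T' corresponds to the two ordered pairs (v1, v3) and (v3, v1); both are removed
     from the open set W. *)
  exists (U `\` [set iso_class T']); split=> //.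
    split; first by move=> x [/UM].
    exists (W `&` ([set x | [set r | r != v1] x.1 /\ [set: S1 R] x.2] `|`
                   [set x | [set: S1 R] x.1 /\ [set r | r != v3] x.2])
              `&` ([set x | [set r | r != v3] x.1 /\ [set: S1 R] x.2] `|`
                   [set x | [set: S1 R] x.1 /\ [set r | r != v1] x.2])).
      by do 2?apply: openI => //; apply: openU; apply: open_rect;
        do ?[exact: open_neq | exact: openT].
    move=> p q pq; have h := pairP _ _ _ p q pq iT'.
    split=> /=.
      move=> [[/(OU _ _ pq) hU h1] h2]; split=> // /h hh; move: hh h1 h2.
      case=> -[-> ->]; rewrite !eqxx; first by case=> -[].
      by move=> _; case=> -[].
    move=> [/(OU _ _ pq) hO nh]; split; first split=> //.
      by case: (eqVneq p v1) => [e1|_]; [right; split=> //; apply/eqP => e2; apply/nh/h; left|left].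
    by case: (eqVneq p v3) => [e1|_]; [right; split=> //; apply/eqP => e2; apply/nh/h; right|left].
  apply/seteqP; split=> [x [[Ux xT'] [[Sx _]|//]]|x ->].
    by rewrite -US.
  by split; [split|left; split].
(* T' is isolated by the geodesics that cross T, since no element of S crosses T. *)
exists [set c | exists X p q, [/\ c = iso_class X, isE X p q & cross v0 v2 p q]].
split.
- split; first by move=> c [X [p [q [-> iX _]]]]; apply/moebiusP; exists X, p, q.
  exists [set x : S1 R * S1 R | cross v0 v2 x.1 x.2]; first exact: open_cross.
  move=> p q pq; split=> /=.
    have /eqP pq' := pq; move=> cr; exists (Eo k p q), p, q.
    by rewrite E_pairE //; split=> //; exact: isE_Eo.
  move=> [X [r [s [/(pairP _ _ _ p q pq) h iX cr]]]].
  by case: (h _ _ iX) => -[-> ->] //; rewrite crossC'.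
- by exists T', v1, v3; split=> //; exact: quad_cross Q.
apply/seteqP; split=> [c [[X [p [q [-> iX cr]]]] /exchangeP [[SX _]|/iso_classP ->]]|c ->] //.
  by have := compat_ncross iT iX (Sc ST SX); rewrite cr.
split; last by right.
by exists T', v1, v3; split=> //; exact: quad_cross Q.
Qed.

End Exchange.
End Cluster.

(** * Rotations of geodesics *)

Section Rotation.
Variables (k : fieldType) (R : realType).
Local Notation obj := (fobj k R).
Implicit Types (X Y Z T : obj) (p q r s v : S1 R).

Lemma sep_rot p q r : p != q -> arc p q <= arc p r -> sep p q p r.
Proof. by move=> pq h; rewrite /sep wrap_pqp pq wrapE -leNgt. Qed.

Lemma rot_comp X Y Z p q r s (f : fhom X Y) (g : fhom Y Z) :
  isE X p q -> isE Y p r -> isE Z p s -> arc p q <= arc p r -> arc p r <= arc p s ->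
  ~ f ==s 0 -> ~ g ==s 0 -> ~ fcomp g f ==s 0.
Proof.
move=> iX iY iZ h1 h2; apply: (isE_comp_neq0 iX iY iZ) => //.
- exact: sep_rot iX.1 h1.
- exact: sep_rot iX.1 (le_trans h1 h2).
- exact: sep_rot iY.1 h2.
Qed.

(** The composite of f with a nonzero rotation from Y to Z is nonzero, so it spans the line of
    stable maps from X to Z. *)
Lemma rot_factor_l X Y Z p q r s (f : fhom X Y) (g : fhom X Z) :
  isE X p q -> isE Y p r -> isE Z p s -> arc p q <= arc p r -> arc p r <= arc p s ->
  ~ f ==s 0 -> exists h, g ==s fcomp h f.
Proof.
move=> iX iY iZ h1 h2 f0; have [e e0] := isE_hom_ex iY iZ (sep_rot iY.1 h2).
have [c ec] := isE_dim1 g iX iZ (rot_comp iX iY iZ h1 h2 f0 e0).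
by exists (fpsC c *: e); rewrite fcompZl.
Qed.

Lemma rot_factor_r X Y Z p q r s (f : fhom Y Z) (g : fhom X Z) :
  isE X p q -> isE Y p r -> isE Z p s -> arc p q <= arc p r -> arc p r <= arc p s ->
  ~ f ==s 0 -> exists h, g ==s fcomp f h.
Proof.
move=> iX iY iZ h1 h2 f0; have [e e0] := isE_hom_ex iX iY (sep_rot iX.1 h1).
have [c ec] := isE_dim1 g iX iZ (rot_comp iX iY iZ h1 h2 e0 f0).
by exists (fpsC c *: e); rewrite fcompZr.
Qed.

Lemma sum_stab0 X Y n (F : 'I_n -> fhom X Y) :
  (forall i, F i ==s 0) -> \sum_i F i ==s 0.
Proof.
move=> h; elim/big_ind: _ => // f g e e'; rewrite e e' addr0 //.
Qed.

(** A rotation about [p] within [S] is irreducible if [S] contains nothing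
    between its source and its target: by [isE_comp_le], a factorisation of it can
    only go through a rotation about [p]. *)
Lemma rot_irreducible S X Z p q s (f : fhom X Z) :
  (forall Y, S (iso_class Y) -> exists r t, isE Y r t) ->
  S (iso_class X) -> S (iso_class Z) -> isE X p q -> isE Z p s -> arc p q < arc p s ->
  (forall Y t, S (iso_class Y) -> isE Y p t -> arc p q < arc p t -> arc p t < arc p s ->
     False) ->
  ~ f ==s 0 -> irreducible S f.
Proof.
move=> SE SX SZ iX iZ qs btw f0; split=> // [fi|[n [l [Y [a [b [h e]]]]]]].
  have [[_ e]|[e _]] := isE_inj iX iZ (ex_intro _ f fi).
    by move: qs; rewrite e ltxx.
  by have := iZ.1; rewrite e eqxx.
have [i ci] : exists i, ~ fcomp (b i) (a i) ==s 0.
  apply: contrapT => /forallNP nc; apply: f0; rewrite e; apply: sum_stab0 => i.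
  by have /contrapT -> := nc i; rewrite scaler0.
have [SY nai nbi] := h i; have a0 : ~ a i ==s 0 by move=> z; apply: ci; rewrite z fcomp0r.
have b0 : ~ b i ==s 0 by move=> z; apply: ci; rewrite z fcomp0l.
have [r [t [iY rt]]] : exists r t, isE (Y i) r t /\ sep p q r t.
  have [r [t iY]] := SE _ SY; have /orP [hs|hs] := isE_hom iX iY a0; first by exists r, t.
  by exists t, r; split=> //; apply: isE_sym.
have [l1 l2] := isE_comp_le iX iY iZ rt (sep_rot iX.1 (ltW qs)) ci.
have rp : r = p.
  by apply/eqP; rewrite eq_sym -arc_eq0 eq_le arc_ge0 andbT; rewrite arc_refl in l1.
rewrite {r l1}rp in iY rt.
have [wt ws] : wrap p q t = false /\ wrap p q s = false.
  split; first by case/andP: rt => _ /negbTE.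
  by rewrite wrapE; apply/negbTE; rewrite -leNgt ltW.
have := wrapP p q t; have := wrapP p q s; rewrite wt ws !mulr0 !addr0 => e1 e2.
have [tq|tq] := eqVneq t q.
  rewrite tq in iY; apply: nai; apply: isE_isoP a0 => //; first exact: iX.
  exact: isE_isoE iX iY.
have [ts|ts] := eqVneq t s.
  rewrite ts in iY; apply: nbi; apply: isE_isoP b0; first exact: iY.
  exact: isE_isoE iY iZ.
apply: (btw _ t SY iY); rewrite lt_def -?e1 -?e2.
  rewrite lerDl arc_ge0 andbT e2 (inj_eq (@arc_inj _ p)) tq //.
by rewrite lerD2l l2 andbT e1 e2 (inj_eq (@arc_inj _ p)) eq_sym.
Qed.

End Rotation.

(** * Maps leaving or reaching a diagonal factor through the sides *)

Section QuadFactor.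
Variables (k : fieldType) (R : realType).
Local Notation obj := (fobj k R).
Implicit Types (X Y Z T : obj).
Variables v0 v1 v2 v3 : S1 R.
Hypothesis Q : quad v0 v1 v2 v3.

(** Not crossing v0 v2 leaves r = v0 or s = v2; not crossing the sides v2 v3 and v0 v1 pushes the
    other endpoint to v3 or beyond, respectively to v1 or beyond. *)
Lemma quad_left r s : sep v0 v2 r s ->
  ~~ cross v0 v2 r s -> ~~ cross v2 v3 r s -> ~~ cross v0 v1 r s ->
  [\/ r = v0 /\ s = v2, r = v0 /\ arc v0 v3 <= arc v0 s |
      s = v2 /\ arc v2 v1 <= arc v2 r].
Proof.
have /and3P [n01 h1 h2] := Q; move=> /andP [w1 w2].
have e := arc_refl v0; have l01 : arc v0 v0 < arc v0 v1.
  by rewrite e lt_def arc_eq0 n01 arc_ge0.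
have l02 := lt_trans l01 h1; have h := arc_lt v0 v3.
rewrite !wrapE -?leNgt in w1 w2; have rs := lt_le_trans w1 w2.
have r0 := arc_ge0 v0 r; have s2 := arc_lt v0 s.
rewrite (cross_coord l02 rs) (cross_coord h2 rs) (cross_coord l01 rs) e.
rewrite (arc_coord v0 v2 v1) (arc_coord v0 v2 r) h1 w1 => c1 c2 c3.
have [rv|rv] := eqVneq r v0.
  have [sv|sv] := eqVneq s v2; first by apply: Or31.
  have {}sv : arc v0 s != arc v0 v2 by rewrite (inj_eq (@arc_inj _ v0)).
  apply: Or32; split=> //; move: c2; rewrite rv e; have : arc v0 v2 < arc v0 s by rewrite lt_def sv.
  by lra.
have {}rv : 0 < arc v0 r by rewrite lt_def arc_eq0 eq_sym rv.
apply: Or33; split; first by apply: (@arc_inj _ v0); lra.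
lra.
Qed.

Lemma quad_right r s : r != s -> sep r s v0 v2 ->
  ~~ cross v0 v2 r s -> ~~ cross v0 v3 r s -> ~~ cross v1 v2 r s ->
  [\/ r = v0 /\ s = v2, r = v0 /\ arc v0 s <= arc v0 v1 |
      s = v2 /\ arc v2 r <= arc v2 v3].
Proof.
have /and3P [n01 h1 h2] := Q; move=> rs /andP [w1 w2].
have e := arc_refl v0; have l01 : arc v0 v0 < arc v0 v1.
  by rewrite e lt_def arc_eq0 n01 arc_ge0.
have l02 := lt_trans l01 h1; have l03 := lt_trans l02 h2; have h := arc_lt v0 v3.
have r0 := arc_ge0 v0 r; have s0 := arc_ge0 v0 s; have s2 := arc_lt v0 s.
have r2 := arc_lt v0 r.
rewrite !(wrap_coord v0) e in w1 w2.
have a23 : arc v2 v3 = arc v0 v3 - arc v0 v2.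
  by rewrite (arc_coord v0) ltNge (ltW h2) addr0.
move=> c1 c2 c3; have [rv|rv] := eqVneq r v0.
  have [sv|sv] := eqVneq s v2; first by apply: Or31.
  apply: Or32; split=> //; have lrs : arc v0 r < arc v0 s.
    by rewrite rv e lt_def arc_eq0 arc_ge0 -rv rs.
  have {}sv : arc v0 s != arc v0 v2 by rewrite (inj_eq (@arc_inj _ v0)).
  move: c1 c3 w2 sv; rewrite (cross_coord l02 lrs) (cross_coord h1 lrs) rv e neq_lt.
  lra.
have {}rv : 0 < arc v0 r by rewrite lt_def arc_eq0 eq_sym rv.
have lsr : arc v0 s < arc v0 r by lra.
rewrite -(crossC' v0 v2) (cross_coord l02 lsr) e in c1.
rewrite -(crossC' v0 v3) (cross_coord l03 lsr) e in c2.
have e2 : arc v0 s = arc v0 v2 by lra.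
apply: Or33; split; first exact: (@arc_inj _ v0).
rewrite a23 (arc_coord v0 v2 r); case: ltP; lra.
Qed.

Lemma left_quad T A C Z r s (f : fhom T A) (h : fhom T C) (g : fhom T Z) :
  isE T v0 v2 -> isE A v0 v3 -> isE C v1 v2 -> isE Z r s -> ~ isomorphic Z T ->
  ~~ cross v0 v2 r s -> ~~ cross v2 v3 r s -> ~~ cross v0 v1 r s ->
  ~ f ==s 0 -> ~ h ==s 0 -> exists x y, g ==s fcomp x f + fcomp y h.
Proof.
move=> iT iA iC iZ nZ c1 c2 c3 f0 h0.
have [g0|g0] := pselect (g ==s 0).
  by exists 0, 0; rewrite !fcomp0l addr0.
wlog w : r s iZ c1 c2 c3 / sep v0 v2 r s.
  move=> W; have /orP [w|w] := isE_hom iT iZ g0; first exact: (W r s).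
  by apply: (W s r) => //; rewrite 1?crossC' //; apply: isE_sym.
have /and3P [n01 h1 h2] := Q.
case: (quad_left w c1 c2 c3) => -[e1 e2].
- by case: nZ; rewrite e1 e2 in iZ; exact: isE_isoE iZ iT.
- rewrite e1 in iZ; have [x E] := rot_factor_l g iT iA iZ (ltW h2) e2 f0.
  by exists x, 0; rewrite E fcomp0l addr0.
rewrite e1 in iZ.
have h3 : arc v2 v0 <= arc v2 v1.
  have p2 : 0 < arc v0 v2 := le_lt_trans (arc_ge0 _ _) h1.
  rewrite (arc_coord v0 v2 v0) (arc_coord v0 v2 v1) arc_refl p2 h1.
  by have := arc_ge0 v0 v1; lra.
have [y E] := rot_factor_l g (isE_sym iT) (isE_sym iC) (isE_sym iZ) h3 e2 h0.
by exists 0, y; rewrite E fcomp0l add0r.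
Qed.

Lemma right_quad T B D Z r s (f : fhom B T) (h : fhom D T) (g : fhom Z T) :
  isE T v0 v2 -> isE B v2 v3 -> isE D v0 v1 -> isE Z r s -> ~ isomorphic Z T ->
  ~~ cross v0 v2 r s -> ~~ cross v0 v3 r s -> ~~ cross v1 v2 r s ->
  ~ f ==s 0 -> ~ h ==s 0 -> exists x y, g ==s fcomp f x + fcomp h y.
Proof.
move=> iT iB iD iZ nZ c1 c2 c3 f0 h0.
have [g0|g0] := pselect (g ==s 0).
  by exists 0, 0; rewrite !fcomp0r addr0.
wlog w : r s iZ c1 c2 c3 / sep r s v0 v2.
  move=> W; have /orP [w|w] := isE_hom iZ iT g0; first exact: (W r s).
  rewrite -(sepC _ _ iZ.1) in w; have iZ' := isE_sym iZ.
  by apply: (W s r); rewrite 1?crossC'.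
have /and3P [n01 h1 h2] := Q.
case: (quad_right iZ.1 w c1 c2 c3) => -[e1 e2].
- by case: nZ; rewrite e1 e2 in iZ; exact: isE_isoE iZ iT.
- rewrite e1 in iZ; have [y E] := rot_factor_r g iZ iD iT e2 (ltW h1) h0.
  by exists 0, y; rewrite E fcomp0r add0r.
rewrite e1 in iZ.
have h3 : arc v2 v3 <= arc v2 v0.
  have p2 : 0 < arc v0 v2 := le_lt_trans (arc_ge0 _ _) h1.
  rewrite (arc_coord v0 v2 v0) (arc_coord v0 v2 v3) arc_refl p2 (lt_gtF h2).
  by have := arc_lt v0 v3; lra.
have [x E] := rot_factor_r g (isE_sym iZ) iB (isE_sym iT) e2 h3 f0.
by exists x, 0; rewrite E fcomp0r addr0.
Qed.
End QuadFactor.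

(** * Ideal triangles and the quadrilateral around T *)

Section Triangle.
Variables (k : fieldType) (R : realType).
Local Notation obj := (fobj k R).
Implicit Types (X Y Z T : obj) (p q r s v w x y : S1 R).

Lemma arc_gt0 p q : p != q -> 0 < arc p q.
Proof. by move=> pq; rewrite lt_def arc_eq0 pq arc_ge0. Qed.

(** With T = x y and A = x w, this locates B = p q from the nonzero maps B -> T and A -> B. *)
Lemma triangle_coord x y w p q : x != y -> arc x y < arc x w -> arc x p < arc x q ->
  wrap p q x (+) wrap p q y -> wrap x w p (+) wrap x w q ->
  ~~ cross x y p q -> ~~ cross x w p q -> ~ (p = x /\ q = y) -> ~ (p = x /\ q = w) ->
  p = y /\ q = w.
Proof.
move=> xy yw pq; have e := arc_refl x; have l := arc_gt0 xy.
have lxy : arc x x < arc x y by rewrite e.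
have lxw : arc x x < arc x w by rewrite e; apply: lt_trans yw.
rewrite (hom2_coord pq lxy) (hom2_coord lxw pq) (cross_coord lxy pq) (cross_coord lxw pq) e.
have p0 := arc_ge0 x p => h1 h2 c1 c2 n1 n2.
have inj v v' : arc x v = arc x v' -> v = v' by exact: (@arc_inj _ x).
have n1' : (arc x p != 0) || (arc x q != arc x y).
  rewrite -negb_and; apply/negP => /andP [/eqP e1 /eqP /inj e2]; apply: n1; split=> //.
  by apply: inj; rewrite e.
have n2' : (arc x p != 0) || (arc x q != arc x w).
  rewrite -negb_and; apply/negP => /andP [/eqP e1 /eqP /inj e2]; apply: n2; split=> //.
  by apply: inj; rewrite e.
have pN0 : 0 < arc x p.
  rewrite lt_def p0 andbT; apply/negP => /eqP p00; rewrite p00 eqxx /= in n1' n2'.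
  by rewrite p00 in h1 h2; move: n1' n2'; rewrite !neq_lt; lra.
by split; apply: inj; lra.
Qed.

(** The geodesics of [B], [T] and [A] are the sides of an ideal triangle. *)
Lemma triangle_vertices T A B x y (a : fhom T A) (b : fhom B T) (c : fhom A B) :
  isE T x y -> (exists p q, isE A p q) -> (exists p q, isE B p q) ->
  compatible T A -> compatible T B -> compatible A B ->
  ~ isomorphic T A -> ~ isomorphic T B -> ~ isomorphic A B ->
  ~ a ==s 0 -> ~ b ==s 0 -> ~ c ==s 0 ->
  exists v0 v2 w, [/\ (v0 = x /\ v2 = y) \/ (v0 = y /\ v2 = x), isE A v0 w, isE B v2 w &
    arc v0 v2 < arc v0 w].
Proof.
move=> iT [r [s iA]] [p [q iB]] cTA cTB cAB nTA nTB nAB a0 b0 c0.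
wlog h : r s iA / sep x y r s.
  move=> W; have /orP [h|h] := isE_hom iT iA a0; first exact: (W r s).
  exact: (W s r (isE_sym iA)).
have c1 := compat_ncross iT iA cTA.
(* T and A do not cross, so the nonzero map between them makes r = x or s = y; exchanging endpoints
   reduces the second case to the first. *)
wlog rx : x y r s iT iA h c1 / r = x.
  move=> W; have [rx|/eqP rx] := pselect (r = x); first exact: (W x y r s).
  have sy : s = y.
    have /andP [w1 w2] := h; rewrite !wrapE -?leNgt in w1 w2.
    have l : arc x x < arc x y by rewrite arc_refl arc_gt0 // iT.1.
    have rs := lt_le_trans w1 w2; have r0 : 0 < arc x r by rewrite arc_gt0 // eq_sym.
    move: c1; rewrite (cross_coord l rs) arc_refl => c1.
    by apply: (@arc_inj _ x); lra.
  have [||v0 [v2 [w [e ? ? ?]]]] := W y x s r (isE_sym iT) (isE_sym iA) _ _ sy.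
  - by rewrite sepC // iT.1.
  - by rewrite crossC ?iT.1 // crossC'.
  by exists v0, v2, w; split=> //; case: e; [right|left].
rewrite {r}rx in iA h c1.
have ys : arc x y < arc x s.
  have /andP [_] := h; rewrite wrapE -leNgt le_eqVlt => /orP [/eqP/arc_inj e|//].
  by case: nTA; rewrite -e in iA; exact: isE_isoE iT iA.
have h1 := isE_hom iB iT b0; rewrite sep_addb in h1.
have h2 := isE_hom iA iB c0; rewrite sep_addb in h2.
have c2 := compat_ncross iT iB cTB; have c3 := compat_ncross iA iB cAB.
exists x, y, s; split=> //; first by left.
wlog pq : p q iB h1 h2 c2 c3 / arc x p < arc x q.
  move=> W; case: (coord_lt x iB.1) => pq; first exact: (W p q).
  apply: (W q p (isE_sym iB)) => //; rewrite 1?crossC' //.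
    by rewrite !(wrap_qpr _ iB.1) addbN addNb negbK.
  by rewrite addbC.
have [||e1 e2] := triangle_coord iT.1 ys pq h1 h2 c2 c3; last by rewrite e1 e2 in iB.
  by move=> [e1 e2]; apply: nTB; rewrite e1 e2 in iB; exact: isE_isoE iT iB.
by move=> [e1 e2]; apply: nAB; rewrite e1 e2 in iB; exact: isE_isoE iA iB.
Qed.

(** If both ideal triangles lay on the same side of T, noncrossing would make their third vertices
    coincide and A isomorphic to C. So they lie on opposite sides. *)
Lemma quad_vertices T (A B C D : obj) x y : isE T x y ->
  (exists v0 v2 w, [/\ (v0 = x /\ v2 = y) \/ (v0 = y /\ v2 = x), isE A v0 w, isE B v2 w &
    arc v0 v2 < arc v0 w]) ->
  (forall x y, isE T x y ->
    exists v0 v2 w, [/\ (v0 = x /\ v2 = y) \/ (v0 = y /\ v2 = x), isE C v0 w, isE D v2 w &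
    arc v0 v2 < arc v0 w]) ->
  compatible A D -> compatible C B -> ~ isomorphic A C ->
  exists v0 v1 v2 v3, [/\ quad v0 v1 v2 v3, isE T v0 v2, isE A v0 v3, isE B v2 v3 &
    isE C v1 v2 /\ isE D v0 v1].
Proof.
move=> iT [v0 [v2 [w [e iA iB l]]]] CD cAD cCB nAC.
have {x y e}iT : isE T v0 v2.
  by case: e => -[e1 e2]; move: iT; rewrite -e1 -e2 // => /isE_sym.
have e := arc_refl v0; have l0 := arc_gt0 iT.1.
have [u0 [u2 [z [[[-> ->]|[-> ->]] iC iD l']]]] := CD _ _ iT.
  have l1 : arc v0 v0 < arc v0 w by rewrite e; lra.
  have l2 : arc v0 v0 < arc v0 z by rewrite e; lra.
  have := compat_ncross iA iD cAD; have := compat_ncross iC iB cCB.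
  rewrite (cross_coord l1 l') (cross_coord l2 l) e => c1 c2.
  have wz : w = z by apply: (@arc_inj _ v0); lra.
  by case: nAC; rewrite -wz in iC; exact: isE_isoE iA iC.
exists v0, z, v2, w; split=> //; last by split=> //; exact: isE_sym.
rewrite /quad iD.1 l andbT /=.
move: l'; rewrite (arc_coord v0 v2 v0) (arc_coord v0 v2 z) e l0.
by have := arc_lt v0 z; case: (ltP (arc v0 z) (arc v0 v2)) => //; lra.
Qed.

End Triangle.

(** * Approximations, and the isomorphism of E(p, q) with its shift *)

Section Approximations.
Variables (k : fieldType) (R : realType).
Local Notation obj := (fobj k R).
Implicit Types (X Y Z W : obj) (S : set (set obj)).

Lemma fzero_is_zero : is_zero (fzero k R).
Proof. exact: zero_prk0. Qed.

Lemma in_add2 S X Y : S (iso_class X) -> S (iso_class Y) -> in_add S (fsum X Y).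
Proof.
move=> SX SY; exists (fzero k R), [:: X; Y]; split; first by case=> [|[|]].
apply: iso_trans (fsum0_r _ fzero_is_zero) (iso_sym _) => /=.
have [f fi] := fsum0_r Y fzero_is_zero.
exists (fdsum (fid X) f); apply: fdsum_iso => //; exact: stab_iso_id.
Qed.

(** Factorisations pass from the objects of S to finite sums componentwise, and then to direct
    summands. *)
Lemma left_approxI S X Y (f : fhom X Y) : in_add S Y ->
  (forall Z, S (iso_class Z) -> forall g : fhom X Z, exists h, g ==s fcomp h f) ->
  left_approx S f.
Proof.
move=> SY F; split=> // Z [Z' [s [Ss [p [q [qp _]]]]]] g.
have Fs : forall g : fhom X (foldr (@fsum k R) (fzero k R) s), exists h, g ==s fcomp h f.
  elim: s Ss {p q qp} => [|W s IH] Ss g' /=.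
    exists 0; rewrite fcomp0l -[g']fcomp1l.
    have /= -> : fid (fzero k R) ==s 0 := fzero_is_zero.
    by rewrite fcomp0l.
  have [g1 [g2 ->]] := fcolP g'.
  have [h1 e1] := F _ (Ss 0%N isT) g1.
  have [|h2 e2] := IH _ g2; first by move=> i; apply: (Ss i.+1).
  by exists (fcol h1 h2); rewrite fcolM e1 e2.
have [h e] := Fs (fcomp p (fcomp (fin1 Z Z') g)).
exists (fcomp (fpr1 Z Z') (fcomp q h)).
rewrite -!fcompA -e [fcomp q _]fcompA qp fcomp1l fcompA frow_col.
by rewrite fcomp1l fcomp0l addr0 fcomp1l.
Qed.

Lemma right_approxI S X Y (f : fhom X Y) : in_add S X ->
  (forall Z, S (iso_class Z) -> forall g : fhom Z Y, exists h, g ==s fcomp f h) ->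
  right_approx S f.
Proof.
move=> SY F; split=> // Z [Z' [s [Ss [p [q [qp _]]]]]] g.
have Fs : forall g : fhom (foldr (@fsum k R) (fzero k R) s) Y, exists h, g ==s fcomp f h.
  elim: s Ss {p q qp} => [|W s IH] Ss g' /=.
    exists 0; rewrite fcomp0r -[g']fcomp1r.
    have /= -> : fid (fzero k R) ==s 0 := fzero_is_zero.
    by rewrite fcomp0r.
  have [g1 [g2 ->]] := frowP g'.
  have [h1 e1] := F _ (Ss 0%N isT) g1.
  have [|h2 e2] := IH _ g2; first by move=> i; apply: (Ss i.+1).
  by exists (frow h1 h2); rewrite frowM e1 e2.
have [h e] := Fs (fcomp (fcomp g (fpr1 Z Z')) q).
exists (fcomp h (fcomp p (fin1 Z Z'))).
rewrite fcompA -e -!fcompA [fcomp q _]fcompA qp fcomp1l frow_col.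
by rewrite fcomp1l fcomp0l addr0 fcomp1r.
Qed.

(** On E(p, q) the differential is off-diagonal, so the diagonal matrix with entries 1 and -1
    anticommutes with it. *)
Lemma susp_iso X p q : isE X p q -> exists f : fhom (susp X) X, stab_iso f.
Proof.
move=> [pq [x [x' [x'x xx']]]].
have e : mat4 p q p q 1 0 0 (-1) \in @fcomm k R (susp (Eo k p q)) (Eo k p q).
  apply/eqP; rewrite /= /Eo_dif (negbTE pq) expr0 mat4N !mat4M.
  by rewrite !wrap_l !wrap_r !(mul0r, mulr0, mul1r, mulr1, add0r, addr0, oppr0, mulrN, mulNr, opprK).
have e' : mat4 p q p q 1 0 0 (-1) \in @fcomm k R (Eo k p q) (susp (Eo k p q)).
  apply/eqP; rewrite /= /Eo_dif (negbTE pq) expr0 mat4N !mat4M.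
  by rewrite !wrap_l !wrap_r !(mul0r, mulr0, mul1r, mulr1, add0r, addr0, oppr0, mulrN, mulNr, opprK).
exists (fcomp x' (fcomp (FHom e) (susp_map x))).
apply: stab_iso_comp; first by exists x.
apply: stab_iso_comp.
  exists (FHom e'); split; apply: stab_eqE; apply: fhomP; rewrite /= mat4M mat4_1;
  by rewrite !wrap_l !wrap_r !(mul0r, mulr0, mul1r, mulr1, add0r, addr0, oppr0, mulrN, mulNr, opprK, expr0).
by exists (susp_map x'); rewrite -!susp_mapM x'x xx' !susp_map1.
Qed.
End Approximations.

(** * The octahedron and the exchange triangles *)

Section OctahedronTriangles.
Variables (k : fieldType) (R : realType).
Local Notation obj := (fobj k R).
Variables (T A B C D T' : obj).
Variables (a : fhom T A) (b : fhom B T) (c : fhom A (susp B))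
  (f : fhom T C) (g : fhom D T) (h : fhom C (susp D)).
Hypotheses (bac : distinguished b a c) (gfh : distinguished g f h).

Lemma cone_comp_iso : isomorphic (cone (frow b g)) (cone (fcomp f b)).
Proof.
have [pC [pCi pCf _]] := dist_cone gfh (cone_is_cone g).
have [|z [zi _ _]] := cone_map_iso (cone_is_cone (fcomp f b)) (cone_jr b g)
  (stab_iso_id B) pCi.
  by rewrite fcomp1r fcompA pCf.
by apply: iso_sym; exists z.
Qed.

Let sums_subproof :
  pid k (psum B D) \in @fcomm _ _ (fsum (susp B) (susp D)) (susp (fsum B D)).
Proof. by apply/eqP; rewrite pcomp1l pcomp1r /= pcolN !prowN !oppr0. Qed.
Let sums : fhom (fsum (susp B) (susp D)) (susp (fsum B D)) := FHom sums_subproof.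

Let sums_col Z (x : fhom Z (susp B)) (y : fhom Z (susp D)) :
  fmx (fcomp sums (fcol x y)) = pcol (fmx x) (fmx y).
Proof. by rewrite /= pcomp1l. Qed.

Let sums_iso : stab_iso sums.
Proof.
have P : pid k (psum B D) \in @fcomm _ _ (susp (fsum B D)) (fsum (susp B) (susp D)).
  by apply/eqP; rewrite pcomp1l pcomp1r /= pcolN !prowN !oppr0.
by exists (FHom P); split; apply: stab_eqE; apply: fhomP; rewrite /= pcomp1l.
Qed.

(** All maps are those of the explicit octahedron on (b, g), conjugated by the identifications of A,
    C and T' with cones. The last two hypotheses say that z, s and r carry (b, g) to its shift; they
    turn the rotated triangle of (b, g) into one ending in B + D -> T. *)
Lemma octahedron_triangles (z : fhom T (susp T)) (s : fhom (susp B) B) (r : fhom (susp D) D) :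
  isomorphic T' (cone (frow b g)) ->
  stab_iso z -> stab_iso s -> stab_iso r ->
  fcomp z (fcomp b s) ==s susp_map b -> fcomp z (fcomp g r) ==s susp_map g ->
  exists (u : fhom C T') (u' : fhom T' (susp B)) (v : fhom A T') (v' : fhom T' (susp D))
    (w : fhom T' (susp T)) (w' : fhom T (susp T')),
  [/\ octahedron b a c g f h u u' v v',
      distinguished (fcol a f) (frow v (- u)) w &
      distinguished (fcol (fcomp s u') (fcomp r v')) (frow b g) w'].
Proof.
move=> [th [th' [thK thK']]] zi si ri zs zr.
have thi : stab_iso th by exists th'.
have [pA [pAi pAa pAc]] := dist_cone bac (cone_is_cone b).
have [pC [pCi pCf pCh]] := dist_cone gfh (cone_is_cone g).
have [w0 dw] := exact_dist (exact_jlr b g).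
pose u := fcomp th' (fcomp (jr b g) pC); pose v := fcomp th' (fcomp (jl b g) pA).
pose u' := fcomp (ql b g) th; pose v' := fcomp (qr b g) th.
have thu : fcomp th u ==s fcomp (jr b g) pC by rewrite fcompA thK' fcomp1l.
have thv : fcomp th v ==s fcomp (jl b g) pA by rewrite fcompA thK' fcomp1l.
have [s1 [s1K s1K']] := si; have [r1 [r1K r1K']] := ri.
exists u, u', v, v', (fcomp w0 th).
exists (fcomp (susp_map th') (fcomp (susp_map (cin (frow b g))) z)).
split.
- split=> //; [| |split|split].
  + apply: (dist_iso (cone_dist (cone_jr b g)) (stab_iso_id B) pCi thi) => //.
      by rewrite fcomp1r fcompA pCf.
    by rewrite susp_map1 fcomp1l.
  + apply: (dist_iso (cone_dist (cone_jl b g)) (stab_iso_id D) pAi thi) => //.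
      by rewrite fcomp1r fcompA pAa.
    by rewrite susp_map1 fcomp1l.
  + by rewrite /v /u -!fcompA pAa pCf jl_cin jr_cin.
  + by rewrite /u' /v' !fcompA ql_qr fcompNl.
  + by rewrite /u' -fcompA thv fcompA ql_jl.
  + by rewrite /v' -fcompA thu fcompA qr_jr.
- apply: (dist_iso dw (stab_iso_id T) (fdsum_iso pAi pCi) thi).
  + by rewrite fdsum_col fcomp1r pAa pCf.
  + by rewrite frowM row_fdsum fcompNr thv thu fcompNl.
  + by rewrite susp_map1 fcomp1l.
apply: (dist_iso (rotate (cone_is_cone (frow b g))) thi
  (stab_iso_comp sums_iso (fdsum_iso (ex_intro _ s (conj s1K' s1K)) (ex_intro _ r (conj r1K' r1K)))) zi).
- rewrite -fcompA fdsum_col !fcompA s1K r1K !fcomp1l; apply: stab_eqE; apply: fhomP.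
  rewrite sums_col /= -pcomp_col; congr pcomp.
  by rewrite pid_sum pcol_row pcol00.
- rewrite fcompA.
  have -> : fcomp (susp_map (frow b g)) sums = frow (susp_map b) (susp_map g).
    by apply: fhomP; rewrite /= pcomp1r.
  rewrite row_fdsum frowM; apply: stab_row.
    by rewrite -zs -!fcompA s1K' fcomp1r.
  by rewrite -zr -!fcompA r1K' fcomp1r.
- by rewrite fcompA -susp_mapM thK' susp_map1 fcomp1l.
Qed.
End OctahedronTriangles.

Section Mutation.
Variables (k : fieldType) (R : realType).
Local Notation obj := (fobj k R).
Local Open Scope classical_set_scope.
Implicit Types (X Y Z : obj) (p q r s t v : S1 R).

(** If q s belongs to the cluster, no element lies strictly between p q and p s about p, as
    [rot_irreducible] requires. *)
Lemma cross_btw p q s t : p != q -> arc p q < arc p t -> arc p t < arc p s ->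
  cross p t q s.
Proof.
move=> /arc_gt0 q0 qt ts; have e := arc_refl p.
have l1 : arc p p < arc p t by rewrite e; apply: lt_trans qt.
by rewrite (cross_coord l1 (lt_trans qt ts)) e q0 qt ts.
Qed.

Lemma stabZ_neq0 X Y (x : fhom X Y) e : ~ x ==s 0 -> ~ fpsC e *: x ==s 0 -> e != 0.
Proof. by move=> x0 n; apply/eqP => e0; apply: n; rewrite e0 fpsC0 scale0r. Qed.

(** As [Hom(susp B, susp T)] is a line, an isomorphism [susp B -> B] may be
    rescaled so that it is compatible with a given one on [T]. *)
Lemma susp_iso_compat X T p q r s (b : fhom X T) (z : fhom T (susp T)) :
  isE X p q -> isE T r s -> stab_iso z -> ~ b ==s 0 ->
  exists e : fhom (susp X) X, stab_iso e /\ fcomp z (fcomp b e) ==s susp_map b.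
Proof.
move=> iX iT zi b0; have [e ei] := susp_iso iX.
have n0 : ~ fcomp z (fcomp b e) ==s 0 by rewrite (comp_iso_l _ zi) (comp_iso_r _ ei).
have isX : isE (susp X) p q by apply: isE_iso iX (iso_sym _); exists e.
have isT : isE (susp T) r s by apply: isE_iso iT _; exists z.
have [d ed] := isE_dim1 (susp_map b) isX isT n0.
have sb0 : ~ susp_map b ==s 0.
  by move=> hb; apply: b0; apply/stab_susp; rewrite hb; apply: stab_eqE; apply: fhomP.
have d0 : d != 0 by apply: (stabZ_neq0 n0); rewrite -ed.
by exists (fpsC d *: e); split; [exact: stab_isoZ|rewrite !fcompZr -ed].
Qed.

Section InS.
Variables (S : set (set obj)) (T A B C D T' : obj) (v0 v1 v2 v3 : S1 R).
Hypotheses (Scl : is_cluster S) (Q : quad v0 v1 v2 v3).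
Hypotheses (iT : isE T v0 v2) (iA : isE A v0 v3) (iB : isE B v2 v3)
  (iC : isE C v1 v2) (iD : isE D v0 v1) (iT' : isE T' v1 v3).
Hypotheses (ST : S (iso_class T)) (SA : S (iso_class A)) (SB : S (iso_class B))
  (SC : S (iso_class C)) (SD : S (iso_class D)).
Let S' := exchange S T T'.
Let S0 : set (set obj) := S `\ iso_class T.

Let S0P X : S0 (iso_class X) <-> S (iso_class X) /\ ~ isomorphic X T.
Proof. by split=> -[h1 h2]; split=> // /iso_classP. Qed.

Let S0_nc X Y p q r s : S0 (iso_class X) -> isE X r s -> S (iso_class Y) -> isE Y p q ->
  ~~ cross p q r s.
Proof.
move=> /S0P [SX _] iX SY iY; apply: (compat_ncross iY iX).
by case: Scl => _ c _ _; apply: c.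
Qed.

Let S0_nc' X r s : S0 (iso_class X) -> isE X r s -> ~~ cross v1 v3 r s.
Proof. by move=> /S0P [SX nX]; exact: (diag_cross Scl Q iT iA iB iC iD SA SB SC SD iT'). Qed.

Let S0T' X : S0 (iso_class X) -> ~ isomorphic X T'.
Proof.
move=> /S0P [SX _] /iso_classP e; apply: (diag_notin Scl Q iT ST iT').
by rewrite -e.
Qed.

Let S0_isE X : S0 (iso_class X) -> exists p q, isE X p q.
Proof. by move=> /S0P [SX _]; exact: cluster_isE Scl SX. Qed.

Let S0sides : [/\ S0 (iso_class A), S0 (iso_class B), S0 (iso_class C) & S0 (iso_class D)].
Proof.
have [] := sides_neq Q iT iA iB iC iD.
by split; apply/S0P.
Qed.

Section Approx.
Variables (a : fhom T A) (f : fhom T C) (b : fhom B T) (g : fhom D T).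
Hypotheses (a0 : ~ a ==s 0) (f0 : ~ f ==s 0) (b0 : ~ b ==s 0) (g0 : ~ g ==s 0).

Lemma approx_T_l : left_approx S0 (fcol a f).
Proof.
have [A0 B0 C0 D0] := S0sides.
apply: left_approxI; first exact: in_add2.
move=> Z SZ x; have [r [s iZ]] := S0_isE SZ; have [_ nZ] := (S0P Z).1 SZ.
have [y [z E]] := left_quad Q x iT iA iC iZ nZ (S0_nc SZ iZ ST iT) (S0_nc SZ iZ SB iB)
  (S0_nc SZ iZ SD iD) a0 f0.
by exists (frow y z); rewrite E frow_col.
Qed.

Lemma approx_T_r : right_approx S0 (frow b g).
Proof.
have [A0 B0 C0 D0] := S0sides.
apply: right_approxI; first exact: in_add2.
move=> Z SZ x; have [r [s iZ]] := S0_isE SZ; have [_ nZ] := (S0P Z).1 SZ.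
have [y [z E]] := right_quad Q x iT iB iD iZ nZ (S0_nc SZ iZ ST iT) (S0_nc SZ iZ SA iA)
  (S0_nc SZ iZ SC iC) b0 g0.
by exists (fcol y z); rewrite E frow_col.
Qed.
End Approx.

Section ApproxT'.
Variables (x : fhom T' B) (y : fhom T' D) (u : fhom C T') (v : fhom A T').
Hypotheses (x0 : ~ x ==s 0) (y0 : ~ y ==s 0) (u0 : ~ u ==s 0) (v0' : ~ v ==s 0).

Lemma approx_T'_l : left_approx S0 (fcol x y).
Proof.
have [A0 B0 C0 D0] := S0sides.
apply: left_approxI; first exact: in_add2.
move=> Z SZ w; have [r [s iZ]] := S0_isE SZ; have nZ := S0T' SZ.
have [y' [z E]] := left_quad (quad_rot Q) w iT' (isE_sym iD) iB iZ nZ (S0_nc' SZ iZ)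
  (S0_nc SZ iZ SA (isE_sym iA)) (S0_nc SZ iZ SC iC) y0 x0.
by exists (frow z y'); rewrite E frow_col addrC.
Qed.

Lemma approx_T'_r : right_approx S0 (frow v (- u)).
Proof.
have [A0 B0 C0 D0] := S0sides.
apply: right_approxI; first exact: in_add2.
move=> Z SZ w; have [r [s iZ]] := S0_isE SZ; have nZ := S0T' SZ.
have [y' [z E]] := right_quad (quad_rot Q) w iT' (isE_sym iA) iC iZ nZ (S0_nc' SZ iZ)
  (S0_nc SZ iZ SD (isE_sym iD)) (S0_nc SZ iZ SB iB) v0' u0.
by exists (fcol y' (- z)); rewrite E frow_col fcompNl fcompNr opprK.
Qed.
End ApproxT'.

Let S'E X : S' (iso_class X) <-> S0 (iso_class X) \/ isomorphic X T'.
Proof. by rewrite /S' exchangeP S0P. Qed.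

Let S'_isE X : S' (iso_class X) -> exists p q, isE X p q.
Proof.
case/S'E => [/S0_isE //|/iso_sym e].
by exists v1, v3; apply: isE_iso iT' e.
Qed.

Let S'T' : S' (iso_class T').
Proof. by apply/S'E; right; apply: iso_refl. Qed.

Let S'nc X Y p q r s : S' (iso_class X) -> S' (iso_class Y) -> isE X p q -> isE Y r s ->
  cross p q r s -> False.
Proof.
move=> hX hY iX iY; apply/negP; apply: (compat_ncross iX iY).
by case: (exchange_cluster Scl Q iT iA iB iC iD ST SA SB SC SD iT') => _ + _ _; apply.
Qed.

Lemma side_irreducible X Y W p q s (x : fhom X Y) : S' (iso_class X) -> S' (iso_class Y) ->
  isE X p q -> isE Y p s -> arc p q < arc p s -> S' (iso_class W) -> isE W q s ->
  ~ x ==s 0 -> irreducible S' x.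
Proof.
move=> SX SY iX iY qs SW iW; apply: (rot_irreducible S'_isE SX SY iX iY qs).
move=> Z t SZ iZ qt ts.
exact: (S'nc SZ SW iZ iW (cross_btw iX.1 qt ts)).
Qed.

(** Strictly between B and C about v2, every geodesic other than v2 v0 crosses A or D; v2 v0 is T
    itself, which has been removed. *)
Lemma comp_irreducible (x : fhom B C) : ~ x ==s 0 -> irreducible S' x.
Proof.
have [A0 B0 C0 D0] := S0sides.
have [SA' SB' SC' SD'] : [/\ S' (iso_class A), S' (iso_class B), S' (iso_class C) &
  S' (iso_class D)] by split; apply/S'E; left.
have /and3P [n23 l1 l2] := quad_rot (quad_rot Q).
apply: (rot_irreducible S'_isE SB' SC' iB (isE_sym iC) (lt_trans l1 l2)).
move=> Z t SZ iZ qt ts.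
have [t0|t0] := eqVneq t v0.
  have eZ : isomorphic Z T by rewrite t0 in iZ; exact: isE_isoE iZ (isE_sym iT).
  case/S'E: SZ => [/S0P [] //|eZ']; apply: (diag_notin Scl Q iT ST iT').
  by have /iso_classP <- := iso_trans (iso_sym eZ) eZ'.
have : arc v2 t != arc v2 v0 by rewrite (inj_eq (@arc_inj _ v2)).
rewrite neq_lt => /orP [h|h].
  exact: (S'nc SZ SA' iZ (isE_sym iA) (cross_btw n23 qt h)).
have n20 : v2 != v0 by rewrite eq_sym; case: iT.
exact: (S'nc SZ SD' iZ iD (cross_btw n20 h ts)).
Qed.

(** C, T' and B are the sides of an ideal triangle, so [side_irreducible] applies to each rotation
    with the remaining side as obstacle. *)
Lemma rot_irr (x : fhom C T') (y : fhom T' B) :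
  (~ x ==s 0 -> irreducible S' x) /\ (~ y ==s 0 -> irreducible S' y).
Proof.
have [A0 B0 C0 D0] := S0sides.
have [SA' SB' SC' SD'] : [/\ S' (iso_class A), S' (iso_class B), S' (iso_class C) &
  S' (iso_class D)] by split; apply/S'E; left.
have /and3P [_ _ l1] := quad_rot (quad_rot (quad_rot Q)).
have /and3P [_ l2 _] := quad_rot Q.
split; first exact: (side_irreducible SC' S'T' iC iT' l2 SB' iB).
exact: (side_irreducible S'T' SB' (isE_sym iT') (isE_sym iB) l1 SC' iC).
Qed.
End InS.
End Mutation.

Section Main.
Variables (k : fieldType) (R : realType).
Local Notation obj := (fobj k R).
Local Open Scope classical_set_scope.

Lemma quad_of_triangles (S : set (set obj)) (T A B C D : obj)
    (a : fhom T A) (b : fhom B T) (c : fhom A B)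
    (f : fhom T C) (g : fhom D T) (h : fhom C D) :
  is_cluster S -> ~ isomorphic A B -> ~ isomorphic A C -> ~ isomorphic C D ->
  irreducible S a -> irreducible S b -> irreducible S c ->
  irreducible S f -> irreducible S g -> irreducible S h ->
  exists v0 v1 v2 v3, [/\ quad v0 v1 v2 v3, isE T v0 v2, isE A v0 v3, isE B v2 v3 &
    isE C v1 v2 /\ isE D v0 v1].
Proof.
move=> Scl nAB nAC nCD [ST SA a0 na _] [SB _ b0 nb _] [_ _ c0 _ _].
move=> [_ SC f0 nf _] [SD _ g0 ng _] [_ _ h0 _ _].
have isX X : S (iso_class X) -> exists p q, isE X p q by exact: cluster_isE.
have cp X Y : S (iso_class X) -> S (iso_class Y) -> compatible X Y.
  by case: Scl => _ + _ _; apply.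
have [x [y iT]] := isX _ ST.
have nTA : ~ isomorphic T A by move=> e; apply: na; exact: isE_isoP iT e a0.
have nTC : ~ isomorphic T C by move=> e; apply: nf; exact: isE_isoP iT e f0.
have nTB : ~ isomorphic T B.
  by move=> /iso_sym e; apply: nb; exact: isE_isoP (isE_iso iT (iso_sym e)) e b0.
have nTD : ~ isomorphic T D.
  by move=> /iso_sym e; apply: ng; exact: isE_isoP (isE_iso iT (iso_sym e)) e g0.
apply: (quad_vertices iT _ _ (cp _ _ SA SD) (cp _ _ SC SB) nAC).
  exact: (triangle_vertices iT (isX _ SA) (isX _ SB) (cp _ _ ST SA) (cp _ _ ST SB)
    (cp _ _ SA SB) nTA nTB nAB a0 b0 c0).
move=> x' y' iT'.
exact: (triangle_vertices iT' (isX _ SC) (isX _ SD) (cp _ _ ST SC) (cp _ _ ST SD)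
    (cp _ _ SC SD) nTC nTD nCD f0 g0 h0).
Qed.
End Main.

Theorem proposition5p2p1 (k : fieldType) (R : realType)
    (S : set (set (fobj k R))) (T A B C D : fobj k R)
    (a : fhom T A) (b : fhom B T) (c : fhom A (susp B))
    (f : fhom T C) (g : fhom D T) (h : fhom C (susp D))
    (S_cluster : is_cluster S) (T_in_S : S (iso_class T))
    (ABCD_noniso :
       [/\ ~ isomorphic A B, ~ isomorphic A C & ~ isomorphic A D] /\
       [/\ ~ isomorphic B C, ~ isomorphic B D & ~ isomorphic C D])
    (a_irr : irreducible S a) (f_irr : irreducible S f)
    (b_irr : irreducible S b) (g_irr : irreducible S g)
    (irr_from_T : forall (X : fobj k R) (x : fhom T X),
       irreducible S x -> eq_target a x \/ eq_target f x)
    (irr_to_T : forall (X : fobj k R) (x : fhom X T),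
       irreducible S x -> eq_source b x \/ eq_source g x)
    (triangle_bac : distinguished b a c)
    (triangle_gfh : distinguished g f h)
    (c_irr : exists s : fhom (susp B) B, irreducible_susp S s c)
    (h_irr : exists s : fhom (susp D) D, irreducible_susp S s h) :
  (exists T' : fobj k R,
     [/\ ~ isomorphic T' T, is_cluster (exchange S T T')
       & forall T'' : fobj k R, ~ isomorphic T'' T ->
           is_cluster (exchange S T T'') -> isomorphic T'' T']) /\
  (forall T' : fobj k R, ~ isomorphic T' T -> is_cluster (exchange S T T') ->
     let S' := exchange S T T' in
     let S0 := (S `\ iso_class T)%classic in
     exists (u : fhom C T') (u' : fhom T' (susp B))
            (v : fhom A T') (v' : fhom T' (susp D))
            (w : fhom T' (susp T))
            (s : fhom (susp B) B) (r : fhom (susp D) D)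
            (w' : fhom T (susp T')),
       [/\ octahedron b a c g f h u u' v v',
           distinguished (fcol a f) (frow v (- u)%R) w
             /\ distinguished (fcol (fcomp s u') (fcomp r v')) (frow b g) w',
           left_approx S0 (fcol a f) /\ right_approx S0 (frow v (- u)%R),
           left_approx S0 (fcol (fcomp s u') (fcomp r v'))
             /\ right_approx S0 (frow b g)
         & [/\ irreducible S' (fcomp f b), irreducible S' u
             & irreducible_susp S' s u']
             /\ [/\ irreducible S' (fcomp a g), irreducible S' v
                  & irreducible_susp S' r v']]).
Proof.
have [[nAB nAC _] [_ _ nCD]] := ABCD_noniso.
have [sc [sci sc_irr]] := c_irr; have [sh [shi sh_irr]] := h_irr.
have [v0 [v1 [v2 [v3 [Q iT iA iB [iC iD]]]]]] := quad_of_triangles S_cluster nAB nAC nCD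
  a_irr b_irr sc_irr f_irr g_irr sh_irr.
have [_ SA a0 _ _] := a_irr; have [_ SC f0 _ _] := f_irr.
have [SB _ b0 _ _] := b_irr; have [SD _ g0 _ _] := g_irr.
have c0 : ~ c ==s 0 by rewrite -(comp_iso_l _ sci); case: sc_irr.
have h0 : ~ h ==s 0 by rewrite -(comp_iso_l _ shi); case: sh_irr.
have [_ [_ n13 _]] := quad_neq Q.
split.
  have iT' := isE_Eo k n13; exists (Eo k v1 v3); split.
  - move=> /iso_classP e; apply: (diag_notin S_cluster Q iT T_in_S iT').
    by rewrite e.
  - exact: (exchange_cluster S_cluster Q iT iA iB iC iD).
  - move=> T'' nT cl; apply: isE_isoE iT'.
    exact: (exchange_diag S_cluster Q iT iA iB iC iD T_in_S SA SB SC SD nT cl).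
move=> T' nT' cl S' S0.
have iT' := exchange_diag S_cluster Q iT iA iB iC iD T_in_S SA SB SC SD nT' cl.
have Q1 := quad_rot Q; have Q2 := quad_rot Q1; have Q3 := quad_rot Q2.
have /and3P [_ /ltW l1 /ltW l2] := Q; have /and3P [_ /ltW l3 /ltW l4] := Q2.
have fb0 : ~ fcomp f b ==s 0.
  exact: (rot_comp iB (isE_sym iT) (isE_sym iC) l3 l4 b0 f0).
have ag0 : ~ fcomp a g ==s 0 by exact: (rot_comp iD iT iA l1 l2 g0 a0).
(* The map f b rotates B = v2 v3 to C = v2 v1, so its cone is v3 v1. *)
have isoV : isomorphic T' (cone (frow b g)).
  apply: iso_trans (iso_sym (cone_comp_iso b triangle_gfh)).
  apply: isE_isoE iT' (isE_sym _); apply: (isE_cone iB (isE_sym iC)) => //.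
    by rewrite eq_sym.
  by rewrite wrapE; apply/negbTE; rewrite -leNgt (le_trans l3).
have [z0 z0i] := susp_iso iT; have [z [zK zK']] := z0i.
have zi : stab_iso z by exists z0.
have [s [si es]] := susp_iso_compat iB iT zi b0.
have [r [ri er]] := susp_iso_compat iD iT zi g0.
have [u [u' [v [v' [w [w' [oct d1 d2]]]]]]] :=
  octahedron_triangles triangle_bac triangle_gfh isoV zi si ri es er.
have [_ _ _ _ [u'v v'u]] := oct.
(* The new maps are nonzero because v' u = h and u' v = c in the octahedron. *)
have u0 : ~ u ==s 0 by move=> e; apply: h0; rewrite -v'u e fcomp0r.
have v'0 : ~ v' ==s 0 by move=> e; apply: h0; rewrite -v'u e fcomp0l.
have vN0 : ~ v ==s 0 by move=> e; apply: c0; rewrite -u'v e fcomp0r.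
have u'0 : ~ u' ==s 0 by move=> e; apply: c0; rewrite -u'v e fcomp0l.
have su0 : ~ fcomp s u' ==s 0 by rewrite (comp_iso_l _ si).
have rv0 : ~ fcomp r v' ==s 0 by rewrite (comp_iso_l _ ri).
have iT'2 := isE_sym iT'; have iT2 := isE_sym iT.
have iA2 := isE_sym iA; have iC2 := isE_sym iC.
exists u, u', v, v', w, s, r, w'; split=> //.
- split; first exact: (approx_T_l S_cluster Q iT iA iB iC iD).
  exact: (approx_T'_r S_cluster Q iT iA iB iC iD iT').
- split; last exact: (approx_T_r S_cluster Q iT iA iB iC iD).
  exact: (approx_T'_l S_cluster Q iT iA iB iC iD iT').
have [iu iu'] := rot_irr S_cluster Q iT iA iB iC iD iT' T_in_S SA SB SC SD u (fcomp s u').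
(* A half-turn of the quadrilateral exchanges A with C and B with D. *)
have [iv iv'] := rot_irr S_cluster Q2 iT2 iC2 iD iA2 iB iT'2 T_in_S SC SD SA SB v (fcomp r v').
split; split=> //.
- exact: (comp_irreducible S_cluster Q iT iA iB iC iD iT').
- exact: iu.
- by split=> //; apply: iu'.
- exact: (comp_irreducible S_cluster Q2 iT2 iC2 iD iA2 iB iT'2).
- exact: iv.
- by split=> //; apply: iv'.
Qed.
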